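(* Fix $\omega>0$, $H>0$, $\lambda_0,\mu_0$, $\mu(0)$, $\mu'(0)$ and the matrix $G^H$ (and hence the background potential $Q_0$ of the context). For $i=1,2$ let $V_i$ be a real $2\times2$ matrix-valued function, compactly supported on $[0,H]$ and belonging to $L^1([0,H])$, and let $\mathbf M_i$ be the Weyl matrix associated with the potential $Q_0+V_i$. Suppose that both $\mathbf M_1$ and $\mathbf M_2$ satisfy Assumptions (A) and (B) of the context. If $\mathbf M_2(\xi)=\mathbf M_1(\xi)$ for all $\xi\in\mathcal K_+$, then $V_2=V_1$.
   Context: Constants. $\mu_0>0$, $2\mu_0+3\lambda_0>0$, $\mu(0)>0$, $c_0=\frac{\lambda_0+\mu_0}{\lambda_0+2\mu_0}$; $G^H=(G^H_{jk})$ is a real $2\times2$ matrix with $\det G^H=1$. A prime denotes $d/dx$. Background potential, for $x\ge0$ (linear in $x$): $$Q_0(x)=\omega^2\begin{pmatrix}-\frac1{\mu_0}&0\\ 0&-\frac1{\lambda_0+2\mu_0}\end{pmatrix}+\omega^2\frac{c_0}{\mu_0}\begin{pmatrix}-G^H_{12}\,g_{21}(x)&G^H_{11}\,g_{21}(x)\\ -G^H_{12}\,g_{22}(x)&G^H_{12}\,g_{21}(x)\end{pmatrix},$$ where $g_{21}(x)=-\frac{c_0}2G^H_{11}(x-H)+G^H_{21}$ and $g_{22}(x)=-\frac{c_0}2G^H_{12}(x-H)+G^H_{22}$. Boundary matrix. With the $i$-th problem is associated $$\Theta_i(\xi)=\begin{pmatrix}-\frac{\mu'(0)}{\mu(0)}&\frac1{2\mu_0}\frac{\mu^2(0)}{\lambda(0)+2\mu(0)}\\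 \frac{\mu_0}{\mu(0)}\left(2\xi^2-\frac{\omega^2}{\mu(0)}-\mu(0)\left(\frac1\mu\right)''(0)\right)&0\end{pmatrix},$$ where $\mu(0),\mu'(0)$ are the given common values, while the real values $\lambda(0)$ (with $2\mu(0)+3\lambda(0)>0$) and $\mu''(0)$ belong to the $i$-th problem; $\left(\frac1\mu\right)''=-\frac{\mu''}{\mu^2}+\frac{2(\mu')^2}{\mu^3}$. Quasi-momenta. $\mathcal K=\mathbb C\setminus\left(\left[-\frac{\omega}{\sqrt{\mu_0}},\frac{\omega}{\sqrt{\mu_0}}\right]\cup \mathrm i\mathbb R\right)$, $\mathcal K_+=\{\xi\in\mathcal K:\operatorname{Re}\xi>0\}$. On $\mathcal K$, $q_S(\xi)=\sqrt{\omega^2/\mu_0-\xi^2}$ and $q_P(\xi)=\sqrt{\omega^2/(\lambda_0+2\mu_0)-\xi^2}$ denote the analytic branches that lie in $\mathrm i\mathbb R_+$ for real $\xi>\omega/\sqrt{\mu_0}$ and in $\mathrm i\mathbb R_-$ for real $\xi<-\omega/\sqrt{\mu_0}$; thus $\operatorname{Im}q_S,\operatorname{Im}q_P>0$ on $\mathcal K_+$. Jost solution and Weyl matrix. Put $$F^+_{P,0}=\begin{pmatrix}g_{21}(x)+\mathrm iq_P\frac{\mu_0}{\omega^2}G^H_{11}\\ g_{22}(x)+\mathrm iq_P\frac{\mu_0}{\omega^2}G^H_{12}\end{pmatrix}e^{\mathrm ixq_P},\qquad F^+_{S,0}=-\mu_0\frac{\xi}{\omega^2}\begin{pmatrix}G^H_{11}\\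 G^H_{12}\end{pmatrix}e^{\mathrm ixq_S}.$$ For a potential $V_i$, the matrix Jost solution $\mathbf F_i(x,\xi)$ is the solution of $-\mathbf F''+(Q_0+V_i)\mathbf F=-\xi^2\mathbf F$ on $(0,\infty)$ with $\mathbf F=[F^+_{P,0}\ F^+_{S,0}]$ for $x\ge H$. The Weyl matrix is $\mathbf M_i(\xi)=\mathbf F_i(0,\xi)\left[\mathbf F_i'(0,\xi)+\Theta_i(\xi)\mathbf F_i(0,\xi)\right]^{-1}$, meromorphic on $\mathcal K_+$. Assumption (A): the poles of $\mathbf M$ in $\mathcal K_+$ are simple. Assumption (B): $\mathbf M$ has no pole with $\operatorname{Im}q_S=0$ (i.e. on the boundary of $\mathcal K_+$, approached from $\mathcal K_+$) except, possibly, at $\xi=\omega/\sqrt{\mu_0}$. *)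

(* Defs.v *)
From HB Require Import structures.
From mathcomp Require Import all_boot all_order all_algebra.
From mathcomp Require Import complex.
From mathcomp Require Import all_classical all_reals all_analysis.

Set Implicit Arguments.
Unset Strict Implicit.
Unset Printing Implicit Defensive.

Import Order.TTheory GRing.Theory Num.Theory.
Import numFieldNormedType.Exports.

Local Open Scope classical_set_scope.
Local Open Scope ring_scope.
Local Open Scope complex_scope.

(* Rows and columns 1, 2 of the 2 x 2 matrices are indexed by 0, 1 : 'I_2. *)
Definition mx2 (T : Type) (a11 a12 a21 a22 : T) : 'M[T]_2 :=
  \matrix_(i, j) if i == 0 then (if j == 0 then a11 else a12)
                 else (if j == 0 then a21 else a22).

Definition cexp (R : realType) (z : R[i]) : R[i] :=
  (expR (complex.Re z) * cos (complex.Im z)) +i*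
  (expR (complex.Re z) * sin (complex.Im z)).

(* The data shared by the two problems; [mu_s] and [dmu_s] are the surface
   values mu(0) and mu'(0). *)
Record background (R : realType) := Background {
  omega : R;
  depth : R;
  lambda0 : R;
  mu0 : R;
  mu_s : R;
  dmu_s : R;
  GH : 'M[R]_2
}.

(* The data of one problem; [lambda_s] and [ddmu_s] are lambda(0) and mu''(0),
   [pot] is the perturbation V of the background potential. *)
Record problem (R : realType) := Problem {
  lambda_s : R;
  ddmu_s : R;
  pot : R -> 'M[R]_2
}.

Section Definitions.
Variables (R : realType) (b : background R).

Local Notation H := (depth b).
Local Notation G11 := (GH b 0 0).
Local Notation G12 := (GH b 0 1).
Local Notation G21 := (GH b 1 0).
Local Notation G22 := (GH b 1 1).

Definition c0 : R := (lambda0 b + mu0 b) / (lambda0 b + 2 * mu0 b).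

Definition g21 (x : R) : R := - (c0 / 2) * G11 * (x - H) + G21.
Definition g22 (x : R) : R := - (c0 / 2) * G12 * (x - H) + G22.

Definition Q0 (x : R) : 'M[R]_2 :=
  omega b ^+ 2 *: mx2 (- (mu0 b)^-1) 0
                      0 (- (lambda0 b + 2 * mu0 b)^-1)
  + (omega b ^+ 2 * (c0 / mu0 b)) *:
      mx2 (- G12 * g21 x) (G11 * g21 x)
          (- G12 * g22 x) (G12 * g21 x).

Definition xiS : R := omega b / Num.sqrt (mu0 b).

Definition K : set R[i] :=
  [set xi | ~ (complex.Im xi = 0 /\ - xiS <= complex.Re xi <= xiS)
            /\ complex.Re xi <> 0].

Definition Kplus : set R[i] := K `&` [set xi | 0 < complex.Re xi].

(* [q] is the analytic branch on K of sqrt (omega^2 / m - xi^2); q_S is the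
   case m = mu0 and q_P the case m = lambda0 + 2 mu0. *)
Definition quasi_momentum (m : R) (q : R[i] -> R[i]) : Prop :=
  [/\ forall xi, K xi -> derivable (q : R[i]^o -> R[i]^o) xi 1,
      forall xi, K xi -> q xi ^+ 2 = (omega b ^+ 2 / m)%:C - xi ^+ 2,
      forall x : R, xiS < x ->
        complex.Re (q x%:C) = 0 /\ 0 < complex.Im (q x%:C)
    & forall x : R, x < - xiS ->
        complex.Re (q x%:C) = 0 /\ complex.Im (q x%:C) < 0].

Definition is_qS := quasi_momentum (mu0 b).
Definition is_qP := quasi_momentum (lambda0 b + 2 * mu0 b).

Definition Theta (p : problem R) (xi : R[i]) : 'M[R[i]]_2 :=
  let ddinvmu := - (ddmu_s p / mu_s b ^+ 2)
                 + 2 * dmu_s b ^+ 2 / mu_s b ^+ 3 in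
  mx2 (- (dmu_s b / mu_s b))%:C
      ((2 * mu0 b)^-1 * (mu_s b ^+ 2 / (lambda_s p + 2 * mu_s b)))%:C
      ((mu0 b / mu_s b)%:C *
         (2 * xi ^+ 2 - (omega b ^+ 2 / mu_s b)%:C - (mu_s b * ddinvmu)%:C))
      0.

(* The matrix [F^+_{P,0}  F^+_{S,0}] at xi, where qP and qS are the values of
   the quasi-momenta at xi. *)
Definition F0 (qP qS xi : R[i]) (x : R) : 'M[R[i]]_2 :=
  let eP := cexp ('i * x%:C * qP) in
  let eS := cexp ('i * x%:C * qS) in
  let kP := 'i * qP * (mu0 b / omega b ^+ 2)%:C in
  let kS := - ((mu0 b)%:C * (xi / (omega b ^+ 2)%:C)) in
  mx2 (((g21 x)%:C + kP * G11%:C) * eP) (kS * G11%:C * eS)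
      (((g22 x)%:C + kP * G12%:C) * eP) (kS * G12%:C * eS).

(* [f] is locally absolutely continuous on [0, +oo) with a.e. derivative [g],
   i.e. [f] is an indefinite Lebesgue integral of the locally integrable [g]. *)
Definition ac_deriv (f g : R -> R[i]) : Prop :=
  forall x y : R, 0 <= x -> x <= y ->
  [/\ lebesgue_measure.-integrable `[x, y] (fun t => (complex.Re (g t))%:E),
      lebesgue_measure.-integrable `[x, y] (fun t => (complex.Im (g t))%:E)
    & f y - f x =
        (\int[lebesgue_measure]_(t in `[x, y]) complex.Re (g t))%R +i*
        (\int[lebesgue_measure]_(t in `[x, y]) complex.Im (g t))%R].

Definition ac_deriv_mx (F F' : R -> 'M[R[i]]_2) : Prop :=
  forall i j, ac_deriv (fun x => F x i j) (fun x => F' x i j).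

(* [F], with derivative [F'], is the matrix Jost solution at xi for the
   potential Q0 + V.  As V is merely L^1, the equation is meant in the sense of
   Caratheodory: F and F' are locally absolutely continuous up to 0 and the
   equation holds almost everywhere. *)
Definition is_jost (p : problem R) (qP qS xi : R[i])
    (F F' : R -> 'M[R[i]]_2) : Prop :=
  [/\ ac_deriv_mx F F',
      exists F'' : R -> 'M[R[i]]_2,
        ac_deriv_mx F' F'' /\
        {ae lebesgue_measure, forall x : R, 0 < x ->
           - F'' x + map_mx (real_complex R) (Q0 x + pot p x) *m F x
           = - xi ^+ 2 *: F x}
    & forall x, H <= x -> F x = F0 qP qS xi x].

(* [M] represents the meromorphic Weyl matrix on K_+.  Where the denominator is
   singular the value of [M] is left free: this concerns a discrete set of
   points, containing the poles. *)
Definition is_weyl (qP qS : R[i] -> R[i]) (p : problem R)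
    (M : R[i] -> 'M[R[i]]_2) : Prop :=
  forall xi, Kplus xi ->
  exists F F' : R -> 'M[R[i]]_2,
    is_jost p (qP xi) (qS xi) xi F F' /\
    let D := F' 0 + Theta p xi *m F 0 in
    (D \in unitmx -> M xi = F 0 *m invmx D).

Definition pole_of_order (n : nat) (M : R[i] -> 'M[R[i]]_2) (xi0 : R[i]) :=
  (0 < n)%N /\
  exists g : R[i] -> 'M[R[i]]_2,
  [/\ \forall xi \near (xi0 : R[i]^o), forall i j,
        derivable ((fun z => g z i j) : R[i]^o -> R[i]^o) xi 1,
      g xi0 != 0
    & \forall xi \near (xi0 : R[i]^o)^', M xi = (xi - xi0) ^- n *: g xi].

Definition assumptionA (M : R[i] -> 'M[R[i]]_2) : Prop :=
  forall xi0 n, Kplus xi0 -> pole_of_order n M xi0 -> n = 1%N.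

(* M has a pole at the boundary point xi0 approached from the region D. *)
Definition boundary_pole (D : set R[i]) (M : R[i] -> 'M[R[i]]_2)
    (xi0 : R[i]) : Prop :=
  exists i j,
    complex.Re `|M xi i j| @[xi --> within D (nbhs (xi0 : R[i]^o))] --> +oo.

Definition Kplus_upper : set R[i] := Kplus `&` [set xi | 0 < complex.Im xi].
Definition Kplus_lower : set R[i] := Kplus `&` [set xi | complex.Im xi < 0].

(* The cut (0, omega / sqrt mu0] is a two-sided part of the boundary of K_+, on
   whose sides q_S has opposite limits; so boundary points are approached
   separately from the upper and from the lower half of K_+. *)
Definition assumptionB (qS : R[i] -> R[i]) (M : R[i] -> 'M[R[i]]_2) : Prop :=
  forall (D : set R[i]) (xi0 : R[i]),
    D = Kplus_upper \/ D = Kplus_lower ->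
    closure (D : set R[i]^o) xi0 ->
    complex.Im (qS xi) @[xi --> within D (nbhs (xi0 : R[i]^o))] --> (0 : R) ->
    boundary_pole D M xi0 -> xi0 = xiS%:C.

Definition admissible (p : problem R) : Prop :=
  [/\ 0 < 2 * mu_s b + 3 * lambda_s p,
      forall x, ~ (0 <= x <= H) -> pot p x = 0
    & forall i j, lebesgue_measure.-integrable `[0, H]
                    (fun x => (pot p x i j)%:E)].

End Definitions.

(* Main.v *)
(** A local Borg-Marchenko argument along the quasi-momenta xi = n / 2, n a large
    natural number, where all data are real up to the embedding in R[i].

    Put Q_i = Q0 + V_i and L = H.  The functions e^{xi (x - L)} F solve
    u'' - n u' = Q_i u, which also has a solution phi_i with phi_i(L) = 1,
    phi_i'(L) = 0 of the form phi_i(x) = 1 + int e^{-n s} k_i(x, s) ds with k_i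
    bounded and supported in x + s <= L.  Let phi_1^T stand for the solution of
    the transposed problem.  The Wronskian identity equates
      J(n) = int_0^L e^{-n x} phi_1^T(x) (V_2 - V_1)(x) phi_2(x) dx
    with boundary terms at 0, in which phi_i' can be replaced by
    (F_i' F_i^{-1} + xi) phi_i up to O(e^{-n L}).  As M_i^{-1} = F_i' F_i^{-1} +
    Theta_i at 0, the equality of the Weyl matrices gives
      J(n) = phi_1^T (Theta_2 - Theta_1) phi_2 (0) + O(e^{-n L}),
    where Theta_2 - Theta_1 does not depend on xi.  Letting n tend to infinity,
    Theta_1 = Theta_2; so J(n) = O(e^{-n L}).  Expanding the product, J is a
    Laplace transform, and the Mikusinski inversion
    1 - exp(- e^{n (t - tau)}) -> 1_{tau < t}, which only uses the values at
    integer multiples of n, shows that its mass on [0, t) vanishes for t < L.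
    This is a homogeneous Volterra equation for V_2 - V_1. *)
From HB Require Import structures.
Require Import Defs.
From mathcomp Require Import all_boot all_order all_algebra.
From mathcomp Require Import complex ring lra.
From mathcomp Require Import all_classical all_reals all_analysis.
From mathcomp Require Import measurable_realfun.
Import Order.TTheory GRing.Theory Num.Theory.
Import numFieldNormedType.Exports.
Set Implicit Arguments.
Unset Strict Implicit.
Unset Printing Implicit Defensive.
Local Open Scope classical_set_scope.
Local Open Scope ring_scope.

(** At real [xi] above [xiS] the quasi-momenta are purely imaginary and the potential is real, so
    the Jost solution is real and most of the argument concerns real matrices. Three obstacles shape
    it. First, [V] is only integrable: equations are integral identities, and several limits come
    from dominated convergence, without a rate. Second, an entry of [Theta] grows like [xi ^+ 2],
    the order of the determinant of the free part, and the Weyl matrix is unspecified where its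
    denominator is singular. Invertibility at large [xi] thus needs a computation, whose leading
    coefficient (lambda(0) + mu(0)) / (lambda(0) + 2 mu(0)) is positive by the Lame condition at the
    surface. Third, J has to be a Laplace transform in n with a fixed density, so the kernels k_i
    must not depend on n; they are built once, as Neumann series, and the Jost solution meets phi_i
    only through Wronskians. At x = H the matrix F' F^{-1} + xi is read off the background: it is
    the same for both problems and stays bounded as [xi] grows, which is why the errors are O(e^{-n
    L}). *)

Section RealIntegrals.
Context {d} {T : measurableType d} {R : realType}.
Variable m : {measure set T -> \bar R}.
Implicit Types f g h : T -> R.

(** Integrals run over the whole space; intervals and regions are encoded as indicator factors of
    the integrand, so that one form of linearity, Fubini and dominated convergence serves
    throughout. *)
Definition rintegrable f := m.-integrable setT (EFin \o f).

Lemma rintegrable_eq f g : f =1 g -> rintegrable f -> rintegrable g.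
Proof. by move=> /funext ->. Qed.

Lemma rintegrable_meas f : rintegrable f -> measurable_fun setT f.
Proof. by move=> /integrableP[/measurable_EFinP]. Qed.

Lemma rintegrable_le f g : measurable_fun setT f -> rintegrable g ->
  (forall x, `|f x| <= g x) -> rintegrable f.
Proof.
move=> mf ig fg; apply: (le_integrable measurableT _ _ ig).
  exact/measurable_EFinP.
by move=> x _ /=; rewrite lee_fin (le_trans (fg x))// ler_norm.
Qed.

Lemma rintegrable_norm f : rintegrable f -> rintegrable (fun x => `|f x|).
Proof. by move=> /integrable_norm. Qed.

Lemma rintegrableD f g : rintegrable f -> rintegrable g -> rintegrable (fun x => f x + g x).
Proof. by move=> sf sg; exact: (integrableD measurableT sf sg). Qed.

Lemma rintegrableZ f c : rintegrable f -> rintegrable (fun x => c * f x).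
Proof. by move=> sf; exact: (integrableZl measurableT c sf). Qed.

Lemma rintegrableN f : rintegrable f -> rintegrable (fun x => - f x).
Proof.
move=> /(rintegrableZ (-1)); rewrite /rintegrable.
by apply: eq_integrable => // x _ /=; rewrite mulN1r.
Qed.

Lemma rintegrableB f g : rintegrable f -> rintegrable g -> rintegrable (fun x => f x - g x).
Proof. by move=> sf sg; apply: rintegrableD => //; exact: rintegrableN. Qed.

Lemma rintegrable0 : rintegrable (fun=> 0).
Proof. exact: integrable0. Qed.

Lemma rintegrable_sum I (r : seq I) (F : I -> T -> R) :
  (forall i, rintegrable (F i)) -> rintegrable (fun x => \sum_(i <- r) F i x).
Proof.
move=> sF; elim: r => [|i r IH].
  by under eq_fun do rewrite big_nil; exact: rintegrable0.
by under eq_fun do rewrite big_cons; exact: rintegrableD.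
Qed.

Lemma rintegrable_mulbdd f g B : rintegrable f -> measurable_fun setT g ->
  (forall x, `|g x| <= B) -> rintegrable (fun x => f x * g x).
Proof.
move=> sf mg gB; apply: (rintegrable_le (g := fun x => B * `|f x|)).
- by apply: measurable_funM => //; exact: rintegrable_meas.
- exact/rintegrableZ/rintegrable_norm.
- by move=> x; rewrite normrM mulrC ler_wpM2r.
Qed.

Lemma int_norm_le f : rintegrable f -> `|\int[m]_x f x| <= \int[m]_x `|f x|.
Proof. exact: le_normr_Rintegral. Qed.

Lemma int_le f g : rintegrable f -> rintegrable g -> (forall x, f x <= g x) ->
  \int[m]_x f x <= \int[m]_x g x.
Proof. by move=> sf sg fg; exact: le_Rintegral. Qed.

Lemma int_normr_le f g : measurable_fun setT f -> rintegrable g ->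
  (forall x, `|f x| <= g x) -> `|\int[m]_x f x| <= \int[m]_x g x.
Proof.
move=> mf sg fg; have sf := rintegrable_le mf sg fg.
apply: le_trans (int_norm_le sf) _.
by apply: int_le => //; exact: rintegrable_norm.
Qed.

Lemma intD f g : rintegrable f -> rintegrable g ->
  \int[m]_x (f x + g x) = \int[m]_x f x + \int[m]_x g x.
Proof. exact: RintegralD. Qed.

Lemma intB f g : rintegrable f -> rintegrable g ->
  \int[m]_x (f x - g x) = \int[m]_x f x - \int[m]_x g x.
Proof. exact: RintegralB. Qed.

Lemma intZ f c : rintegrable f -> \int[m]_x (c * f x) = c * \int[m]_x f x.
Proof. exact: RintegralZl. Qed.

Lemma intN f : rintegrable f -> \int[m]_x (- f x) = - \int[m]_x f x.
Proof.
move=> sf; rewrite -mulN1r -intZ//.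
by apply: eq_Rintegral => x _; rewrite mulN1r.
Qed.

Lemma int0 : \int[m]_x (0 : R) = 0.
Proof. by rewrite /Rintegral integral0. Qed.

Lemma int_sum I (r : seq I) (F : I -> T -> R) :
  (forall i, rintegrable (F i)) ->
  \int[m]_x (\sum_(i <- r) F i x) = \sum_(i <- r) \int[m]_x F i x.
Proof.
move=> sF; elim: r => [|i r IH].
  by under eq_Rintegral do rewrite big_nil; rewrite big_nil int0.
under eq_Rintegral do rewrite big_cons.
by rewrite intD ?IH ?big_cons//; exact: rintegrable_sum.
Qed.

Lemma int_ext f g : f =1 g -> \int[m]_x f x = \int[m]_x g x.
Proof. by move=> fg; apply: eq_Rintegral => x _. Qed.

Lemma int_dom_cvg (F : nat -> T -> R) f g : (forall n, measurable_fun setT (F n)) ->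
  measurable_fun setT f -> rintegrable g ->
  {ae m, forall x, F n x @[n --> \oo] --> f x} ->
  (forall n x, `|F n x| <= g x) ->
  \int[m]_x F n x @[n --> \oo] --> \int[m]_x f x.
Proof.
move=> mF mf sg Ff Fg.
have mF' n : measurable_fun setT (EFin \o F n) by exact/measurable_EFinP.
have mf' : measurable_fun setT (EFin \o f) by exact/measurable_EFinP.
have [||sf _ h] := @dominated_convergence _ _ _ m setT measurableT
  (fun n => EFin \o F n) (EFin \o f) (EFin \o g) mF' mf' _ sg.
- move: Ff; apply: filterS => x Fx _.
  by apply: cvg_EFin => //; apply: nearW.
- by apply/aeW => x n _ /=; rewrite lee_fin.
by apply: fine_cvg; rewrite fineK//; apply: integrable_fin_num.
Qed.

End RealIntegrals.

(** * Fubini's theorem under domination by a product *)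

Section Fubini.
Context {d1 d2} {T1 : measurableType d1} {T2 : measurableType d2} {R : realType}.
Variables (m1 : {sigma_finite_measure set T1 -> \bar R})
  (m2 : {sigma_finite_measure set T2 -> \bar R}).
Implicit Types F : T1 * T2 -> R.

(** Tonelli measurability needs a sign, hence the split into positive and negative parts. Since
    [fine] sends infinite values to 0, sections may fail to be integrable. *)
Lemma measurable_param_int F : measurable_fun setT F ->
  measurable_fun setT (fun x => \int[m2]_y F (x, y)).
Proof.
move=> mF; have mF' : measurable_fun setT (EFin \o F) by exact/measurable_EFinP.
apply: (measurableT_comp (f := fine) (@fine_measurable _ setT measurableT)) => /=.
rewrite (_ : (fun x => _) = (fun x => \int[m2]_y (EFin \o F)^\+ (x, y))%E
   \- (fun x => \int[m2]_y (EFin \o F)^\- (x, y))%E)%E; last first.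
  apply/funext => x; rewrite [LHS]integralE.
  by congr adde; [|congr oppe]; apply: eq_integral => y _; rewrite ?funeposE ?funenegE.
apply: emeasurable_funB.
- by apply: measurable_fun_fubini_tonelli_F => //; exact: measurable_funepos.
- by apply: measurable_fun_fubini_tonelli_F => //; exact: measurable_funeneg.
Qed.

(** Tonelli bounds the integral of |F| by the product of the integrals of |a| and |b|. The later
    integrands all come with such a majorant, one integrable factor per variable. *)
Lemma rintegrable_prod F a b : measurable_fun setT F ->
  rintegrable m1 a -> rintegrable m2 b ->
  (forall x y, `|F (x, y)| <= a x * b y) -> rintegrable (m1 \x m2)%E F.
Proof.
move=> mF sa sb Fab.
have mF' : measurable_fun setT (EFin \o F) by exact/measurable_EFinP.
apply/(integrable12ltyP m1 m2 mF') => /=.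
pose c := \int[m2]_y `|b y|.
have sbn := rintegrable_norm sb.
have c0 : 0 <= c by exact: Rintegral_ge0.
have cE : (\int[m2]_y `|b y|%:E = c%:E)%E.
  by rewrite fineK//; exact: integrable_fin_num sbn.
apply: (@le_lt_trans _ _ (\int[m1]_x (`|a x| * c)%:E)%E).
  apply: ge0_le_integral => //.
  - by move=> x _; exact: integral_ge0.
  - apply: (measurable_fun_fubini_tonelli_F (abse \o (EFin \o F))) => //=.
    exact: measurableT_comp.
  - apply/measurable_EFinP; apply: measurable_funM => //.
    by apply: measurableT_comp => //; exact: rintegrable_meas sa.
  - move=> x _; rewrite EFinM -cE -ge0_integralZl//.
    + apply: ge0_le_integral => //.
      * apply/measurable_EFinP; apply: measurableT_comp => //.
        exact: measurableT_comp.
      * by apply/measurable_EFinP; apply: measurable_funM => //;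
          exact: rintegrable_meas sbn.
      * by move=> y _; rewrite lee_fin (le_trans (Fab _ _))// -normrM ler_norm.
    + by apply/measurable_EFinP; exact: rintegrable_meas sbn.
have := rintegrableZ c (rintegrable_norm sa).
move=> /integrable_fin_num => /(_ measurableT).
rewrite ge0_fin_numE//=; last by apply: integral_ge0 => x _; rewrite lee_fin mulr_ge0.
by under eq_integral do rewrite mulrC.
Qed.

Section integrals.
Variable F : T1 * T2 -> R.
Hypothesis sF : rintegrable (m1 \x m2)%E F.
Hypothesis sF1 : forall x, rintegrable m2 (fun y => F (x, y)).
Hypothesis sF2 : forall y, rintegrable m1 (fun x => F (x, y)).

Lemma int_int1E : (fun x => (\int[m2]_y F (x, y))%:E) =
  fubini_F m2 (EFin \o F).
Proof.
apply/funext => x; rewrite /fubini_F fineK//.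
exact: integrable_fin_num (sF1 x).
Qed.

Lemma int_int2E : (fun y => (\int[m1]_x F (x, y))%:E) =
  fubini_G m1 (EFin \o F).
Proof.
apply/funext => x; rewrite /fubini_G fineK//.
exact: integrable_fin_num (sF2 x).
Qed.

Lemma rintegrable_int1 : rintegrable m1 (fun x => \int[m2]_y F (x, y)).
Proof. by rewrite /rintegrable /comp int_int1E; exact: integrable_fubini_F. Qed.

Lemma int_prod1 :
  \int[m1]_x \int[m2]_y F (x, y) = \int[(m1 \x m2)%E]_z F z.
Proof.
by rewrite [LHS]/Rintegral int_int1E integral12_prod_meas1.
Qed.

Lemma int_prod2 :
  \int[m2]_y \int[m1]_x F (x, y) = \int[(m1 \x m2)%E]_z F z.
Proof.
by rewrite [LHS]/Rintegral int_int2E integral21_prod_meas1.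
Qed.

End integrals.

Section bounded_by_product.
Variables (F : T1 * T2 -> R) (a : T1 -> R) (b : T2 -> R).
Hypotheses (mF : measurable_fun setT F) (sa : rintegrable m1 a) (sb : rintegrable m2 b).
Hypothesis Fab : forall x y, `|F (x, y)| <= a x * b y.

Lemma rintegrable_section1 x : rintegrable m2 (fun y => F (x, y)).
Proof.
apply: (@rintegrable_le _ _ _ _ _ (fun y => a x * b y)) => //.
  exact: measurable_fun_pair2.
exact: rintegrableZ.
Qed.

Lemma rintegrable_section2 y : rintegrable m1 (fun x => F (x, y)).
Proof.
apply: (@rintegrable_le _ _ _ _ _ (fun x => b y * a x)) => //.
- exact: measurable_fun_pair1.
- exact: rintegrableZ.
- by move=> x; rewrite mulrC.
Qed.

Let sF := rintegrable_prod mF sa sb Fab.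

Lemma int_swap : \int[m1]_x \int[m2]_y F (x, y) = \int[m2]_y \int[m1]_x F (x, y).
Proof.
rewrite int_prod1//; last exact: rintegrable_section1.
by rewrite int_prod2//; exact: rintegrable_section2.
Qed.

Lemma rintegrable_bint1 : rintegrable m1 (fun x => \int[m2]_y F (x, y)).
Proof. by apply: rintegrable_int1 => //; exact: rintegrable_section1. Qed.

Lemma int_bprod1 : \int[m1]_x \int[m2]_y F (x, y) = \int[(m1 \x m2)%E]_z F z.
Proof. by apply: int_prod1 => //; exact: rintegrable_section1. Qed.

End bounded_by_product.
End Fubini.

Lemma rintegrable_bint2 {d1 d2} {T1 : measurableType d1}
    {T2 : measurableType d2} {R : realType}
    (m1 : {sigma_finite_measure set T1 -> \bar R})
    (m2 : {sigma_finite_measure set T2 -> \bar R})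
    (F : T1 * T2 -> R) (a : T1 -> R) (b : T2 -> R) :
  measurable_fun setT F -> rintegrable m1 a -> rintegrable m2 b ->
  (forall x y, `|F (x, y)| <= a x * b y) ->
  rintegrable m2 (fun y => \int[m1]_x F (x, y)).
Proof.
move=> mF sa sb Fab.
apply: (rintegrable_bint1 (F := fun z => F (z.2, z.1)) (a := b) (b := a)) => //.
- by apply: measurableT_comp => //; exact: measurable_fun_pair.
- by move=> x y /=; rewrite mulrC.
Qed.

Notation chi b := (nat_of_bool b)%:R.

Section MeasTactic.
Context {d} {T : measurableType d} {R : realType}.

Lemma measurable_boolr (f : T -> bool) : measurable_fun setT f ->
  measurable_fun setT (fun x => (f x)%:R : R).
Proof.
move=> mf; rewrite (_ : (fun _ => _) = fun x => if f x then 1 else 0); last first.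
  by apply/funext => x; case: (f x).
exact: measurable_fun_ifT.
Qed.

End MeasTactic.

Ltac meas1 := first [ match goal with
    | H : ?P |- ?P => exact: H
    | H : measurable_fun setT ?g |- measurable_fun setT (fun z => ?g _) =>
      apply: (measurableT_comp H)
    | H : measurable_fun setT (fun _ => _) |- _ => first
      [ exact: H
      | exact: (measurableT_comp H measurable_fst)
      | exact: (measurableT_comp H measurable_snd)]
    | |- measurable_fun setT (fun z => GRing.mul (@?a z) (@?b z)) =>
      apply: (@measurable_funM _ _ _ _ a b)
    | |- measurable_fun setT (fun z => GRing.add (@?a z) (@?b z)) =>
      apply: (@measurable_funD _ _ _ _ a b)
    | |- measurable_fun setT (fun z => GRing.opp (@?a z)) =>
      apply: (@measurable_funN _ _ _ _ a)
    | |- measurable_fun setT (fun z => Num.norm (@?a z)) =>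
      first [apply: (measurableT_comp (g := a) (@normr_measurable _ setT))
        | apply: (@measurableT_comp _ _ _ _ _ _ Num.norm setT a)]
    | |- measurable_fun setT (fun z => expR (@?a z)) =>
      first [apply: (@measurableT_comp _ _ _ _ _ _ expR setT a)
        | apply: (measurableT_comp (g := a) (measurable_expR _))]
    | |- measurable_fun setT (fun z => chi (@?a z)) =>
      apply: (@measurable_boolr _ _ _ a)
    | |- measurable_fun setT (fun z => andb (@?a z) (@?b z)) =>
      apply: (@measurable_and _ _ _ a b)
    | |- measurable_fun setT (fun z => (@?a z <= @?b z)%R) =>
      apply: (@measurable_fun_ler _ _ _ _ a b)
    | |- measurable_fun setT (fun z => (@?a z < @?b z)%R) =>
      apply: (@measurable_fun_ltr _ _ _ _ a b)
    | |- measurable_fun setT (fun z => fst (@?a z)) =>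
      apply: (@measurableT_comp _ _ _ _ _ _ fst setT a measurable_fst)
    | |- measurable_fun setT (fun z => snd (@?a z)) =>
      apply: (@measurableT_comp _ _ _ _ _ _ snd setT a measurable_snd)
    | |- measurable_fun setT (fun z => (@?a z, @?b z)) =>
      apply: (@measurable_fun_pair _ _ _ _ _ _ a b)
    end
  | assumption | exact: normr_measurable | exact: measurable_expR | exact: measurable_cst
  | exact: measurable_id | exact: measurable_fst | exact: measurable_snd ].
Ltac meas := repeat meas1.

(** * Absolutely continuous functions on [0, L] *)

Section Lebesgue.
Context {R : realType}.
Local Notation mu := (@lebesgue_measure R).
Implicit Types (f g h : R -> R) (x y t L : R).

Lemma norm_chi (b : bool) : `|chi b : R| <= 1.
Proof. by case: b; rewrite ?normr1 ?normr0. Qed.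

Lemma int_ae f g : measurable_fun setT f -> measurable_fun setT g ->
  {ae mu, forall x, f x = g x} -> \int[mu]_x f x = \int[mu]_x g x.
Proof.
move=> mf mg fg; congr fine; apply: ae_eq_integral => //.
- exact/measurable_EFinP.
- exact/measurable_EFinP.
- move: fg; apply: (@filterS _ _ (ae_filter_ringOfSetsType mu)) => x fg _ /=.
  by rewrite fg.
Qed.

(** Strict and large inequalities in an indicator differ at single points only; this discards
    them. *)
Lemma ae_neq (a : R) : {ae mu, forall x, x != a}.
Proof.
exists [set a]; split => //; first exact: lebesgue_measure_set1.
by move=> x /= /negP; rewrite negbK => /eqP.
Qed.

(** Absolute continuity is kept as an integral identity: no pointwise derivative appears, and [g]
    may be changed on a null set ([ac_ae]). *)
Definition ac L f g :=
  rintegrable mu (fun t => chi (0 <= t <= L) * g t) /\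
  forall x y, 0 <= x -> x <= y -> y <= L ->
    f y - f x = \int[mu]_t (chi (x <= t <= y) * g t).

Lemma rintegrable_sub L g x y : rintegrable mu (fun t => chi (0 <= t <= L) * g t) ->
  0 <= x -> y <= L -> rintegrable mu (fun t => chi (x <= t <= y) * g t).
Proof.
move=> sg x0 yL.
have E t : chi (x <= t <= y) * g t = (chi (0 <= t <= L) * g t) * chi (x <= t <= y).
  have [/andP[xt ty]|_] := boolP (x <= t <= y); last by rewrite mul0r mulr0.
  by rewrite (le_trans x0 xt) (le_trans ty yL) /= !mul1r mulr1.
under eq_fun do rewrite E.
apply: (rintegrable_mulbdd (B := 1)) => //; first by meas.
by move=> t; exact: norm_chi.
Qed.

Lemma ac_eq L f g t : ac L f g -> 0 <= t <= L ->
  f t = f 0 + \int[mu]_s (chi (s <= t) * (chi (0 <= s <= L) * g s)).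
Proof.
move=> [_ fg] /andP[t0 tL]; rewrite addrC; apply/eqP; rewrite -subr_eq; apply/eqP.
rewrite fg//; apply: int_ext => s; rewrite mulrA; congr (_ * _).
case: (leP s t) => st; rewrite ?andbF ?mul0r// ?andbT mul1r.
by rewrite (le_trans st tL) !andbT.
Qed.

Lemma ac_meas L f g : ac L f g ->
  measurable_fun setT (fun t => chi (0 <= t <= L) * f t).
Proof.
move=> fg; have sg := fg.1; have mg := rintegrable_meas sg.
rewrite (_ : (fun _ => _) = (fun t => chi (0 <= t <= L) *
    (f 0 + \int[mu]_s (chi (s <= t) * (chi (0 <= s <= L) * g s))))); last first.
  apply/funext => t; have [tL|_] := boolP (0 <= t <= L); last by rewrite !mul0r.
  by rewrite -(ac_eq fg tL).
have := @measurable_param_int _ _ _ _ R mu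
  (fun z => chi (z.2 <= z.1) * (chi (0 <= z.2 <= L) * g z.2)).
move=> H; apply: measurable_funM; first by meas.
apply: measurable_funD; first by meas.
by apply: H; meas.
Qed.

Lemma ac_bdd L f g t : ac L f g -> 0 <= t <= L ->
  `|f t| <= `|f 0| + \int[mu]_s `|chi (0 <= s <= L) * g s|.
Proof.
move=> fg tL; rewrite (ac_eq fg tL) (le_trans (ler_normD _ _))// lerD2l.
have sg := fg.1; have mg := rintegrable_meas sg.
apply: int_normr_le.
- by meas.
- exact: rintegrable_norm.
- by move=> s; case: (s <= t); rewrite ?mul1r// mul0r normr0.
Qed.

Lemma rintegrable_ac L f g h : ac L f g ->
  rintegrable mu (fun t => chi (0 <= t <= L) * h t) ->
  rintegrable mu (fun t => chi (0 <= t <= L) * (h t * f t)).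
Proof.
move=> fg sh.
have E t : chi (0 <= t <= L) * (h t * f t) =
    chi (0 <= t <= L) * h t * (chi (0 <= t <= L) * f t).
  by case: (0 <= t <= L); rewrite ?mul1r ?mul0r.
under eq_fun do rewrite E.
apply: (rintegrable_mulbdd (B := `|f 0| + \int[mu]_s `|chi (0 <= s <= L) * g s|)) => //.
  exact: ac_meas fg.
move=> t; have [tL|tL] := boolP (0 <= t <= L); first by rewrite mul1r (ac_bdd fg).
by rewrite mul0r normr0 addr_ge0//; exact: Rintegral_ge0.
Qed.

(** Integration by parts through Fubini. Writing f(t) = f(x) + int_x^t f' and likewise for g, the
    two correction terms are the integrals of f'(t) g'(s) over the two triangles of the square
    [x, y]^2; together they give the product of the increments. *)
Lemma ac_mul L f f' g g' : ac L f f' -> ac L g g' ->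
  ac L (fun t => f t * g t) (fun t => f' t * g t + f t * g' t).
Proof.
move=> ff gg; split.
  under eq_fun do rewrite mulrDr.
  apply: rintegrableD; first exact: rintegrable_ac gg ff.1.
  under eq_fun do rewrite (mulrC (f _)).
  exact: rintegrable_ac ff gg.1.
move=> x y x0 xy yL.
pose A t := chi (x <= t <= y) * f' t.
pose B t := chi (x <= t <= y) * g' t.
have sA : rintegrable mu A by exact: rintegrable_sub ff.1 _ _.
have sB : rintegrable mu B by exact: rintegrable_sub gg.1 _ _.
have mA := rintegrable_meas sA. have mB := rintegrable_meas sB.
have sAg : rintegrable mu (fun t => chi (x <= t <= y) * (f' t * g t)).
  exact: rintegrable_sub (rintegrable_ac gg ff.1) _ _.
have sfB : rintegrable mu (fun t => chi (x <= t <= y) * (g' t * f t)).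
  exact: rintegrable_sub (rintegrable_ac ff gg.1) _ _.
under eq_Rintegral do rewrite mulrDr (mulrC (f _)).
rewrite intD//.
have fE : f y = f x + \int[mu]_t A t by rewrite -ff.2// addrC subrK.
have gE : g y = g x + \int[mu]_t B t by rewrite -gg.2// addrC subrK.
pose F (z : measurableTypeR R * measurableTypeR R) := A z.1 * B z.2 * chi (z.2 <= z.1).
pose G (z : measurableTypeR R * measurableTypeR R) := A z.1 * B z.2 * chi (z.1 < z.2).
have mF : measurable_fun setT F by rewrite /F; meas.
have mG : measurable_fun setT G by rewrite /G; meas.
have sA' := rintegrable_norm sA. have sB' := rintegrable_norm sB.
have FAB t s : `|F (t, s)| <= `|A t| * `|B s|.
  rewrite /F /= !normrM ler_piMr ?mulr_ge0//.
  exact: norm_chi.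
have GAB t s : `|G (t, s)| <= `|A t| * `|B s|.
  rewrite /G /= !normrM ler_piMr ?mulr_ge0//.
  exact: norm_chi.
have E1 : \int[mu]_t (chi (x <= t <= y) * (f' t * g t)) =
    g x * \int[mu]_t A t + \int[mu]_t \int[mu]_s F (t, s).
  rewrite -(intZ (g x) sA) -(intD (rintegrableZ (g x) sA) (rintegrable_bint1 mF sA' sB' FAB)).
  apply: int_ext => t; rewrite /F /A /=.
  have [/andP[xt ty]|_] := boolP (x <= t <= y); last first.
    by rewrite !mul0r mulr0 add0r; under eq_Rintegral do rewrite !mul0r; rewrite int0.
  rewrite !mul1r -(subrK (g x) (g t)) gg.2 ?(le_trans ty)//.
  rewrite mulrDr mulrC addrC (mulrC (f' t)); congr (_ + _); rewrite mulrC -intZ.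
    apply: int_ext => s; rewrite /B -!mulrA; congr (_ * _).
    case: (leP s t) => st; rewrite ?andbF ?mul0r ?mulr0// ?andbT !mulr1.
    by rewrite (le_trans st ty) andbT.
  by apply: (rintegrable_sub gg.1 x0); exact: le_trans ty yL.
have E2 : \int[mu]_t (chi (x <= t <= y) * (g' t * f t)) =
    f x * \int[mu]_t B t + \int[mu]_s \int[mu]_t G (t, s).
  rewrite -(intZ (f x) sB) -(intD (rintegrableZ (f x) sB) (rintegrable_bint2 mG sA' sB' GAB)).
  apply: int_ext => s; rewrite /G /B /=.
  have [/andP[xs sy]|_] := boolP (x <= s <= y); last first.
    rewrite !mul0r mulr0 add0r; under eq_Rintegral do rewrite !(mul0r, mulr0).
    by rewrite int0.
  rewrite !mul1r -(subrK (f x) (f s)) ff.2 ?(le_trans sy)//.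
  rewrite mulrDr mulrC addrC (mulrC (g' s)); congr (_ + _); rewrite mulrC -intZ.
    (* [G] excludes the diagonal while the increment of [f] is an integral over a closed interval,
       so the integrands are compared only away from t = s. *)
    apply: int_ae.
    - have := rintegrable_meas (rintegrable_sub ff.1 x0 (le_trans sy yL)).
      by move=> H; meas.
    - by meas.
    apply: (@filterS _ _ (ae_filter_ringOfSetsType mu)) (ae_neq s) => t ts.
    rewrite /A; case: (ltgtP t s) ts => // st _.
      by rewrite (le_trans (ltW st) sy) !andbT /=; ring.
    by rewrite andbF /=; ring.
  by apply: (rintegrable_sub ff.1 x0); exact: le_trans sy yL.
rewrite E1 E2 -(int_swap mG sA' sB' GAB)//.
have E3 : \int[mu]_t \int[mu]_s F (t, s) + \int[mu]_t \int[mu]_s G (t, s) =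
    (\int[mu]_t A t) * (\int[mu]_t B t).
  rewrite -intD; [|exact: (rintegrable_bint1 mF sA' sB' FAB)|exact: (rintegrable_bint1 mG sA' sB' GAB)].
  rewrite [RHS]mulrC -intZ//; apply: int_ext => t.
  rewrite -intD; [|exact: (rintegrable_section1 mF sB' FAB t)|exact: (rintegrable_section1 mG sB' GAB t)].
  rewrite mulrC -intZ//; apply: int_ext => s; rewrite /F /G /= -mulrDr.
  by case: (leP s t); rewrite ?addr0 ?add0r mulr1.
rewrite fE gE; move: E3; set p := Rintegral _ _ _; set q := Rintegral _ _ _ => E3.
move: E3; set a := \int[mu]_t A t; set b := \int[mu]_t B t => E3.
transitivity (g x * a + f x * b + (p + q)); last by ring.
by rewrite E3; ring.
Qed.

End Lebesgue.

Section AC.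
Context {R : realType}.
Local Notation mu := (@lebesgue_measure R).
Implicit Types (f g h : R -> R) (x y t L : R).

Lemma ac_integr L f g : ac L f g -> rintegrable mu (fun t => chi (0 <= t <= L) * g t).
Proof. by case. Qed.

Lemma ac_D L f f' g g' : ac L f f' -> ac L g g' ->
  ac L (fun t => f t + g t) (fun t => f' t + g' t).
Proof.
move=> ff gg; split.
  by under eq_fun do rewrite mulrDr; apply: rintegrableD; [exact: ff.1|exact: gg.1].
move=> x y x0 xy yL; under eq_Rintegral do rewrite mulrDr.
rewrite intD ?(rintegrable_sub ff.1) ?(rintegrable_sub gg.1)//.
by rewrite -ff.2// -gg.2//; ring.
Qed.

Lemma ac_Z L c f f' : ac L f f' -> ac L (fun t => c * f t) (fun t => c * f' t).
Proof.
move=> ff; split.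
  by under eq_fun do rewrite mulrCA; exact/rintegrableZ/ff.1.
move=> x y x0 xy yL; under eq_Rintegral do rewrite mulrCA.
by rewrite intZ ?(rintegrable_sub ff.1)// -ff.2// mulrBr.
Qed.

Lemma ac_N L f f' : ac L f f' -> ac L (fun t => - f t) (fun t => - f' t).
Proof.
move=> /(ac_Z (-1)); under eq_fun do rewrite mulN1r.
by under [in X in ac _ _ X]eq_fun do rewrite mulN1r.
Qed.

Lemma ac_cst L c : ac L (fun=> c) (fun=> 0).
Proof.
split; first by under eq_fun do rewrite mulr0; exact: rintegrable0.
by move=> x y _ _ _; under eq_Rintegral do rewrite mulr0; rewrite int0 subrr.
Qed.

Lemma ac_sum L I (r : seq I) (F F' : I -> R -> R) :
  (forall i, ac L (F i) (F' i)) ->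
  ac L (fun t => \sum_(i <- r) F i t) (fun t => \sum_(i <- r) F' i t).
Proof.
move=> FF; elim: r => [|i r IH].
  under eq_fun do rewrite big_nil.
  by under [in X in ac _ _ X]eq_fun do rewrite big_nil; exact: ac_cst.
under eq_fun do rewrite big_cons.
by under [in X in ac _ _ X]eq_fun do rewrite big_cons; exact: ac_D.
Qed.

Lemma ac_ext L f g h k : (forall t, 0 <= t <= L -> f t = h t) ->
  (forall t, 0 <= t <= L -> g t = k t) -> ac L f g -> ac L h k.
Proof.
move=> fh gk [sg fg]; split.
  apply: rintegrable_eq sg => t.
  by have [tL|_] := boolP (0 <= t <= L); rewrite ?mul0r// !mul1r gk.
move=> x y x0 xy yL; rewrite -!fh ?(x0, yL, le_trans x0 xy, le_trans xy yL)// fg//.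
apply: int_ext => t; have [/andP[xt ty]|_] := boolP (x <= t <= y); rewrite ?mul0r//.
by rewrite !mul1r gk// (le_trans x0 xt) (le_trans ty yL).
Qed.

(** Allows a derivative to be replaced by the right-hand side of the differential equation, which is
    known only almost everywhere and for 0 < t. *)
Lemma ac_ae L f g h : measurable_fun setT (fun t => chi (0 <= t <= L) * h t) ->
  {ae mu, forall t, 0 < t <= L -> g t = h t} -> ac L f g -> ac L f h.
Proof.
move=> mh gh [sg fg].
have E : {ae mu, forall t, chi (0 <= t <= L) * g t = chi (0 <= t <= L) * h t}.
  have N0 := @ae_neq R 0.
  apply: (@filterS2 _ _ (ae_filter_ringOfSetsType mu) _ _ _ _ gh N0) => t ght t0.
  have [/andP[t1 t2]|_] := boolP (0 <= t <= L); rewrite ?mul0r// ght//.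
  by rewrite lt_neqAle eq_sym t0 t1.
have mg := rintegrable_meas sg.
split.
  have mh' : measurable_fun setT (EFin \o (fun t => chi (0 <= t <= L) * h t)).
    exact/measurable_EFinP.
  apply/integrableP; split => //.
  case/integrableP : sg => mg' /=; congr (_ < _)%E.
  apply: ae_eq_integral => //.
  - by apply/measurable_EFinP; exact: measurableT_comp.
  - by apply/measurable_EFinP; exact: measurableT_comp.
  - move: E; apply: (@filterS _ _ (ae_filter_ringOfSetsType mu)) => t /= Et _.
    by rewrite Et.
move=> x y x0 xy yL; rewrite fg//.
have E' (k : R -> R) t : chi (x <= t <= y) * k t =
    (chi (0 <= t <= L) * k t) * chi (x <= t <= y).
  have [/andP[xt ty]|_] := boolP (x <= t <= y); rewrite ?mul0r ?mulr0//.
  by rewrite (le_trans x0 xt) (le_trans ty yL) !mul1r mulr1.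
under eq_Rintegral do rewrite E'.
under [RHS]eq_Rintegral do rewrite E'.
apply: int_ae.
- by apply: measurable_funM => //; meas.
- by apply: measurable_funM => //; meas.
- by apply: (@filterS _ _ (ae_filter_ringOfSetsType mu) _ _ _ E) => t ->.
Qed.

Lemma chi_itv x y f : \int[mu]_t (chi (x <= t <= y) * f t) =
  \int[mu]_(t in `[x, y]) f t.
Proof.
rewrite [RHS]Rintegral_mkcond; apply: int_ext => t; rewrite patchE mem_setE in_itv/=.
by case: (_ && _); rewrite ?mul1r ?mul0r.
Qed.

Lemma rintegrable_itv x y f : mu.-integrable `[x, y] (EFin \o f) <->
  rintegrable mu (fun t => chi (x <= t <= y) * f t).
Proof.
have E : (EFin \o (fun t => chi (x <= t <= y) * f t)) =
    (EFin \o f) \_ `[x, y].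
  apply/funext => t; rewrite patchE mem_setE in_itv/=.
  by case: (_ && _); rewrite ?mul1r ?mul0r.
by rewrite /rintegrable E; apply: integrable_mkcond.
Qed.

Lemma ac_C1 L (F f : R -> R) : continuous f -> (forall t, is_derive t (1:R) F (f t)) ->
  ac L F f.
Proof.
move=> cf dF.
have sf x y : rintegrable mu (fun t => chi (x <= t <= y) * f t).
  apply/rintegrable_itv/continuous_compact_integrable; first exact: segment_compact.
  by apply: continuous_subspaceT => z; exact: cf.
split=> // x y x0; rewrite le_eqVlt => /predU1P[->|xy] yL.
  rewrite subrr chi_itv (_ : `[y, y]%classic = [set y]); last exact: set_itv1.
  by rewrite Rintegral_set1.
rewrite chi_itv /Rintegral (@continuous_FTC2 _ f F)//.
- by apply: continuous_subspaceT => z; exact: cf.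
- have cF : continuous F.
    by move=> z; apply: differentiable_continuous; apply/derivable1_diffP.
  split; [|exact: cvg_at_right_filter (cF x)|exact: cvg_at_left_filter (cF y)].
  by move=> z _; exact: ex_derive.
- by move=> z _; rewrite derive1E; exact: derive_val.
Qed.

Lemma ac_expR L c : ac L (fun t => expR (c * t)) (fun t => c * expR (c * t)).
Proof.
apply: ac_C1.
  move=> t; apply: cvgM; first exact: cvg_cst.
  apply: continuous_comp; last exact: continuous_expR.
  by apply: cvgM; [exact: cvg_cst|exact: cvg_id].
move=> t; have : is_derive t (1:R) (fun t : R => c * t) (c *: 1).
  by apply: is_deriveZ; exact: is_derive_id.
move=> d; have := is_derive1_comp (is_derive_expR (c * t)) d.
by rewrite /comp; under [X in is_derive _ _ X]eq_fun do []; rewrite /GRing.scale/= mulr1 mulrC.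
Qed.

End AC.

(** * Matrix norm and matrix-valued absolutely continuous functions *)

Section EntryNorm.
Context {R : realType} {k : nat}.
Implicit Types A B : 'M[R]_k.

(** The entrywise l^1 norm: submultiplicative, invariant under transposition and above every entry.
    The norm of the identity is k and not 1, which is why it survives as a constant [V] in the later
    bounds. *)
Definition mnorm A : R := \sum_i \sum_j `|A i j|.

Lemma mnorm_ge0 A : 0 <= mnorm A.
Proof. by apply: sumr_ge0 => i _; apply: sumr_ge0. Qed.

Lemma mnorm_entry A i j : `|A i j| <= mnorm A.
Proof.
rewrite /mnorm (bigD1 i)//= (bigD1 j)//= -addrA lerDl addr_ge0//.
  exact: sumr_ge0.
by apply: sumr_ge0 => i' _; apply: sumr_ge0.
Qed.

Lemma mnorm_le A (c : R) : (forall i j, `|A i j| <= c) -> mnorm A <= k%:R * (k%:R * c).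
Proof.
move=> Ac; apply: (@le_trans _ _ (\sum_(i < k) \sum_(j < k) c)).
  by apply: ler_sum => i _; apply: ler_sum.
by rewrite !sumr_const !card_ord !mulr_natl.
Qed.

Lemma mnorm0 : mnorm 0 = 0.
Proof.
rewrite /mnorm big1// => i _; rewrite big1// => j _.
by rewrite mxE normr0.
Qed.

Lemma mnorm_eq0 A : mnorm A <= 0 -> A = 0.
Proof.
move=> A0; apply/matrixP => i j; rewrite mxE; apply/normr0_eq0/le_anti.
by rewrite normr_ge0 andbT (le_trans (mnorm_entry A i j)).
Qed.

Lemma mnormD A B : mnorm (A + B) <= mnorm A + mnorm B.
Proof.
rewrite /mnorm -big_split; apply: ler_sum => i _ /=; rewrite -big_split.
by apply: ler_sum => j _ /=; rewrite mxE ler_normD.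
Qed.

Lemma mnormN A : mnorm (- A) = mnorm A.
Proof.
by apply: eq_bigr => i _; apply: eq_bigr => j _; rewrite mxE normrN.
Qed.

Lemma mnormB A B : mnorm (A - B) <= mnorm A + mnorm B.
Proof. by rewrite (le_trans (mnormD _ _))// mnormN. Qed.

Lemma mnormZ c A : mnorm (c *: A) = `|c| * mnorm A.
Proof.
rewrite /mnorm mulr_sumr; apply: eq_bigr => i _; rewrite mulr_sumr.
by apply: eq_bigr => j _; rewrite mxE normrM.
Qed.

Lemma mnormM A B : mnorm (A *m B) <= mnorm A * mnorm B.
Proof.
rewrite /mnorm mulr_suml; apply: ler_sum => i _.
apply: (@le_trans _ _ (\sum_j \sum_l `|A i l| * `|B l j|)).
  apply: ler_sum => j _; rewrite mxE (le_trans (ler_norm_sum _ _ _))//.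
  by apply: ler_sum => l _; rewrite normrM.
rewrite exchange_big mulr_suml; apply: ler_sum => l _ /=.
rewrite -mulr_sumr ler_wpM2l// [leRHS](bigD1 l)//= lerDl.
by apply: sumr_ge0 => i' _; apply: sumr_ge0.
Qed.

Lemma mnorm_tr A : mnorm A^T = mnorm A.
Proof.
rewrite /mnorm exchange_big; apply: eq_bigr => i _; apply: eq_bigr => j _.
by rewrite mxE.
Qed.

End EntryNorm.

Section ACMatrix.
Context {R : realType} {k : nat}.
Local Notation mu := (@lebesgue_measure R).
Implicit Types (A B Q u p : R -> 'M[R]_k) (L x y : R).

Definition acm L A A' :=
  forall i j, ac L (fun x => A x i j) (fun x => A' x i j).

Definition intm L Q := forall i j, rintegrable mu (fun t => chi (0 <= t <= L) * Q t i j).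

Lemma acm_ext L A A' B B' : (forall t, 0 <= t <= L -> A t = B t) ->
  (forall t, 0 <= t <= L -> A' t = B' t) -> acm L A A' -> acm L B B'.
Proof.
by move=> AB AB' AA i j; apply: ac_ext (AA i j) => t tL; rewrite ?AB ?AB'.
Qed.

Lemma acm_D L A A' B B' : acm L A A' -> acm L B B' ->
  acm L (fun x => A x + B x) (fun x => A' x + B' x).
Proof.
move=> AA BB i j; apply: ac_ext (ac_D (AA i j) (BB i j)) => t _ /=; by rewrite mxE.
Qed.

Lemma acm_N L A A' : acm L A A' -> acm L (fun x => - A x) (fun x => - A' x).
Proof.
by move=> AA i j; apply: ac_ext (ac_N (AA i j)) => t _ /=; rewrite mxE.
Qed.

Lemma acm_scale L (f f' : R -> R) A A' : ac L f f' -> acm L A A' ->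
  acm L (fun x => f x *: A x) (fun x => f' x *: A x + f x *: A' x).
Proof.
by move=> ff AA i j; apply: ac_ext (ac_mul ff (AA i j)) => t _ /=; rewrite !mxE.
Qed.

Lemma acm_cst L (A : 'M[R]_k) : acm L (fun=> A) (fun=> 0).
Proof. by move=> i j; apply: ac_ext (ac_cst L (A i j)) => t _ //; rewrite mxE. Qed.

Lemma acm_M L A A' B B' : acm L A A' -> acm L B B' ->
  acm L (fun x => A x *m B x) (fun x => A' x *m B x + A x *m B' x).
Proof.
move=> AA BB i j.
have := @ac_sum R L _ (index_enum 'I_k)
  (fun l x => A x i l * B x l j) (fun l x => A' x i l * B x l j + A x i l * B' x l j).
move=> /(_ (fun l => ac_mul (AA i l) (BB l j))).
by apply: ac_ext => t _; rewrite !mxE// big_split.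
Qed.

Lemma acm_tr L A A' : acm L A A' -> acm L (fun x => (A x)^T) (fun x => (A' x)^T).
Proof. by move=> AA i j; apply: ac_ext (AA j i) => t _; rewrite mxE. Qed.

Lemma intm_tr L Q : intm L Q -> intm L (fun x => (Q x)^T).
Proof.
by move=> iQ i j; apply: rintegrable_eq (iQ j i) => t; rewrite mxE.
Qed.

Lemma intm_D L Q Q' : intm L Q -> intm L Q' -> intm L (fun x => Q x + Q' x).
Proof.
move=> iQ iQ' i j; apply: rintegrable_eq (rintegrableD (iQ i j) (iQ' i j)) => t.
by rewrite mxE mulrDr.
Qed.

Lemma intm_N L Q : intm L Q -> intm L (fun x => - Q x).
Proof.
by move=> iQ i j; apply: rintegrable_eq (rintegrableN (iQ i j)) => t; rewrite mxE mulrN.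
Qed.

Lemma intm_mnorm L Q : intm L Q -> rintegrable mu (fun t => chi (0 <= t <= L) * mnorm (Q t)).
Proof.
move=> iQ.
have : rintegrable mu (fun t => \sum_i \sum_j `|chi (0 <= t <= L) * Q t i j|).
  apply: rintegrable_sum => i; apply: rintegrable_sum => j.
  exact/rintegrable_norm.
apply: rintegrable_eq => t; rewrite /mnorm mulr_sumr; apply: eq_bigr => i _.
rewrite mulr_sumr; apply: eq_bigr => j _.
by rewrite normrM; case: (0 <= t <= L); rewrite ?normr1 ?normr0.
Qed.

Lemma intm_M L A A' Q : acm L A A' -> intm L Q -> intm L (fun x => Q x *m A x).
Proof.
move=> AA iQ i j.
have : rintegrable mu (fun t => \sum_l chi (0 <= t <= L) * (Q t i l * A t l j)).
  by apply: rintegrable_sum => l; exact: rintegrable_ac (AA l j) (iQ i l).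
by apply: rintegrable_eq => t; rewrite mxE mulr_sumr.
Qed.

Lemma acm_int L A A' : acm L A A' -> intm L A'.
Proof. by move=> AA i j; exact: (AA i j).1. Qed.

Lemma acm_norm L A A' x y : acm L A A' -> 0 <= x -> x <= y -> y <= L ->
  mnorm (A y - A x) <= \int[mu]_t (chi (x <= t <= y) * mnorm (A' t)).
Proof.
move=> AA x0 xy yL.
have sA i j : rintegrable mu (fun t => chi (x <= t <= y) * A' t i j).
  exact: rintegrable_sub (AA i j).1 _ _.
have -> : \int[mu]_t (chi (x <= t <= y) * mnorm (A' t)) =
    \sum_i \sum_j \int[mu]_t `|chi (x <= t <= y) * A' t i j|.
  under eq_bigr => i _.
    rewrite -int_sum; last by move=> j; exact/rintegrable_norm.
    over.
  rewrite -int_sum; last first.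
    by move=> i; apply: rintegrable_sum => j; exact/rintegrable_norm.
  apply: int_ext => t; rewrite /mnorm mulr_sumr; apply: eq_bigr => i _.
  rewrite mulr_sumr; apply: eq_bigr => j _.
  by rewrite normrM; case: (x <= t <= y); rewrite ?normr1 ?normr0.
apply: ler_sum => i _; apply: ler_sum => j _.
by rewrite !mxE (AA i j).2// int_norm_le.
Qed.

Lemma acm_bdd L A A' : acm L A A' -> exists B : R, forall t, 0 <= t <= L -> mnorm (A t) <= B.
Proof.
move=> AA.
exists (\sum_i \sum_j (`|A 0 i j| + \int[mu]_s `|chi (0 <= s <= L) * A' s i j|)).
move=> t tL; apply: ler_sum => i _; apply: ler_sum => j _.
exact: ac_bdd (AA i j) tL.
Qed.

(* With n = 2 xi, u = e^{xi (x - L)} F solves u'' - n u' = Q u when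
   -F'' + Q F = - xi^2 F; p = e^{-n x} u' makes the system triangular. *)
Definition sol L (n : R) Q u p :=
  acm L u (fun x => expR (n * x) *: p x) /\
  acm L p (fun x => expR (- n * x) *: (Q x *m u x)).

(** * A priori bounds for u'' - n u' = Q u, for n large against the integral of |Q| *)

Section apriori.
Variables (L n : R) (Q u p : R -> 'M[R]_k) (v w : 'M[R]_k) (q : R).
Hypotheses (L0 : 0 <= L) (n0 : 0 < n) (iQ : intm L Q) (up : sol L n Q u p).
Hypotheses (uL : u L = v) (pL : expR (n * L) *: p L = w).
Hypothesis qE : q = \int[mu]_t (chi (0 <= t <= L) * mnorm (Q t)).

Let du x := expR (n * x) *: p x.

(** Since u'' = n u' + Q u, the combination z = u - n^{-1} u' has derivative - n^{-1} Q u.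
    Integrating z instead of u gains the factor n^{-1} and avoids every growing exponential. *)
Lemma sol_id x : 0 <= x <= L ->
  mnorm (u x - v) <= n^-1 * (mnorm w + mnorm (du x) +
    \int[mu]_t (chi (x <= t <= L) * mnorm (Q t *m u t))).
Proof.
move=> /andP[x0 xL].
have [au ap] := up.
pose z x := u x - n^-1 *: du x.
have az : acm L z (fun x => - (n^-1 *: (Q x *m u x))).
  have := acm_D au (acm_N (acm_scale (ac_cst L n^-1) (acm_scale (ac_expR L n) ap))).
  apply: acm_ext => t _ //.
  rewrite scale0r add0r scalerA -expRD mulNr subrr expR0 scale1r scalerDr scalerA mulrA.
  by rewrite mulVf ?gt_eqF// mul1r opprD addrA subrr add0r.
have := acm_norm az x0 xL (lexx L).
have -> : \int[mu]_t (chi (x <= t <= L) * mnorm (- (n^-1 *: (Q t *m u t)))) =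
    n^-1 * \int[mu]_t (chi (x <= t <= L) * mnorm (Q t *m u t)).
  under eq_Rintegral do rewrite mnormN mnormZ gtr0_norm ?invr_gt0// mulrCA.
  rewrite intZ//; apply: (rintegrable_sub (L := L)) => //.
  exact: intm_mnorm (intm_M au iQ).
rewrite /z uL /du pL => H.
have -> : u x - v = - (v - n^-1 *: w - (u x - n^-1 *: du x)) + n^-1 *: (du x - w).
  by rewrite /du scalerBr !opprB; apply/matrixP => i j; rewrite !mxE; ring.
apply: le_trans (mnormD _ _) _; rewrite mnormN (mnormZ n^-1) gtr0_norm ?invr_gt0//.
rewrite [leRHS]mulrDr [leRHS]addrC lerD//; apply: ler_wpM2l.
  by rewrite invr_ge0 ltW.
by rewrite (le_trans (mnormB _ _))// addrC.
Qed.

(** Integrate p' = e^{-n x} Q u backwards from L and multiply by e^{n x}: the exponents become - n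
    (L - x) and - n (t - x), both nonpositive because the data are prescribed at the right end. *)
Lemma sol_du x : 0 <= x <= L ->
  mnorm (du x) <= expR (- n * (L - x)) * mnorm w +
    \int[mu]_t (chi (x <= t <= L) * (expR (- n * (t - x)) * mnorm (Q t *m u t))).
Proof.
move=> /andP[x0 xL]; have [au ap] := up.
have := acm_norm ap x0 xL (lexx L).
have e0 := expR_ge0 (n * x).
move=> /(ler_wpM2l e0) H.
have -> : du x = expR (n * x) *: p L - expR (n * x) *: (p L - p x).
  by rewrite /du scalerBr opprB addrC subrK.
apply: le_trans (mnormB _ _) _; rewrite !mnormZ !ger0_norm//; apply: lerD.
  rewrite -pL mnormZ ger0_norm ?expR_ge0// mulrA -expRD.
  by rewrite (_ : - n * (L - x) + n * L = n * x)//; ring.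
apply: le_trans H _; rewrite le_eqVlt; apply/orP; left; apply/eqP.
rewrite -intZ.
  apply: int_ext => t; rewrite mnormZ ger0_norm ?expR_ge0// mulrCA mulrA -mulrA.
  by rewrite [in RHS](_ : - n * (t - x) = n * x + - n * t) ?expRD ?mulrA//; ring.
by apply: (rintegrable_sub (L := L)) => //; exact: intm_mnorm (acm_int ap).
Qed.

End apriori.
End ACMatrix.

Section Apriori.
Context {R : realType} {k : nat}.
Local Notation mu := (@lebesgue_measure R).
Variables (L n : R) (Q u p : R -> 'M[R]_k).
Let du x := expR (n * x) *: p x.
Let q := \int[mu]_t (chi (0 <= t <= L) * mnorm (Q t)).
Hypotheses (L0 : 0 <= L) (n0 : 0 < n) (iQ : intm L Q) (up : sol L n Q u p).
Hypothesis qn : 4 * q <= n.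
Let V := mnorm (u L).
Let W := mnorm (du L).

(** Two weights [c] occur: the constant 1, for [sol_id], and e^{- n (t - x)}, for [sol_du]. *)
Lemma sol_int_le (c : R -> R) x U : 0 <= x -> (forall t, x <= t <= L -> 0 <= c t <= 1) ->
  measurable_fun setT c ->
  (forall t, 0 <= t <= L -> mnorm (u t) <= U) ->
  \int[mu]_t (chi (x <= t <= L) * (c t * mnorm (Q t *m u t))) <=
  U * \int[mu]_t (chi (x <= t <= L) * (c t * mnorm (Q t))).
Proof.
move=> x0 c01 mc uU.
have sub f : rintegrable mu (fun t => chi (0 <= t <= L) * f t) ->
    rintegrable mu (fun t => chi (x <= t <= L) * (c t * f t)).
  move=> sf; have sf' := rintegrable_sub sf x0 (lexx L).
  have := rintegrable_meas sf' => mf.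
  apply: (rintegrable_le _ (rintegrable_norm sf')).
    under eq_fun do rewrite mulrCA.
    by apply: measurable_funM.
  move=> t; have [tL|_] := boolP (x <= t <= L); rewrite ?mul0r ?normr0// !mul1r.
  have /andP[c0 c1] := c01 _ tL.
  by rewrite normrM ger0_norm// ler_piMl.
rewrite -intZ; last exact: sub (intm_mnorm iQ).
apply: int_le.
- exact: sub (intm_mnorm (intm_M up.1 iQ)).
- exact: rintegrableZ (sub _ (intm_mnorm iQ)).
- move=> t; have [/[dup] tL /andP[xt tl]|_] := boolP (x <= t <= L);
    rewrite ?mul0r ?mulr0// !mul1r mulrCA.
  have /andP[c0 c1] := c01 _ tL.
  apply: ler_wpM2l => //; rewrite (le_trans (mnormM _ _))// mulrC ler_wpM2r ?mnorm_ge0//.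
  by rewrite uU// (le_trans x0 xt).
Qed.

Lemma int_sub_le (c : R -> R) x : 0 <= x -> (forall t, x <= t <= L -> 0 <= c t <= 1) ->
  measurable_fun setT c ->
  \int[mu]_t (chi (x <= t <= L) * (c t * mnorm (Q t))) <= q.
Proof.
move=> x0 c01 mc; have sQ := intm_mnorm iQ; have mQ := rintegrable_meas sQ.
have E t : chi (x <= t <= L) * (c t * mnorm (Q t)) =
    (chi (0 <= t <= L) * mnorm (Q t)) * (chi (x <= t <= L) * c t).
  have [/andP[xt tL]|_] := boolP (x <= t <= L); rewrite ?mul0r ?mulr0//.
  by rewrite (le_trans x0 xt) tL !mul1r mulrC.
have B t : 0 <= (chi (x <= t <= L) : R) * c t <= 1.
  by have [/c01|_] := boolP (x <= t <= L); rewrite ?mul0r ?mul1r ?lexx ?ler01.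
under eq_Rintegral do rewrite E.
apply: int_le => //.
- apply: (rintegrable_mulbdd (B := 1)) => //; first by apply: measurable_funM => //; meas.
  by move=> t; have /andP[? ?] := B t; rewrite ger0_norm.
- move=> t; rewrite ler_piMr//; first by rewrite mulr_ge0// mnorm_ge0.
  by have /andP[] := B t.
Qed.

Let U0 := 2 * V + 4 * n^-1 * W.

Lemma sol_bound_step U : (forall t, 0 <= t <= L -> mnorm (u t) <= U) ->
  forall x, 0 <= x <= L -> mnorm (u x - u L) <= n^-1 * (2 * W + 2 * (q * U)).
Proof.
move=> uU x xL; have /andP[x0 xl] := xL.
have U_ge0 : 0 <= U by rewrite (le_trans (mnorm_ge0 (u x)))// uU.
have I1 : \int[mu]_t (chi (x <= t <= L) * mnorm (Q t *m u t)) <= q * U.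
  have := @sol_int_le (fun=> 1) x U x0.
  under eq_Rintegral do rewrite mul1r.
  move=> /(_ _ _ uU) H; rewrite mulrC; apply: le_trans (H _ _) _.
  - by move=> t _; rewrite ler01 lexx.
  - exact: measurable_cst.
  - apply: ler_wpM2l => //; apply: int_sub_le => //.
    by move=> t _; rewrite ler01 lexx.
have I2 : \int[mu]_t (chi (x <= t <= L) * (expR (- n * (t - x)) * mnorm (Q t *m u t))) <= q * U.
  have e1 t : x <= t <= L -> 0 <= expR (- n * (t - x)) <= 1.
    move=> /andP[xt _]; rewrite expR_ge0/= -expR0 ler_expR mulNr oppr_le0.
    by rewrite mulr_ge0// ?subr_ge0// ltW.
  have me : measurable_fun setT (fun t : R => expR (- n * (t - x))) by meas.
  apply: le_trans (sol_int_le x0 e1 me uU) _; rewrite mulrC.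
  by apply: ler_wpM2r => //; exact: int_sub_le.
have D : mnorm (du x) <= W + q * U.
  apply: le_trans (sol_du up (erefl _) xL) _; apply: lerD => //.
  rewrite ler_piMl ?mnorm_ge0// -expR0 ler_expR mulNr oppr_le0.
  by rewrite mulr_ge0// ?subr_ge0// ltW.
apply: le_trans (sol_id n0 iQ up (erefl _) (erefl _) xL) _.
apply: ler_wpM2l; first by rewrite invr_ge0 ltW.
have -> : 2 * W + 2 * (q * U) = W + (W + q * U) + q * U by ring.
by rewrite lerD// lerD.
Qed.

(** The supremum S of |u|, finite by absolute continuity, satisfies S <= V + n^{-1} (2 W + 2 q S).
    As 4 q <= n, the term in S is at most S / 2 and is absorbed; solving for S gives the constants
    of [U0]. *)
Lemma sol_bound x : 0 <= x <= L -> mnorm (u x) <= U0.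
Proof.
have [B HB] := acm_bdd up.1.
pose E := [set mnorm (u t) | t in [set t | 0 <= t <= L]].
have hE : has_sup E.
  split; first by exists (mnorm (u 0)); exists 0 => //=; rewrite lexx.
  by exists B => _ [t tL <-]; exact: HB.
have uS t : 0 <= t <= L -> mnorm (u t) <= sup E.
  by move=> tL; apply: ub_le_sup; [exact: hE.2|exists t].
suff : sup E <= U0 by move=> H xL; exact: le_trans (uS x xL) H.
have : sup E <= V + n^-1 * (2 * W + 2 * (q * sup E)).
  apply: ge_sup; first exact: hE.1.
  move=> _ [t tL <-]; rewrite -(subrK (u L) (u t)) addrC.
  by apply: le_trans (mnormD _ _) _; rewrite lerD2l sol_bound_step.
have S0 : 0 <= sup E by rewrite (le_trans (mnorm_ge0 (u 0)))// uS// lexx.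
have : n^-1 * (2 * (q * sup E)) <= 2^-1 * sup E.
  rewrite (_ : n^-1 * _ = (2 * q / n) * sup E); last by ring.
  by apply: ler_wpM2r => //; rewrite ler_pdivrMr//; move: qn; rewrite -/q; clearbody q; lra.
by rewrite /U0 mulrDr; lra.
Qed.

Lemma sol_near x : 0 <= x <= L ->
  mnorm (u x - u L) <= n^-1 * (2 * W + 2 * (q * U0)).
Proof. by apply: sol_bound_step => t; exact: sol_bound. Qed.

(** The factor e^{-n t} is kept inside the integral: it makes the bound tend to 0 by dominated
    convergence, whereas the cruder bound by q would not. *)
Lemma sol_du0 : mnorm (p 0) <= expR (- n * L) * W +
  U0 * \int[mu]_t (expR (- n * t) * (chi (0 <= t <= L) * mnorm (Q t))).
Proof.
have H0 : 0 <= (0 : R) <= L by rewrite lexx.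
have := sol_du up (erefl _) H0.
rewrite mulr0 expR0 scale1r subr0 => H; apply: le_trans H _; rewrite lerD2l.
have e1 t : 0 <= t <= L -> 0 <= expR (- n * (t - 0)) <= 1.
  move=> /andP[xt _]; rewrite expR_ge0/= -expR0 ler_expR mulNr oppr_le0.
  by rewrite mulr_ge0// ?subr_ge0// ltW.
have me : measurable_fun setT (fun t : R => expR (- n * (t - 0))) by meas.
apply: le_trans (sol_int_le (lexx 0) e1 me sol_bound) _.
by under eq_Rintegral do rewrite subr0 mulrCA.
Qed.

End Apriori.

(** * Geometric series, exponential integrals and tail integrals *)

Section Geometric.
Context {R : realType}.

Lemma series_geometric (u : nat -> R) c :
  (forall m, `|u m| <= c * 2^-1 ^+ m) ->
  cvgn (series u) /\ forall N, `|limn (series u) - series u N| <= 2 * c * 2^-1 ^+ N.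
Proof.
move=> uc.
have c0 : 0 <= c by rewrite (le_trans (normr_ge0 (u 0)))// (le_trans (uc 0))// expr0 mulr1.
have cu : cvgn (series u).
  apply: normed_cvg; apply: (series_le_cvg (v_ := geometric c 2^-1)).
  - by move=> m; exact: normr_ge0.
  - by move=> m; rewrite /geometric /= mulr_ge0// exprn_ge0.
  - by move=> m; exact: uc.
  - by apply: is_cvg_geometric_series; rewrite ger0_norm// invf_lt1// ltr1n.
split=> // N.
have tail M : `|series u (N + M)%N - series u N| <= 2 * c * 2^-1 ^+ N * (1 - 2^-1 ^+ M).
  elim: M => [|M IH]; first by rewrite addn0 subrr normr0 expr0 subrr mulr0.
  rewrite addnS /series /= big_nat_recr//= addrAC.
  apply: le_trans (ler_normD _ _) _.
  apply: le_trans (lerD IH (uc _)) _.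
  rewrite exprS exprD; set a := _ ^+ N; set b := _ ^+ M.
  by rewrite le_eqVlt; apply/orP; left; apply/eqP; field.
have cN : (`|series u (N + M)%N - series u N|) @[M --> \oo] --> `|limn (series u) - series u N|.
  apply: cvg_norm; apply: cvgB; last exact: cvg_cst.
  rewrite (_ : (fun M => series u (N + M)%N) = (fun M => series u (M + N)%N)); last first.
    by apply/funext => M; rewrite addnC.
  by rewrite cvg_shiftn.
have e : cvgn (fun M => `|series u (N + M)%N - series u N|) by apply/cvg_ex; eexists; exact: cN.
rewrite -(cvg_lim (@Rhausdorff R) cN); apply: limr_le => //.
apply: nearW => M; apply: le_trans (tail M) _.
rewrite ler_piMr//; first by rewrite !mulr_ge0// exprn_ge0.
Qed.

Local Notation mu := (@lebesgue_measure R).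

Lemma rintegrable_expR (c a b : R) : 0 <= a ->
  rintegrable mu (fun s => chi (a <= s <= b) * expR (c * s)).
Proof.
move=> a0; apply/rintegrable_itv/continuous_compact_integrable; first exact: segment_compact.
apply: continuous_subspaceT => z; apply: continuous_comp; last exact: continuous_expR.
by apply: cvgM; [exact: cvg_cst|exact: cvg_id].
Qed.

Lemma int_expR (c a b : R) : c != 0 -> 0 <= a -> a <= b ->
  \int[mu]_s (chi (a <= s <= b) * expR (c * s)) = (expR (c * b) - expR (c * a)) / c.
Proof.
move=> c0 a0 ab; have [_ ->//] := ac_expR b c.
have -> : \int[mu]_t (chi (a <= t <= b) * (c * expR (c * t))) =
    \int[mu]_t (c * (chi (a <= t <= b) * expR (c * t))).
  by apply: int_ext => t; rewrite mulrCA.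
rewrite intZ; last exact: rintegrable_expR.
by rewrite mulrAC mulfV// mul1r.
Qed.

Lemma int_expR_half (c a b : R) : c != 0 -> 0 <= a -> a <= b ->
  \int[mu]_s (chi (a <= s < b) * expR (c * s)) = (expR (c * b) - expR (c * a)) / c.
Proof.
move=> c0 a0 ab; rewrite -int_expR//; apply: int_ae; [by meas|by meas|].
apply: (@filterS _ _ (ae_filter_ringOfSetsType mu)) (ae_neq b) => t tb.
by rewrite [t < b]lt_neqAle tb.
Qed.

Lemma ac_tail L (h : R -> R) : rintegrable mu h ->
  ac L (fun x => \int[mu]_t (chi (x < t) * h t)) (fun x => - h x).
Proof.
move=> sh; have mh := rintegrable_meas sh.
have sc c : measurable_fun setT (fun t => (chi (c t) : R)) -> rintegrable mu (fun t => chi (c t) * h t).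
  move=> mc; apply: (rintegrable_eq (f := fun t : measurableTypeR R => h t * chi (c t))).
    by move=> t; rewrite mulrC.
  by apply: (rintegrable_mulbdd (B := 1)) => // t; exact: norm_chi.
split.
  apply: (rintegrable_eq (f := fun t : measurableTypeR R => - (chi (0 <= t <= L) * h t))).
    by move=> t; rewrite mulrN.
  by apply: rintegrableN; apply: sc; meas.
move=> x y x0 xy yL; rewrite -intB; try by apply: sc; meas.
apply: int_ae; [by meas|by meas|].
apply: (@filterS _ _ (ae_filter_ringOfSetsType mu)) (ae_neq x) => t tx.
rewrite mulrN -mulrBl -mulNr; congr (_ * _).
case: (ltgtP x t) tx => // xt _ /=; last by rewrite ltNge (le_trans (ltW xt))//= subrr oppr0.
by case: (leP t y) => /= ty; rewrite ?sub0r ?subrr ?oppr0.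
Qed.

End Geometric.

Section PlaneMeasure.
Context {R : realType}.
Local Notation mu := (@lebesgue_measure R).
Local Notation RR := (measurableTypeR R).

(** A named copy of the product measure that carries its own sigma-finiteness, so that it can serve
    as a factor in a further product over three variables. *)
Definition plane_measure : set (RR * RR)%type -> \bar R := (mu \x mu)%E.

HB.instance Definition _ := Measure.copy plane_measure (mu \x mu)%E.

Let plane_sigma_finite : sigma_finite setT plane_measure.
Proof.
have /sigma_finiteP[F [TF ndF Foo]] := sigma_finiteT mu.
exists (fun n => F n `*` F n) => [|n]; last first.
  have [? ?] := Foo n; split; first exact: measurableX.
  by rewrite /plane_measure product_measure1E// lte_mul_pinfty// ge0_fin_numE.
rewrite -setXTT TF predeqE => -[x y]; split=> [[/= [n _ Fnx] [m _ Fmy]]|].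
  exists (maxn n m) => //; split => /=.
  - by move: x Fnx; exact/subsetPset/ndF/leq_maxl.
  - by move: y Fmy; exact/subsetPset/ndF/leq_maxr.
by move=> [n _ []/= ? ?]; split; exists n.
Qed.

HB.instance Definition _ := Measure_isSigmaFinite.Build _ _ _ plane_measure
  plane_sigma_finite.

End PlaneMeasure.

(** * The kernel of phi, independent of n, as a Neumann series *)

Section Kernel.
Context {R : realType} {k : nat}.
Local Notation mu := (@lebesgue_measure R).
Local Notation RR := (measurableTypeR R).
Local Notation mu2 := (@plane_measure R).
Variables (L : R) (Q : R -> 'M[R]_k).
Hypotheses (L0 : 0 <= L) (iQ : intm L Q).

Let Qb (i j : 'I_k) (t : RR) : R := chi (0 <= t <= L) * Q t i j.
Let q := \int[mu]_t (chi (0 <= t <= L) * mnorm (Q t)).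
(** The integral of e^{lam s'} over [0, s] is at most e^{lam s} / lam, so [kstep] multiplies a
    weighted bound by q / lam <= 1 / 2. The summand 1 keeps [lam] positive when q = 0. *)
Let lam := 2 * q + 1.

Lemma sQb i j : rintegrable mu (Qb i j). Proof. exact: iQ. Qed.
Let mQb i j := rintegrable_meas (sQb i j).

Lemma kq_ge0 : 0 <= q.
Proof. by apply: Rintegral_ge0 => t _; rewrite mulr_ge0// mnorm_ge0. Qed.
Let q0 := kq_ge0.
Let lam0 : 0 < lam. Proof. by rewrite ltr_wpDl// mulr_ge0. Qed.

Lemma int_Qb_le i : \sum_l \int[mu]_t `|Qb i l t| <= q.
Proof.
rewrite -int_sum; last by move=> l; exact/rintegrable_norm/sQb.
apply: int_le; first by apply: rintegrable_sum => l; exact/rintegrable_norm/sQb.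
  exact: intm_mnorm.
move=> t; rewrite /Qb /mnorm.
have [_|_] := boolP (0 <= t <= L); last first.
  by rewrite mul0r big1// => l _; rewrite mul0r normr0.
rewrite mul1r [leRHS](bigD1 i)//=; under eq_bigr do rewrite mul1r.
by rewrite lerDl; apply: sumr_ge0 => i' _; apply: sumr_ge0.
Qed.

Definition box (z : RR * RR) : bool := (0 <= z.1 <= L) && (0 <= z.2 <= L).

(* Inserting phi(x) = 1 + int_0^L e^{-n s} k(x, s) ds in the integral equation
   phi(x) = 1 + int_x^L n^{-1} (1 - e^{-n (t - x)}) Q(t) phi(t) dt and comparing
   the coefficients of e^{-n s} gives k = kseed + kstep k, independently of n. *)
Definition kseed i j (z : RR * RR) : R :=
  chi (box z) * \int[mu]_t (Qb i j t * chi (z.1 + z.2 < t)).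

(** Write t = w.1 and x = z.1. As n^{-1} (1 - e^{-n (t - x)}) is the integral of e^{-n r} over 0 <=
    r < t - x, its product with e^{-n w.2} contributes to the coefficient of e^{-n z.2} exactly when
    z.2 - w.2 lies in that range; the middle two indicators say so. *)
Definition kstep (f : 'I_k -> 'I_k -> RR * RR -> R) i j (z : RR * RR) : R :=
  chi (box z) * \sum_l \int[mu2]_w (Qb i l w.1 * chi (z.1 < w.1) *
    chi (z.2 - w.1 + z.1 < w.2) * chi (w.2 <= z.2) * f l j w).

(* Under the weight e^{lam s} the operator kstep contracts by 1/2. *)
Definition kgood c (f : 'I_k -> 'I_k -> RR * RR -> R) :=
  forall i j, [/\ measurable_fun setT (f i j),
    forall z, `|f i j z| <= c * expR (lam * z.2) &
    forall z, f i j z != 0 -> box z && (z.1 + z.2 < L)].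

Lemma measurable_box : measurable_fun setT (fun z => chi (box z) : R).
Proof. by rewrite /box; meas. Qed.

Lemma kgood_c c f : kgood c f -> forall i j : 'I_k, 0 <= c.
Proof.
move=> fc i j; have [_ H _] := fc i j.
have := H (0, 0); rewrite /= mulr0 expR0 mulr1; exact: le_trans.
Qed.

Lemma kseed_good : kgood q kseed.
Proof.
move=> i j; split.
- apply: measurable_funM; first exact: measurable_box.
  apply: (@measurable_param_int _ _ _ _ R mu
    (fun z : (RR * RR) * RR => Qb i j z.2 * chi (z.1.1 + z.1.2 < z.2))).
  by have mq := mQb i j; meas.
- move=> z; rewrite /kseed normrM.
  have [bz|_] := boolP (box z); last by rewrite normr0 mul0r mulr_ge0// expR_ge0.
  rewrite normr1 mul1r; apply: (@le_trans _ _ q).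
    apply: le_trans (int_Qb_le i); rewrite (bigD1 j)//= -[leLHS]addr0 lerD//; last first.
      by apply: sumr_ge0 => l _; apply: Rintegral_ge0.
    apply: int_normr_le; [by have mq := mQb i j; meas|exact/rintegrable_norm/sQb|].
    by move=> t; rewrite normrM ler_piMr// norm_chi.
  rewrite ler_peMr// -expR0 ler_expR mulr_ge0 ?(ltW lam0)//.
  by case/andP : bz => _ /andP[].
- move=> z; rewrite /kseed; have [bz|_] := boolP (box z); last by rewrite mul0r eqxx.
  rewrite mul1r; case: ltP => // Lz.
  rewrite (_ : \int[mu]_t _ = 0) ?eqxx//.
  rewrite -[RHS](@int0 _ _ _ mu); apply: int_ext => t; rewrite /Qb.
  have [/andP[_ tL]|_] := boolP (0 <= t <= L); last by rewrite !mul0r.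
  by rewrite ltNge (le_trans tL Lz) mulr0.
Qed.

Section step.
Variables (c : R) (f : 'I_k -> 'I_k -> RR * RR -> R).
Hypothesis fc : kgood c f.

Let F i l j (zw : (RR * RR) * (RR * RR)) : R :=
  Qb i l zw.2.1 * chi (zw.1.1 < zw.2.1) *
    chi (zw.1.2 - zw.2.1 + zw.1.1 < zw.2.2) * chi (zw.2.2 <= zw.1.2) * f l j zw.2.

Lemma measurable_kstep_integrand i l j : measurable_fun setT (F i l j).
Proof. by have mq := mQb i l; have [mf _ _] := fc l j; rewrite /F; meas. Qed.

Lemma kstep_integrand_le i l j z t s : `|F i l j (z, (t, s))| <=
  `|Qb i l t| * (c * (chi (0 <= s <= z.2) * expR (lam * s))).
Proof.
have [_ fb fs] := fc l j.
rewrite /F /=; move: (Qb i l t) => a; rewrite !normrM -!mulrA ler_wpM2l//.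
have c0 := kgood_c fc l j.
have [->|/fs /andP[/andP[_ /andP[/= s0 _]] _]] := eqVneq (f l j (t, s)) 0.
  by rewrite normr0 !mulr0 !mulr_ge0// expR_ge0.
rewrite s0 /=; case: (leP s z.2) => sz; last by rewrite normr0 !(mul0r, mulr0).
rewrite normr1 !mul1r.
apply: (@le_trans _ _ `|f l j (t, s)|); last exact: (fb (t, s)).
by rewrite mulrA ler_piMl// mulr_ile1// norm_chi.
Qed.

Lemma rintegrable_kexp s : rintegrable mu (fun s' => c * (chi (0 <= s' <= s) * expR (lam * s'))).
Proof. by apply: rintegrableZ; exact: rintegrable_expR. Qed.

Lemma measurable_kstep_section i l j z : measurable_fun setT (fun w => F i l j (z, w)).
Proof. apply: (@measurable_fun_pair2 _ _ _ _ _ _ (F i l j)); exact: measurable_kstep_integrand. Qed.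

Lemma rintegrable_kstep_integrand i l j z : rintegrable mu2 (fun w => F i l j (z, w)).
Proof.
apply: (rintegrable_prod _ (rintegrable_norm (sQb i l)) (rintegrable_kexp z.2)).
- exact: measurable_kstep_section.
- by move=> t s; exact: kstep_integrand_le.
Qed.

(** The bound is q times the integral of c e^{lam s}, see [lam]. The support condition is inherited
    because the second indicator forces z.1 + z.2 < w.1 + w.2, and w.1 + w.2 < L wherever [f] is
    nonzero. *)
Lemma kstep_good : kgood (c / 2) (kstep f).
Proof.
move=> i j; have c0 := kgood_c fc i j; split.
- apply: measurable_funM; first exact: measurable_box.
  apply: measurable_sum => l.
  exact: (measurable_param_int mu2 (measurable_kstep_integrand i l j)).
- move=> z; rewrite /kstep normrM.
  have [bz|_] := boolP (box z); last first.
    by rewrite normr0 mul0r mulr_ge0// ?expR_ge0// divr_ge0.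
  rewrite normr1 mul1r.
  have z20 : 0 <= z.2 by case/andP : bz => _ /andP[].
  pose e := \int[mu]_s (c * (chi (0 <= s <= z.2) * expR (lam * s))).
  have eE : e <= c / lam * expR (lam * z.2).
    rewrite /e intZ; last exact: rintegrable_expR.
    rewrite int_expR ?gt_eqF// mulr0 expR0 -mulrA ler_wpM2l// mulrC ler_wpM2l//.
      by rewrite invr_ge0 ltW.
    by rewrite lerBlDr lerDl.
  have e0 : 0 <= e.
    by apply: Rintegral_ge0 => s _; rewrite !mulr_ge0// expR_ge0.
  have B l : `|\int[mu2]_w F i l j (z, w)| <= (\int[mu]_t `|Qb i l t|) * e.
    pose G (w : RR * RR) : R := `|Qb i l w.1| * (c * (chi (0 <= w.2 <= z.2) * expR (lam * w.2))).
    have mG : measurable_fun setT G by have mq := mQb i l; rewrite /G; meas.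
    have sa := rintegrable_norm (sQb i l). have sb := rintegrable_kexp z.2.
    have GG t s : `|G (t, s)| <= `|Qb i l t| * (c * (chi (0 <= s <= z.2) * expR (lam * s))).
      by rewrite /G /= normrM normr_id ger0_norm// !mulr_ge0// expR_ge0.
    apply: (@le_trans _ _ (\int[mu2]_w G w)).
      apply: int_normr_le.
      - exact: measurable_kstep_section.
      - exact: (rintegrable_prod mG sa sb GG).
      - by case=> t s; exact: kstep_integrand_le.
    rewrite -(int_bprod1 mG sa sb GG) mulrC -intZ//; rewrite le_eqVlt; apply/orP; left.
    by apply/eqP; apply: int_ext => t; rewrite /G /= intZ// mulrC.
  apply: le_trans (ler_norm_sum _ _ _) _.
  apply: (@le_trans _ _ (\sum_l (\int[mu]_t `|Qb i l t|) * e)).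
    by apply: ler_sum => l _; exact: B.
  rewrite -mulr_suml; apply: le_trans (ler_wpM2r e0 (int_Qb_le i)) _.
  apply: le_trans (ler_wpM2l q0 eE) _.
  rewrite mulrA ler_wpM2r ?expR_ge0// mulrCA ler_wpM2l//.
  by rewrite ler_pdivrMr// /lam; lra.
- move=> z; rewrite /kstep; have [bz|_] := boolP (box z); last by rewrite mul0r eqxx.
  rewrite mul1r; case: ltP => // Lz.
  rewrite big1 ?eqxx// => l _.
  rewrite -[RHS](@int0 _ _ _ mu2); apply: int_ext => -[t s] /=.
  have [_ _ fs] := fc l j.
  have [->|/fs /andP[_ /= ts]] := eqVneq (f l j (t, s)) 0; first by rewrite mulr0.
  case: (ltP (z.2 - t + z.1) s) => zs; last by rewrite mulr0 !mul0r.
  suff : false by []. 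
  by move: ts; rewrite ltNge => /negP; case; lra.
Qed.

End step.

Fixpoint kterm m : 'I_k -> 'I_k -> RR * RR -> R :=
  if m is m'.+1 then kstep (kterm m') else kseed.

Lemma kterm_good m : kgood (q * 2^-1 ^+ m) (kterm m).
Proof.
elim: m => [|m IH] /=; first by rewrite expr0 mulr1; exact: kseed_good.
by rewrite exprSr mulrA; exact: kstep_good.
Qed.

Definition kern i j z := limn (series (fun m => kterm m i j z)).

Lemma kern_series i j z : cvgn (series (fun m => kterm m i j z)) /\
  forall N, `|kern i j z - series (fun m => kterm m i j z) N| <=
    2 * (q * expR (lam * z.2)) * 2^-1 ^+ N.
Proof.
apply: series_geometric => m; have [_ H _] := kterm_good m i j.
by apply: le_trans (H z) _; rewrite mulrAC.
Qed.

Lemma measurable_kpart i j N :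
  measurable_fun setT (fun z => series (fun m => kterm m i j z) N).
Proof.
rewrite /series /=; under eq_fun do rewrite big_mkord.
by apply: measurable_sum => m; have [] := kterm_good m i j.
Qed.

Lemma kern_good : kgood (2 * q) kern.
Proof.
move=> i j; split.
- apply: (@measurable_fun_cvg _ _ _ setT (fun N z => series (fun m => kterm m i j z) N)).
    by move=> N; exact: measurable_kpart.
  by move=> z _; exact: (kern_series i j z).1.
- move=> z; have [_ /(_ 0%N)] := kern_series i j z.
  by rewrite expr0 mulr1 /series /= big_geq// subr0 mulrA.
- move=> z kz; apply/negP => /negP H.
  move/negP : kz; apply; apply/eqP; rewrite /kern.
  rewrite (_ : series _ = fun=> 0); first exact: lim_cst.
  apply/funext => N; rewrite /series /= big1// => m _.
  apply/eqP; apply: contraT => m0; have [_ _ /(_ _ m0)] := kterm_good m i j.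
  by rewrite (negbTE H).
Qed.

(** The partial sums satisfy S_{N+1} = [kseed] + [kstep] S_N. The remainder [kern] - S_N is itself
    [kgood] with a constant of order 2^{-N}, so the contraction estimate alone carries [kstep] S_N
    to [kstep] [kern]. *)
Lemma kern_fix i j z : kern i j z = kseed i j z + kstep kern i j z.
Proof.
pose S N l j z : R := series (fun m => kterm m l j z) N.
have SE N : kstep (S N) i j z = series (fun m => kterm m.+1 i j z) N.
  rewrite /kstep /= /series /= -mulr_sumr exchange_big /=; congr (_ * _).
  apply: eq_bigr => l _; rewrite -int_sum; last first.
    by move=> m; exact: (rintegrable_kstep_integrand (kterm_good m) i l j z).
  by apply: int_ext => w; rewrite /S /series /= mulr_sumr.
have good N : kgood (2 * q * 2^-1 ^+ N) (fun l j z => kern l j z - S N l j z).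
  move=> l j'; have [mk _ ks] := kern_good l j'; split.
  - by apply: measurable_funB => //; exact: measurable_kpart.
  - move=> w; have [_ /(_ N) H] := kern_series l j' w.
    by apply: le_trans H _; rewrite mulrA mulrAC.
  - move=> w; apply: contraNT => H; rewrite subr_eq0; apply/eqP.
    have -> : kern l j' w = 0 by apply/eqP; apply: contraNT H => /ks.
    rewrite /S /series /= big1// => m _.
    by apply/eqP; apply: contraNT H => m0; have [_ _ /(_ _ m0)] := kterm_good m l j'.
have SgoodI N l : rintegrable mu2 (fun w => Qb i l w.1 * chi (z.1 < w.1) *
    chi (z.2 - w.1 + z.1 < w.2) * chi (w.2 <= z.2) * S N l j w).
  apply: (rintegrable_eq (f := fun w : (RR * RR)%type => \sum_(0 <= m < N) (Qb i l w.1 * chi (z.1 < w.1) *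
    chi (z.2 - w.1 + z.1 < w.2) * chi (w.2 <= z.2) * kterm m l j w))).
    by move=> w; rewrite /S /series /= mulr_sumr.
  apply: rintegrable_sum => m.
  exact: (rintegrable_kstep_integrand (kterm_good m) i l j z).
have D N : kstep kern i j z - kstep (S N) i j z = kstep (fun l j z => kern l j z - S N l j z) i j z.
  rewrite /kstep -mulrBr -sumrB; congr (_ * _); apply: eq_bigr => l _.
  rewrite -intB//; last exact: (rintegrable_kstep_integrand kern_good i l j z).
  by apply: int_ext => w; rewrite mulrBr.
have c1 : kstep (S N) i j z @[N --> \oo] --> kstep kern i j z.
  apply/cvgrPdist_le => e e0.
  have : 2 * q * expR (lam * z.2) * 2^-1 ^+ N @[N --> \oo] --> 2 * q * expR (lam * z.2) * 0.
    by apply: cvgM; [exact: cvg_cst|apply: cvg_expr; rewrite ger0_norm// invf_lt1// ltr1n].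
  rewrite mulr0 => /cvgrPdist_le/(_ _ e0); apply: filterS => N.
  rewrite sub0r normrN ger0_norm; last by rewrite !mulr_ge0// expR_ge0.
  apply: le_trans; rewrite D.
  have [_ H _] := kstep_good (good N) i j; apply: le_trans (H z) _.
  have : 0 <= q * expR (lam * z.2) * 2^-1 ^+ N by rewrite !mulr_ge0// expR_ge0.
  set x := expR _; set y := _ ^+ N => xy0.
  have -> : 2 * q * y / 2 * x = q * x * y by field.
  have -> : 2 * q * x * y = 2 * (q * x * y) by ring.
  lra.
have c2 : S N.+1 i j z @[N --> \oo] --> kern i j z.
  by rewrite (cvg_shiftS (fun N => S N i j z)); exact: (kern_series i j z).1.
have E N : S N.+1 i j z = kseed i j z + kstep (S N) i j z.
  by rewrite SE /S /series /= big_nat_recl.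
have c3 : S N.+1 i j z @[N --> \oo] --> kseed i j z + kstep kern i j z.
  under eq_fun do rewrite E.
  by apply: cvgD => //; exact: cvg_cst.
by rewrite -(cvg_lim (@Rhausdorff R) c2) (cvg_lim (@Rhausdorff R) c3).
Qed.

End Kernel.

(** * The solution phi with phi(L) = 1 and phi'(L) = 0 *)

Section KernelSolution.
Context {R : realType} {k : nat}.
Local Notation mu := (@lebesgue_measure R).
Local Notation RR := (measurableTypeR R).
Local Notation mu2 := (@plane_measure R).
Variables (L n : R) (Q : R -> 'M[R]_k).
Hypotheses (L0 : 0 <= L) (n0 : 0 < n) (iQ : intm L Q).

Let Qb (i j : 'I_k) (t : RR) : R := chi (0 <= t <= L) * Q t i j.
Let sQ i j : rintegrable mu (Qb i j) := iQ i j.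
Let mQ i j := rintegrable_meas (sQ i j).
Let K := kern L Q.

(** The weighted bound of [kern_good] at the largest exponent s = L; it does not involve n. *)
Definition kbound : R := 2 * (\int[mu]_t (chi (0 <= t <= L) * mnorm (Q t))) *
  expR ((2 * (\int[mu]_t (chi (0 <= t <= L) * mnorm (Q t))) + 1) * L).

Lemma kbound_ge0 : 0 <= kbound.
Proof. by rewrite !mulr_ge0 ?expR_ge0//; exact: kq_ge0. Qed.
Let C0 := kbound_ge0.

Lemma measurable_kern i j : measurable_fun setT (K i j).
Proof. by have [] := kern_good iQ i j. Qed.
Let mK := measurable_kern.

Lemma kern_le i j z : `|K i j z| <= kbound * chi (0 <= z.2 <= L).
Proof.
have [_ /(_ z) H Hs] := kern_good iQ i j.
have [->|/Hs /andP[/andP[_ zL] _]] := eqVneq (K i j z) 0.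
  by rewrite normr0 mulr_ge0.
rewrite zL mulr1 /K; apply: le_trans H _.
rewrite ler_wpM2l ?ler_expR ?ler_wpM2l//.
- by rewrite mulr_ge0//; exact: kq_ge0.
- by rewrite addr_ge0// mulr_ge0//; exact: kq_ge0.
- by case/andP : zL.
Qed.

Lemma kern_supp i j t s : K i j (t, s) != 0 -> 0 <= s /\ t + s < L.
Proof. by have [_ _ H] := kern_good iQ i j => /H /andP[/andP[_ /andP[]]]. Qed.

Let ex (s : RR) : R := chi (0 <= s <= L) * expR (- n * s).
Let sex : rintegrable mu ex := rintegrable_expR (- n) L (lexx 0).
Let mex := rintegrable_meas sex.

Lemma ex_le s : `|ex s| <= chi (0 <= s <= L).
Proof.
rewrite /ex; have [/andP[s0 _]|_] := boolP (_ && _); last by rewrite mul0r normr0.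
by rewrite mul1r ger0_norm ?expR_ge0// -expR0 ler_expR mulNr oppr_le0 mulr_ge0// ltW.
Qed.

Definition kphi i j (x : RR) : R :=
  (i == j)%:R + \int[mu]_s (ex s * K i j (x, s)).

(** This is the integral of e^{-n r} over [0, z]; for x < t, [Dn (t - x)] is the Green function of
    u'' - n u' with zero data at the right end. *)
Let Dn (z : R) : R := (1 - expR (- n * z)) / n.

Lemma chi_Dn_le x t : `|(chi (x < t) : R) * Dn (t - x)| <= n^-1.
Proof.
case: (ltP x t) => xt; last by rewrite mul0r normr0 invr_ge0 ltW.
rewrite mul1r /Dn ger0_norm.
  by rewrite ler_piMl// ?invr_ge0 ?ltW// lerBlDr lerDl expR_ge0.
rewrite divr_ge0 ?(ltW n0)// subr_ge0 -expR0 ler_expR mulNr oppr_le0.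
by rewrite mulr_ge0 ?(ltW n0)// subr_ge0 ltW.
Qed.

Lemma int_exp_window a b : 0 <= a -> a <= b ->
  \int[mu]_s (chi (a <= s < b) * expR (- n * s)) = expR (- n * a) * Dn (b - a).
Proof.
move=> a0 ab; rewrite int_expR_half//; last by rewrite oppr_eq0 gt_eqF.
have -> : expR (- n * b) = expR (- n * a) * expR (- n * (b - a)).
  by rewrite -expRD; congr expR; ring.
by rewrite /Dn invrN; field; rewrite gt_eqF.
Qed.

Lemma kphi_seed i j x : 0 <= x <= L ->
  \int[mu]_s (ex s * kseed L Q i j (x, s)) =
  \int[mu]_t (Qb i j t * (chi (x < t) * Dn (t - x))).
Proof.
move=> /andP[x0 xL].
pose F (z : RR * RR) : R := ex z.1 * (Qb i j z.2 * chi (x + z.1 < z.2)).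
have mq := mQ i j.
have mF : measurable_fun setT F by rewrite /F; meas.
have FB s t : `|F (s, t)| <= `|ex s| * `|Qb i j t|.
  by rewrite /F /= !normrM ler_wpM2l// ler_piMr// norm_chi.
have sa := rintegrable_norm sex. have sb := rintegrable_norm (sQ i j).
transitivity (\int[mu]_s \int[mu]_t F (s, t)).
  apply: int_ext => s; rewrite /F /kseed /= -/(Qb i j) intZ; last first.
    by apply: (rintegrable_mulbdd (B := 1)) => //; [meas|move=> t; exact: norm_chi].
  rewrite /ex /box /= x0 xL /=.
  by case: (_ && _); rewrite ?mul1r ?mul0r.
rewrite (int_swap mF sa sb FB); apply: int_ext => t; rewrite /F /=.
have [-> |Qt] := eqVneq (Qb i j t) 0.
  by rewrite mul0r; under eq_Rintegral do rewrite !(mul0r, mulr0); rewrite int0.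
have tL : 0 <= t <= L.
  by apply: contraNT Qt => /negbTE; rewrite /Qb => ->; rewrite mul0r.
transitivity (Qb i j t * \int[mu]_s (chi (0 <= s < t - x) * expR (- n * s))).
  rewrite -intZ.
    apply: int_ext => s; rewrite /ex mulrCA; congr (_ * _).
    rewrite mulrAC; congr (_ * _); rewrite ltrBrDl.
    case: (leP 0 s) => s0 /=; rewrite ?mul0r//.
    case: (ltP (x + s) t) => xs; rewrite ?mulr0// mulr1 (_ : s <= L)//.
    by case/andP : tL => t0 tL; lra.
  apply: (rintegrable_le _ (rintegrable_expR (- n) (t - x) (lexx 0))); first by meas.
  move=> s; rewrite ger0_norm ?mulr_ge0 ?expR_ge0// ler_wpM2r ?expR_ge0//.
  by case: (leP 0 s) => //= _; case: (ltP s (t - x)) => // /ltW ->.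
congr (_ * _); case: (ltP x t) => xt.
  by rewrite int_exp_window// ?subr_ge0 ?ltW// mulr0 expR0 subr0 !mul1r.
rewrite mul0r -[RHS](@int0 _ _ _ mu); apply: int_ext => s.
rewrite (_ : _ && _ = false) ?mul0r//; apply/negP => /andP[]; lra.
Qed.

(** After exchanging the integrals, the exponent variable s runs for fixed w over a window of length
    w.1 - x starting at w.2, so e^{-n s} integrates to e^{-n w.2} [Dn (w.1 - x)]: the exponential of
    the kernel times the Green function. *)
Lemma kphi_step i j x : 0 <= x <= L ->
  \int[mu]_s (ex s * kstep L Q K i j (x, s)) =
  \sum_l \int[mu]_t (Qb i l t * (chi (x < t) * Dn (t - x)) *
    \int[mu]_s (ex s * K l j (t, s))).
Proof.
move=> /andP[x0 xL].
pose G l (z : RR * (RR * RR)) : R := ex z.1 * (Qb i l z.2.1 * chi (x < z.2.1) *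
    chi (z.1 - z.2.1 + x < z.2.2) * chi (z.2.2 <= z.1) * K l j z.2).
have mG l : measurable_fun setT (G l).
  by have mq := mQ i l; have mk := mK l j; rewrite /G; meas.
pose b l (w : RR * RR) : R := `|Qb i l w.1| * (kbound * chi (0 <= w.2 <= L)).
have scL : rintegrable mu (fun s : RR => kbound * chi (0 <= s <= L)).
  apply: rintegrableZ; have := rintegrable_expR 0 L (lexx 0).
  by apply: rintegrable_eq => s; rewrite mul0r expR0 mulr1.
have mb l : measurable_fun setT (b l).
  by have mq := mQ i l; rewrite /b; meas.
have sb l : rintegrable mu2 (b l).
  apply: (rintegrable_prod (mb l) (rintegrable_norm (sQ i l)) scL) => t s.
  by rewrite /b /= normrM normr_id ger0_norm// mulr_ge0.
have Gw l s w : `|G l (s, w)| <= `|ex s| * b l w.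
  rewrite /G /b /=; move: (Qb i l w.1) (ex s) => a e; rewrite normrM ler_wpM2l//.
  rewrite normrM; apply: ler_pM => //; last exact: kern_le.
  rewrite -!mulrA normrM ler_piMr// normrM mulr_ile1 ?norm_chi//.
  by rewrite normrM mulr_ile1 ?norm_chi.
have sa := rintegrable_norm sex.
have sG1 l s : rintegrable mu2 (fun w => G l (s, w)) := rintegrable_section1 (mG l) (sb l) (Gw l) s.
transitivity (\sum_l \int[mu]_s \int[mu2]_w G l (s, w)).
  rewrite -int_sum; last by move=> l; exact: (rintegrable_bint1 (mG l) sa (sb l) (Gw l)).
  apply: int_ext => s; rewrite /kstep /=.
  have -> : ex s * (chi (box L (x, s)) * \sum_l \int[mu2]_w (chi (0 <= w.1 <= L) * Q w.1 i l *
      chi (x < w.1) * chi (s - w.1 + x < w.2) * chi (w.2 <= s) * K l j w)) =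
      ex s * \sum_l \int[mu2]_w (Qb i l w.1 *
      chi (x < w.1) * chi (s - w.1 + x < w.2) * chi (w.2 <= s) * K l j w).
    rewrite /ex /box /= x0 xL /=.
    by case: (_ && _); rewrite ?mul1r ?mul0r.
  rewrite mulr_sumr; apply: eq_bigr => l _; rewrite -intZ//.
  exact: (rintegrable_kstep_integrand iQ (kern_good iQ) i l j (x, s)).
apply: eq_bigr => l _.
rewrite (int_swap (mG l) sa (sb l) (Gw l)).
pose F (w : RR * RR) : R := (Qb i l w.1 * (chi (x < w.1) * Dn (w.1 - x))) * (ex w.2 * K l j w).
have mF : measurable_fun setT F.
  by have mq := mQ i l; have mk := mK l j; rewrite /F /Dn; meas.
have mD : measurable_fun setT (fun t : RR => (chi (x < t) : R) * Dn (t - x)).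
  by rewrite /Dn; meas.
have sQD : rintegrable mu (fun t => Qb i l t * (chi (x < t) * Dn (t - x))).
  exact: (rintegrable_mulbdd (sQ i l) mD (chi_Dn_le x)).
have FB t s : `|F (t, s)| <= `|Qb i l t * (chi (x < t) * Dn (t - x))| * (kbound * chi (0 <= s <= L)).
  rewrite /F /= normrM ler_wpM2l// normrM -[leRHS]mul1r; apply: ler_pM => //.
    by apply: le_trans (ex_le s) _; case: (_ && _).
  exact: (kern_le l j (t, s)).
transitivity (\int[mu2]_w F w); last first.
  rewrite -(int_bprod1 mF (rintegrable_norm sQD) scL FB).
  apply: int_ext => t; rewrite /F /= -intZ//.
  apply: (rintegrable_le _ scL).
    apply: measurable_funM => //.
    by apply: (@measurable_fun_pair2 _ _ _ _ _ _ (K l j)); exact: mK.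
  move=> s; rewrite normrM -[leRHS]mul1r; apply: ler_pM => //.
    by apply: le_trans (ex_le s) _; case: (_ && _).
  exact: (kern_le l j (t, s)).
apply: int_ext => -[t s]; rewrite /G /F /=.
have [-> |Kt] := eqVneq (K l j (t, s)) 0.
  by rewrite !mulr0; under eq_Rintegral do rewrite !mulr0; rewrite int0.
have [s0 tsL] := kern_supp Kt.
case: (ltP x t) => xt; last first.
  by rewrite mul0r mulr0 mul0r; under eq_Rintegral do rewrite !(mulr0, mul0r); rewrite int0.
have sL : s <= L by lra.
transitivity (Qb i l t * K l j (t, s) * \int[mu]_r (chi (s <= r < s + (t - x)) * expR (- n * r))).
  rewrite -intZ; last first.
    apply: (rintegrable_le _ (rintegrable_expR (- n) (s + (t - x)) (lexx 0))); first by meas.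
    move=> r; rewrite ger0_norm ?mulr_ge0 ?expR_ge0// ler_wpM2r ?expR_ge0//.
    case: (leP s r) => //= sr; case: (ltP r) => // /ltW ->.
    by rewrite (le_trans s0 sr).
  apply: int_ext => r; rewrite /ex.
  (* The cut-off r <= L inside [ex] is automatic: r < s + t - x <= s + t < L on the support of the
     kernel. *)
  have -> : (s <= r < s + (t - x)) = [&& (0 <= r <= L), (r - t + x < s) & (s <= r)].
    apply/andP/and3P => [[sr rs]|[/andP[r0 rL] h1 h2]].
      by split=> //; [apply/andP; split; lra|lra].
    by split=> //; lra.
  by case: (0 <= r <= L); case: (r - t + x < s); case: (s <= r) => /=; ring.
rewrite int_exp_window//; last by rewrite lerDl subr_ge0 ltW.
rewrite (_ : s + (t - x) - s = t - x); last by ring.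
by rewrite /ex s0 sL /= !mul1r; ring.
Qed.

Lemma rintegrable_exK i j x : rintegrable mu (fun s => ex s * K i j (x, s)).
Proof.
apply: (rintegrable_mulbdd (B := kbound)) => //.
- by apply: (@measurable_fun_pair2 _ _ _ _ _ _ (K i j)); exact: mK.
- move=> s; apply: le_trans (kern_le i j (x, s)) _.
  by rewrite ler_piMr//; case: (_ && _).
Qed.

Lemma measurable_kphi i j : measurable_fun setT (kphi i j).
Proof.
apply: measurable_funD => //.
apply: (@measurable_param_int _ _ _ _ R mu (fun z : RR * RR => ex z.2 * K i j z)).
by have mk := mK i j; meas.
Qed.

Lemma kphi_bdd i j x : `|kphi i j x| <= 1 + kbound * \int[mu]_s `|ex s|.
Proof.
rewrite /kphi; apply: le_trans (ler_normD _ _) _; apply: lerD.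
  by case: (_ == _); rewrite ?normr1 ?normr0.
rewrite -intZ; last exact: rintegrable_norm.
apply: int_normr_le; first exact: rintegrable_meas (rintegrable_exK i j x).
  by apply: rintegrableZ; exact: rintegrable_norm.
move=> s; rewrite normrM mulrC ler_wpM2r//; apply: le_trans (kern_le i j (x, s)) _.
by rewrite ler_piMr//; case: (_ && _).
Qed.

Let h i j (t : RR) : R := \sum_l Qb i l t * kphi l j t.

Lemma rintegrable_Qkphi i l j : rintegrable mu (fun t => Qb i l t * kphi l j t).
Proof.
exact: (rintegrable_mulbdd (sQ i l) (measurable_kphi l j) (kphi_bdd l j)).
Qed.

Lemma rintegrable_h i j : rintegrable mu (h i j).
Proof. by apply: rintegrable_sum => l; exact: rintegrable_Qkphi. Qed.

(** Integrate [kern_fix] against e^{-n s}: the seed accounts for the identity part of phi under the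
    integral, and the step for its kernel part. *)
Lemma kphi_eq i j x : 0 <= x <= L ->
  kphi i j x = (i == j)%:R + \int[mu]_t (chi (x < t) * Dn (t - x) * h i j t).
Proof.
move=> xL; rewrite /kphi; congr (_ + _).
have mD : measurable_fun setT (fun t : RR => (chi (x < t) : R) * Dn (t - x)).
  by rewrite /Dn; meas.
have fixK s : K i j (x, s) = kseed L Q i j (x, s) + kstep L Q K i j (x, s).
  exact: kern_fix.
have sQD l : rintegrable mu (fun t => Qb i l t * (chi (x < t) * Dn (t - x))).
  exact: (rintegrable_mulbdd (sQ i l) mD (chi_Dn_le x)).
have sQDk l : rintegrable mu (fun t => Qb i l t * (chi (x < t) * Dn (t - x)) * kphi l j t).
  exact: (rintegrable_mulbdd (sQD l) (measurable_kphi l j) (kphi_bdd l j)).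
have good1 := kseed_good iQ. have good2 := kstep_good iQ (kern_good iQ).
have sg c f : kgood L Q c f -> rintegrable mu (fun s => ex s * f i j (x, s)).
  move=> /(_ i j) [mf fb fs].
  apply: (rintegrable_le (g := fun s => `|ex s| * (c * expR
     ((2 * (\int[mu]_t (chi (0 <= t <= L) * mnorm (Q t))) + 1) * L)))).
  - apply: measurable_funM => //.
    by apply: (@measurable_fun_pair2 _ _ _ _ _ _ (f i j)).
  - apply: (rintegrable_eq (f := fun s : RR => (c * expR
     ((2 * (\int[mu]_t (chi (0 <= t <= L) * mnorm (Q t))) + 1) * L)) * `|ex s|)).
      by move=> s; rewrite mulrC.
    by apply: rintegrableZ; exact: rintegrable_norm.
  - move=> s; rewrite normrM ler_wpM2l//.
    have c0 : 0 <= c.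
      by have := fb (0, 0); rewrite /= mulr0 expR0 mulr1; exact: le_trans.
    have [->|/fs/andP[/andP[_ /andP[/= s0 sL]] _]] := eqVneq (f i j (x, s)) 0.
      by rewrite normr0 mulr_ge0// expR_ge0.
    apply: le_trans (fb _) _; rewrite ler_wpM2l// ler_expR ler_wpM2l//.
    by rewrite addr_ge0// mulr_ge0//; exact: kq_ge0.
under eq_Rintegral do rewrite fixK mulrDr.
rewrite intD; [|exact: sg good1|exact: sg good2].
rewrite kphi_seed// kphi_step//.
have -> : \int[mu]_t (Qb i j t * (chi (x < t) * Dn (t - x))) =
    \sum_l \int[mu]_t (Qb i l t * (chi (x < t) * Dn (t - x)) * (l == j)%:R).
  rewrite (bigD1 j)//= eqxx big1 ?addr0.
    by apply: int_ext => t; rewrite mulr1.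
  move=> l /negbTE ->; rewrite -[RHS](@int0 _ _ _ mu); apply: int_ext => t.
  by rewrite mulr0.
rewrite -big_split /=.
transitivity (\sum_l \int[mu]_t (Qb i l t * (chi (x < t) * Dn (t - x)) * kphi l j t)).
  apply: eq_bigr => l _; rewrite -intD.
  - by apply: int_ext => t; rewrite -mulrDr.
  - apply: (rintegrable_eq (f := fun t : RR => (l == j)%:R * (Qb i l t * (chi (x < t) * Dn (t - x))))).
      by move=> t; rewrite mulrC.
    exact: rintegrableZ.
  - apply: (rintegrable_eq (f := fun t : RR => Qb i l t * (chi (x < t) * Dn (t - x)) * kphi l j t
       - (l == j)%:R * (Qb i l t * (chi (x < t) * Dn (t - x))))).
      by move=> t; rewrite /kphi; ring.
    by apply: rintegrableB => //; exact: rintegrableZ.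
rewrite -int_sum//; apply: int_ext => t; rewrite /h mulr_sumr.
by apply: eq_bigr => l _; rewrite mulrAC mulrC.
Qed.

Definition kPhi (x : R) : 'M[R]_k := \matrix_(i, j) kphi i j x.
Definition kP (x : R) : 'M[R]_k :=
  \matrix_(i, j) (- \int[mu]_t (chi (x < t) * (expR (- n * t) * h i j t))).

(** Splitting [Dn (t - x)] as n^{-1} (1 - e^{n x} e^{-n t}) writes phi as 1, plus n^{-1} times a
    tail integral of [h], plus n^{-1} e^{n x} [kP]. On differentiation the two terms in [h] cancel
    and e^{n x} [kP] remains. *)
Lemma kPhi_sol : sol L n Q kPhi kP.
Proof.
have hE i j t : 0 <= t <= L -> h i j t = (Q t *m kPhi t) i j.
  move=> tL; rewrite mxE; apply: eq_bigr => l _.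
  by rewrite /Qb tL mul1r mxE.
have seh i j : rintegrable mu (fun t => expR (- n * t) * h i j t).
  have mh := rintegrable_meas (rintegrable_h i j).
  apply: (rintegrable_le _ (rintegrable_norm (rintegrable_h i j))); first by meas.
  move=> t; have [tL|tL] := boolP (0 <= t <= L); last first.
    rewrite /h big1 ?mulr0 ?normr0// => l _.
    by rewrite /Qb (negbTE tL) !mul0r.
  rewrite normrM ler_piMl// ger0_norm ?expR_ge0// -expR0 ler_expR mulNr oppr_le0.
  by rewrite mulr_ge0 ?(ltW n0)//; case/andP : tL.
have aP i j : ac L (fun x => kP x i j) (fun x => expR (- n * x) * h i j x).
  have := ac_N (ac_tail L (seh i j)).
  by apply: ac_ext => t _; rewrite ?mxE// opprK.
split=> i j; last first.
  by apply: ac_ext (aP i j) => t tL //; rewrite [RHS]mxE hE.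
have a1 := ac_Z n^-1 (ac_tail L (rintegrable_h i j)).
have a2 := ac_Z n^-1 (ac_mul (ac_expR L n) (aP i j)).
have := ac_D (ac_cst L (i == j)%:R) (ac_D a1 a2).
apply: ac_ext => t tL; last first.
  rewrite [in RHS]mxE /= [kP t i j]mxE.
  have -> : expR (n * t) * (expR (- n * t) * h i j t) = h i j t.
    by rewrite mulrA -expRD mulNr subrr expR0 mul1r.
  by field; rewrite gt_eqF.
rewrite [in RHS]mxE kphi_eq// [kP t i j]mxE; congr (_ + _).
have sc f : rintegrable mu f -> rintegrable mu (fun s : RR => chi (t < s) * f s).
  move=> sf; apply: (rintegrable_eq (f := fun s : RR => f s * chi (t < s))).
    by move=> s; rewrite mulrC.
  by apply: (rintegrable_mulbdd (B := 1)) => //; [meas|move=> s; exact: norm_chi].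
rewrite mulrN -mulrDr -intZ; last exact: sc.
rewrite -intB; [|exact: sc (rintegrable_h i j)|by apply: rintegrableZ; exact: sc].
rewrite -intZ; last first.
  by apply: rintegrableB; [exact: sc (rintegrable_h i j)|apply: rintegrableZ; exact: sc].
apply: int_ext => s; rewrite /Dn.
have -> : expR (- n * (s - t)) = expR (n * t) * expR (- n * s).
  by rewrite -expRD; congr expR; ring.
by ring.
Qed.

Lemma kPhi_end : kPhi L = 1%:M /\ kP L = 0.
Proof.
have h0 i j t : L < t -> h i j t = 0.
  move=> Lt; rewrite /h big1// => l _; rewrite /Qb [t <= L]leNgt Lt andbF /=.
  by rewrite !mul0r.
split; apply/matrixP => i j; rewrite !mxE.
  rewrite kphi_eq ?L0 ?lexx// (_ : \int[mu]_t _ = 0) ?addr0//.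
  rewrite -[RHS](@int0 _ _ _ mu); apply: int_ext => t.
  by case: (ltP L t) => Lt; rewrite ?mul0r// h0 ?mulr0.
rewrite (_ : \int[mu]_t _ = 0) ?oppr0//.
rewrite -[RHS](@int0 _ _ _ mu); apply: int_ext => t.
by case: (ltP L t) => Lt; rewrite ?mul0r// h0 ?mulr0.
Qed.

End KernelSolution.

(** * Mikusinski's inversion of the Laplace transform *)

Section Mikusinski.
Context {R : realType}.
Implicit Types (J : nat -> R) (t l : R).

(* (1 - exp(- e^(n t) X)) expanded in powers of X, with X^k read as J (k n);
   when J m = e^(- m tau) the value tends to the indicator of tau < t. *)
Definition mik_sum t J (n N : nat) : R :=
  - \sum_(1 <= k < N) (-1) ^+ k / k`!%:R * expR ((k * n)%:R * t) * J (k * n)%N.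

Definition mik t J l := exists ln : nat -> R,
  (forall n, mik_sum t J n N @[N --> \oo] --> ln n) /\ ln n @[n --> \oo] --> l.

Lemma mik_D t J J' l l' : mik t J l -> mik t J' l' ->
  mik t (fun m => J m + J' m) (l + l').
Proof.
move=> [ln [Jl ll]] [ln' [Jl' ll']]; exists (fun n => ln n + ln' n); split.
  move=> n.
  have -> : (fun N => mik_sum t (fun m => J m + J' m) n N) =
      (fun N => mik_sum t J n N + mik_sum t J' n N).
    apply/funext => N; rewrite /mik_sum -opprD -big_split /=; congr (- _).
    by apply: eq_bigr => k _; rewrite mulrDr.
  exact: cvgD.
exact: cvgD.
Qed.

Lemma series_exp_le (y : R) N : 0 <= y ->
  \sum_(0 <= k < N) y ^+ k / k`!%:R <= expR y.
Proof.
move=> y0; apply: (@nondecreasing_cvgn_le _ (series (exp_coeff y))).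
- apply/nondecreasing_series => k _ _; rewrite /exp_coeff /=.
  by rewrite divr_ge0// exprn_ge0.
- exact: is_cvg_series_exp_coeff.
Qed.

Lemma series_exp_le1 (y : R) N : 0 <= y ->
  \sum_(1 <= k < N) y ^+ k / k`!%:R <= expR y - 1.
Proof.
move=> y0; case: N => [|N].
  by rewrite big_geq// subr_ge0 -expR0 ler_expR.
have := series_exp_le N.+1 y0.
by rewrite big_ltn// expr0 fact0 divr1 -lerBrDl.
Qed.

Lemma cvg_expRn (c : R) : c < 0 -> expR (n%:R * c) @[n --> \oo] --> (0 : R).
Proof.
move=> c0; under eq_fun do rewrite expRM_natl.
by apply: cvg_expr; rewrite ger0_norm ?expR_ge0// expR_lt1.
Qed.

(** The decay of J bounds the k-th term by C y^k / k! with y = e^{n (t - L)}, so the sum is at most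
    C (e^y - 1), and y tends to 0 because t < L. As k >= 1, only indices k n >= n enter, hence a
    bound on J from [m0] on is enough. *)
Lemma mik_eq0 t J l (C L : R) m0 : t < L ->
  (forall m, (m0 <= m)%N -> `|J m| <= C * expR (- (m%:R * L))) ->
  mik t J l -> l = 0.
Proof.
move=> tL JC [ln [Jl ll]].
have C0 : 0 <= C.
  have := le_trans (normr_ge0 _) (JC m0 (leqnn _)).
  by rewrite pmulr_lge0// expR_gt0.
pose y n := expR (n%:R * (t - L)).
have yc : y n @[n --> \oo] --> (0 : R) by apply: cvg_expRn; rewrite subr_lt0.
have B n : (m0 <= n)%N -> `|ln n| <= C * (expR (y n) - 1).
  move=> mn.
  have cl : `|mik_sum t J n N| @[N --> \oo] --> `|ln n| by apply: cvg_norm; exact: Jl.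
  rewrite -(cvg_lim (@Rhausdorff R) cl); apply: limr_le; first by apply/cvg_ex; eexists; exact: cl.
  apply: nearW => N; rewrite /mik_sum normrN.
  apply: le_trans (ler_norm_sum _ _ _) _.
  apply: (@le_trans _ _ (C * \sum_(1 <= k < N) y n ^+ k / k`!%:R)); last first.
    by rewrite ler_wpM2l// series_exp_le1// expR_ge0.
  rewrite mulr_sumr big_nat [leRHS]big_nat; apply: ler_sum => k /andP[k1 _].
  rewrite !normrM normrX normrN1 expr1n mul1r ger0_norm ?invr_ge0// (ger0_norm (expR_ge0 _)).
  have kn : (m0 <= k * n)%N by rewrite (leq_trans mn)// leq_pmull.
  apply: le_trans (ler_wpM2l _ (JC _ kn)) _; first by rewrite mulr_ge0 ?expR_ge0.
  rewrite /y -expRM_natl mulrCA; apply: ler_wpM2l => //.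
  rewrite -mulrA -expRD mulrC; apply: ler_wpM2r => //.
  by rewrite ler_expR natrM le_eqVlt; apply/orP; left; apply/eqP; ring.
have cz : C * (expR (y n) - 1) @[n --> \oo] --> (0 : R).
  have -> : (0 : R) = C * (expR 0 - 1) by rewrite expR0 subrr mulr0.
  apply: cvgM; first exact: cvg_cst.
  apply: cvgB; last exact: cvg_cst.
  by apply: continuous_cvg => //; exact: continuous_expR.
have l0 : ln n @[n --> \oo] --> (0 : R).
  apply/norm_cvg0P; apply: squeeze_cvgr (cvg_cst 0) cz.
  by exists m0 => // n mn; rewrite normr_ge0 B.
by rewrite -(cvg_lim (@Rhausdorff R) ll) (cvg_lim (@Rhausdorff R) l0).
Qed.

(* The pointwise limit of 1 - exp(- e^{n (t - s)}), hence the value at s = t. *)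
Definition step_weight t (s : R) : R :=
  if s < t then 1 else if s == t then 1 - expR (-1) else 0.

Lemma step_weight_itv t s : 0 <= step_weight t s <= 1.
Proof.
rewrite /step_weight; case: ifP => _; first by rewrite ler01 lexx.
case: ifP => _; last by rewrite lexx ler01.
by rewrite subr_ge0 lerBlDr lerDl expR_ge0 andbT -[leRHS]expR0 ler_expR lerN10.
Qed.

Lemma step_weight_lim t s :
  1 - expR (- expR (n%:R * (t - s))) @[n --> \oo] --> step_weight t s.
Proof.
rewrite /step_weight; case: ltrgtP => ts.
- rewrite -[X in _ --> X]subr0; apply: cvgB; first exact: cvg_cst.
  apply: squeeze_cvgr (cvg_cst 0) (cvg_expRn (c := s - t) _); last by rewrite subr_lt0.
  apply: nearW => n; rewrite expR_ge0 /=.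
  have -> : n%:R * (s - t) = - (n%:R * (t - s)) by ring.
  rewrite !expRN lef_pV2 ?posrE ?expR_gt0//.
  by rewrite (le_trans _ (expR_ge1Dx _))// lerDr.
- have -> : (0 : R) = 1 - expR (- 0) by rewrite oppr0 expR0 subrr.
  apply: cvgB; first exact: cvg_cst.
  apply: continuous_cvg; first exact: continuous_expR.
  by apply: cvgN; apply: cvg_expRn; rewrite subr_lt0.
- rewrite ts subrr; under eq_fun do rewrite mulr0 expR0.
  exact: cvg_cst.
Qed.

Lemma measurable_step_weight t : measurable_fun setT (step_weight t).
Proof.
have H (n : nat) : measurable_fun setT (fun s : R => 1 - expR (- expR (n%:R * (t - s)))).
  by meas.
apply: (measurable_fun_cvg (h := fun n (s : R) => 1 - expR (- expR (n%:R * (t - s)))) H).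
by move=> s _; exact: step_weight_lim.
Qed.

Section integral.
Context {d} {T : measurableType d}.
Variables (nu : {measure set T -> \bar R}) (f tau : T -> R) (t : R).
Hypotheses (sf : rintegrable nu f) (mtau : measurable_fun setT tau)
  (tau0 : forall w, f w != 0 -> 0 <= tau w).

Lemma rintegrable_expf (m : R) : 0 <= m -> rintegrable nu (fun w => expR (- (m * tau w)) * f w).
Proof.
move=> m0; have mf := rintegrable_meas sf.
apply: (rintegrable_le _ (rintegrable_norm sf)).
  by meas.
move=> w; have [->|/tau0 tw] := eqVneq (f w) 0; first by rewrite mulr0 normr0.
rewrite normrM ler_piMl// ger0_norm ?expR_ge0// -expR0 ler_expR oppr_le0.
exact: mulr_ge0.
Qed.

Let P n N w := - \sum_(1 <= k < N) (- expR (n%:R * (t - tau w))) ^+ k / k`!%:R.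

Let mexpt n : measurable_fun setT (fun w => expR (n%:R * (t - tau w))).
Proof. by meas. Qed.

Lemma mik_int_sum n N :
  mik_sum t (fun m => \int[nu]_w (expR (- (m%:R * tau w)) * f w)) n N =
  \int[nu]_w (P n N w * f w).
Proof.
rewrite /mik_sum.
transitivity (- \int[nu]_w \sum_(1 <= k < N) ((-1) ^+ k / k`!%:R * expR ((k * n)%:R * t)) *
     (expR (- ((k * n)%:R * tau w)) * f w)).
  rewrite int_sum; last by move=> k; apply: rintegrableZ; exact: rintegrable_expf.
  by congr (- _); apply: eq_bigr => k _; rewrite intZ//; exact: rintegrable_expf.
rewrite -intN; last first.
  by apply: rintegrable_sum => k; apply: rintegrableZ; exact: rintegrable_expf.
apply: int_ext => w; rewrite /P mulNr mulr_suml; congr (- _).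
apply: eq_bigr => k _; rewrite [in RHS]exprNn -[in RHS]expRM_natl.
have -> : expR (k%:R * (n%:R * (t - tau w))) = expR ((k * n)%:R * t) * expR (- ((k * n)%:R * tau w)).
  by rewrite -expRD natrM; congr expR; ring.
by ring.
Qed.

(** Both limits are dominated convergence. At fixed n the partial sums are bounded by e^{e^{n t}}
    |f|, because tau >= 0 where f is nonzero; as n grows, 1 - exp(- e^{n (t - tau)}) stays in [0, 1]
    and |f| dominates. *)
Lemma mik_int : mik t (fun m => \int[nu]_w (expR (- (m%:R * tau w)) * f w))
  (\int[nu]_w (step_weight t (tau w) * f w)).
Proof.
have mf := rintegrable_meas sf.
have sfn := rintegrable_norm sf.
have mE n : measurable_fun setT (fun w => 1 - expR (- expR (n%:R * (t - tau w)))).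
  by meas.
exists (fun n => \int[nu]_w ((1 - expR (- expR (n%:R * (t - tau w)))) * f w)); split.
  move=> n; under eq_fun do rewrite mik_int_sum.
  apply: (int_dom_cvg (g := fun w => expR (expR (n%:R * t)) * `|f w|)).
  - move=> N; apply: measurable_funM => //; apply: measurable_funN.
    apply: measurable_sum => k; apply: measurable_funM => //.
    by apply: measurable_funX; exact: measurable_funN.
  - exact: measurable_funM.
  - exact: rintegrableZ.
  - apply/aeW => w; apply: cvgM; last exact: cvg_cst.
    (* The sum starts at k = 1; the shift to [N.+1] ensures that the missing term k = 0, equal to 1,
       is present in the full exponential sum. *)
    have E N : P n N.+1 w = 1 - \sum_(0 <= k < N.+1) (- expR (n%:R * (t - tau w))) ^+ k / k`!%:R.
      by rewrite /P [in RHS]big_ltn// expr0 fact0 divr1 opprD addNKr.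
    have : P n N.+1 w @[N --> \oo] --> 1 - expR (- expR (n%:R * (t - tau w))).
      under eq_fun do rewrite E.
      apply: cvgB; first exact: cvg_cst.
      rewrite (cvg_shiftS (fun N => \sum_(0 <= k < N) (- expR (n%:R * (t - tau w))) ^+ k / k`!%:R)).
      exact: is_cvg_series_exp_coeff.
    by rewrite (cvg_shiftS (fun N => P n N w)).
  - move=> N w; rewrite normrM; have [->|/tau0 tw] := eqVneq (f w) 0.
      by rewrite normr0 !mulr0.
    apply: ler_wpM2r => //; rewrite /P normrN; apply: le_trans (ler_norm_sum _ _ _) _.
    apply: (@le_trans _ _ (\sum_(1 <= k < N) (expR (n%:R * (t - tau w))) ^+ k / k`!%:R)).
      apply: ler_sum => k _; rewrite normrM normrX normrN (ger0_norm (expR_ge0 _)).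
      by rewrite (@ger0_norm _ (_^-1))// invr_ge0.
    apply: le_trans (series_exp_le1 _ (expR_ge0 _)) _.
    apply: (@le_trans _ _ (expR (expR (n%:R * (t - tau w))))); first by rewrite gerBl.
    by rewrite ler_expR ler_expR ler_wpM2l// gerBl.
apply: (int_dom_cvg (g := fun w => `|f w|)) => //.
- by move=> n; exact: measurable_funM.
- by have mw := measurable_step_weight t; meas.
- by apply/aeW => w; apply: cvgM; [exact: step_weight_lim|exact: cvg_cst].
- move=> n w; rewrite normrM ler_piMl// ger0_norm.
    by rewrite lerBlDr lerDl expR_ge0.
  by rewrite subr_ge0 -expR0 ler_expR oppr_le0 expR_ge0.
Qed.

End integral.
End Mikusinski.

(** * From averages over intervals to bounds almost everywhere *)

Section LebesguePoints.
Context {R : realType}.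
Local Notation mu := (@lebesgue_measure R).

Lemma int_chi (a b : R) : a <= b ->
  rintegrable mu (fun s => chi (a <= s <= b)) /\
  \int[mu]_s (chi (a <= s <= b) : R) = b - a.
Proof.
move=> ab; have E s : (chi (a <= s <= b) : R) = chi (a <= s <= b) * cst 1 s.
  by rewrite mulr1.
split.
  under eq_fun do rewrite E; apply/rintegrable_itv.
  apply: continuous_compact_integrable; first exact: segment_compact.
  by apply: continuous_subspaceT => x; exact: cvg_cst.
under eq_Rintegral do rewrite E; rewrite chi_itv Rintegral_cst//= mul1r.
rewrite lebesgue_measure_itv /= lte_fin; case: ltP => //= ba.
by apply/esym/eqP; rewrite subr_eq0 eq_le ab ba.
Qed.

Lemma int_eq0_ae (f : R -> R) : rintegrable mu f -> \int[mu]_x `|f x| = 0 ->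
  {ae mu, forall x, f x = 0}.
Proof.
move=> sf f0; have mf := rintegrable_meas sf.
have mf' : measurable_fun setT (EFin \o f) by exact/measurable_EFinP.
have : (\int[mu]_x `|(EFin \o f) x|)%E = 0.
  have /fineK <- : (\int[mu]_x `|(EFin \o f) x|)%E \is a fin_num.
    exact: (integrable_fin_num measurableT (rintegrable_norm sf)).
  by congr (_%:E).
move=> /(ae_eq_integral_abs mu measurableT mf').
by apply: (@filterS _ _ (ae_filter_ringOfSetsType mu)) => x /(_ I) [].
Qed.

Lemma rintegrable_chi (f : R -> R) (p : R -> bool) : rintegrable mu f ->
  measurable_fun setT (fun x => chi (p x) : R) -> rintegrable mu (fun x => chi (p x) * f x).
Proof.
move=> sf mp; apply: (rintegrable_eq (f := fun x : measurableTypeR R => f x * chi (p x))).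
  by move=> x; rewrite mulrC.
by apply: (rintegrable_mulbdd (B := 1)) => // x; exact: norm_chi.
Qed.

(** At almost every x the indefinite integral has derivative f(x), by Lebesgue differentiation, and
    its difference quotients are at most M in absolute value as long as x + h stays in (0, b). *)
Lemma ae_le_of_int_le (f : R -> R) (b M : R) : rintegrable mu f ->
  (forall x y, 0 <= x -> x <= y -> y <= b ->
    `|\int[mu]_t (chi (x <= t <= y) * f t)| <= M * (y - x)) ->
  {ae mu, forall x, 0 < x < b -> `|f x| <= M}.
Proof.
move=> sf fM.
have ac_f L : ac L (fun x => \int[mu]_(t in `[0, x]) f t) f.
  split; first by apply: rintegrable_chi => //; meas.
  move=> x y x0 xy yL; rewrite -!chi_itv -intB; try by apply: rintegrable_chi => //; meas.
  have mf := rintegrable_meas sf.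
  apply: int_ae; [by meas|by meas|].
  apply: (@filterS _ _ (ae_filter_ringOfSetsType mu)) (ae_neq x) => t tx.
  rewrite -mulrBl; congr (_ * _).
  case: (ltgtP x t) tx => // xt _ /=.
    by rewrite (le_trans x0 (ltW xt)) /= subr0.
  by rewrite (le_trans (ltW xt) xy) subrr.
have := @FTC1 R f (BLeft 0).
move=> /(_ _ _) H.
have loc : locally_integrable setT f by exact: (open_integrable_locally openT sf).
have int0y (y : R) : mu.-integrable [set` Interval (BLeft 0) (BRight y)] (EFin \o f).
  by apply: integrableS sf.
have := H int0y loc.
apply: (@filterS _ _ (ae_filter_ringOfSetsType mu)) => x Hx /andP[x0 xb].
have [|dF <-] := Hx; first by rewrite lte_fin.
rewrite derive1E /derive.
have cF := dF; rewrite /derivable in cF.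
pose g h := h^-1 *: ((\int[mu]_(t in `[0, h *: 1 + x]) f t) - \int[mu]_(t in `[0, x]) f t).
have cg : cvg (g h @[h --> 0^']) by exact: cF.
have -> : `|lim (g h @[h --> 0^'])| = lim (`|g h| @[h --> 0^']).
  by apply/esym/cvg_lim; [exact: Rhausdorff|exact: cvg_norm].
apply: limr_le; first exact: is_cvg_norm.
near=> h.
have hne : h != 0 by near: h; exact: nbhs_dnbhs_neq.
have hx : 0 < x + h < b.
  near: h; apply: nbhs_dnbhs.
  have : (x + h) @[h --> (0 : R)] --> x + 0 by apply: cvgD; [exact: cvg_cst|exact: cvg_id].
  rewrite addr0 => /(_ `]0, b[%classic); rewrite /nbhs /=.
  move=> /(_ _); apply; apply: near_in_itvoo; by rewrite in_itv /= x0 xb.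
rewrite /g [h *: 1]mulr1 normrM normrV ?unitfE//.
rewrite ler_pdivrMl ?normr_gt0//.
have [/andP[xh0 xhb]] := hx.
have [h0|h0|/eqP] := ltrgtP h 0; last by rewrite (negbTE hne).
- rewrite distrC (ac_f x).2//; last 2 first.
  + by rewrite addrC ltW.
  + by rewrite gerDr ltW.
  apply: le_trans (fM _ _ _ _ _) _; rewrite ?(ltW xb)// ?gerDr ?(ltW h0)//; first by rewrite addrC ltW.
  by rewrite ltr0_norm// mulrC opprD addrCA subrr addr0.
- rewrite (ac_f (h + x)).2//; [|exact: ltW|by rewrite lerDr ltW].
  apply: le_trans (fM _ _ _ _ _) _; rewrite ?(ltW x0)// ?lerDr ?(ltW h0)//; first by rewrite addrC ltW.
  by rewrite gtr0_norm// mulrC addrK.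
Unshelve. all: by end_near. Qed.

End LebesguePoints.

(** The window is closed because [step_weight] takes an intermediate value at its jump. *)
Lemma step_weight_diff {R : realType} (t t' s : R) : t <= t' ->
  `|step_weight t' s - step_weight t s| <= chi (t <= s <= t').
Proof.
move=> tt; have [/andP[ts st]|] := boolP (t <= s <= t').
  have /andP[a0 a1] := step_weight_itv t s; have /andP[b0 b1] := step_weight_itv t' s.
  by rewrite ler_norml /= mulr1n; apply/andP; split; lra.
rewrite negb_and -!ltNge => /orP[st|st].
  by rewrite /step_weight (lt_le_trans st tt) st subrr normr0.
rewrite /step_weight !ltNge (ltW st) (le_trans tt (ltW st)) /=.
by rewrite !gt_eqF ?subrr ?normr0// (le_lt_trans tt).
Qed.

Lemma ae_forall_count {R : realType} (I : countType) (P : I -> R -> Prop) :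
  (forall i, {ae @lebesgue_measure R, forall x, P i x}) ->
  {ae @lebesgue_measure R, forall x, forall i, P i x}.
Proof.
move=> H; pose Pn n x := if unpickle n is Some i then P i x else True.
have : {ae @lebesgue_measure R, forall x, forall n, Pn n x}.
  apply: ae_foralln => n; rewrite /Pn; case: unpickle => [i|]; first exact: H.
  by apply/aeW.
apply: (@filterS _ _ (ae_filter_ringOfSetsType (@lebesgue_measure R))) => x Hx i.
by have := Hx (pickle i); rewrite /Pn pickleK.
Qed.

(** * Uniqueness for the homogeneous Volterra equation *)

Section Volterra.
Context {R : realType} {k : nat}.
Local Notation mu := (@lebesgue_measure R).
Local Notation RR := (measurableTypeR R).
Local Notation mu2 := (@plane_measure R).
Variables (L C : R) (D : 'I_k -> 'I_k -> RR -> R) (A B : 'I_k -> 'I_k -> RR * RR -> R).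
Hypotheses (L0 : 0 < L) (C0 : 0 <= C) (sD : forall i j, rintegrable mu (D i j))
  (D0 : forall i j x, ~~ (0 <= x <= L) -> D i j x = 0)
  (mA : forall i j, measurable_fun setT (A i j))
  (mB : forall i j, measurable_fun setT (B i j))
  (AC : forall i j z, `|A i j z| <= C * chi (0 <= z.2 <= L))
  (BC : forall i j z, `|B i j z| <= C * chi (0 <= z.2 <= L)).

(* vol2 and vol3 are the densities of the terms D B + A D and A D B of the
   product (1 + A) D (1 + B) with respect to all the integration variables. *)
Definition vol2 al be (z : RR * RR) : R :=
  \sum_i A al i z * D i be z.1 + \sum_j D al j z.1 * B j be z.

Definition vol3 al be (z : RR * (RR * RR)) : R :=
  \sum_i \sum_j A al i (z.1, z.2.1) * D i j z.1 * B j be (z.1, z.2.2).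

Let dd (x : RR) : R := \sum_i \sum_j `|D i j x|.
Let mD i j := rintegrable_meas (sD i j).

Lemma sdd : rintegrable mu dd.
Proof. by apply: rintegrable_sum => i; apply: rintegrable_sum => j; exact: rintegrable_norm. Qed.
Let mdd := rintegrable_meas sdd.

Lemma dd_ge0 x : 0 <= dd x.
Proof. by apply: sumr_ge0 => i _; apply: sumr_ge0. Qed.

Lemma dd_supp x : ~~ (0 <= x <= L) -> dd x = 0.
Proof.
by move=> xL; rewrite /dd big1// => i _; rewrite big1// => j _; rewrite D0// normr0.
Qed.

Let win (s : RR) : R := chi (0 <= s <= L).
Let swin : rintegrable mu win. Proof. exact: (int_chi (ltW L0)).1. Qed.
Let mwin := rintegrable_meas swin.
Let iwin : \int[mu]_s win s = L.
Proof. by rewrite -[RHS]subr0; exact: (int_chi (ltW L0)).2. Qed.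
Lemma win_itv s : 0 <= win s <= 1.
Proof. by rewrite /win; case: (0 <= s <= L); rewrite ?lexx ?ler01. Qed.

Lemma vol2_le al be x s : `|vol2 al be (x, s)| <= dd x * (2 * C * win s).
Proof.
have S (F G : 'I_k -> R) : (forall i, `|F i| <= C * win s) ->
    \sum_i `|G i| <= dd x -> `|\sum_i F i * G i| <= dd x * (C * win s).
  move=> FC Gd; apply: le_trans (ler_norm_sum _ _ _) _.
  apply: (@le_trans _ _ (\sum_i (C * win s) * `|G i|)).
    by apply: ler_sum => i _; rewrite normrM ler_wpM2r.
  by rewrite -mulr_sumr mulrC ler_wpM2r// mulr_ge0.
rewrite /vol2; apply: le_trans (ler_normD _ _) _.
have -> : dd x * (2 * C * win s) = dd x * (C * win s) + dd x * (C * win s) by ring.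
apply: lerD.
  apply: S => [i|]; first exact: (AC al i (x, s)).
  apply: ler_sum => i _; rewrite (bigD1 be)//= lerDl.
  by apply: sumr_ge0.
under eq_bigr do rewrite mulrC.
apply: S => [i|]; first exact: (BC i be (x, s)).
rewrite /dd [leRHS](bigD1 al)//= lerDl.
by apply: sumr_ge0 => i _; apply: sumr_ge0.
Qed.

Lemma vol3_le al be x w : `|vol3 al be (x, w)| <= dd x * (C * win w.1 * (C * win w.2)).
Proof.
rewrite /vol3 /=; apply: le_trans (ler_norm_sum _ _ _) _.
rewrite /dd mulr_suml; apply: ler_sum => i _.
apply: le_trans (ler_norm_sum _ _ _) _; rewrite mulr_suml; apply: ler_sum => j _.
rewrite !normrM -mulrA mulrCA; apply: ler_wpM2l => //.
exact: ler_pM (normr_ge0 _) (normr_ge0 _) (AC al i (x, w.1)) (BC j be (x, w.2)).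
Qed.

Lemma measurable_vol2 al be : measurable_fun setT (vol2 al be).
Proof.
apply: measurable_funD; apply: measurable_sum => i.
- by have mq := mD i be; have ma := mA al i; meas.
- by have mq := mD al i; have ma := mB i be; meas.
Qed.

Lemma measurable_vol3 al be : measurable_fun setT (vol3 al be).
Proof.
apply: measurable_sum => i; apply: measurable_sum => j.
by have mq := mD i j; have ma := mA al i; have mb := mB j be; meas.
Qed.

Let swin2 : rintegrable mu2 (fun w => C * win w.1 * (C * win w.2)).
Proof.
apply: (rintegrable_prod (a := fun s => C * win s) (b := fun s => C * win s)).
- by meas.
- exact: rintegrableZ.
- exact: rintegrableZ.
- by move=> s s' /=; rewrite ger0_norm// !mulr_ge0.
Qed.

Lemma rintegrable_vol2 al be : rintegrable mu2 (vol2 al be).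
Proof.
apply: (rintegrable_prod (measurable_vol2 al be) sdd (b := fun s => 2 * C * win s)).
- by apply: rintegrableZ.
- by move=> x s; exact: vol2_le.
Qed.

Lemma rintegrable_vol3 al be : rintegrable (mu \x mu2)%E (vol3 al be).
Proof. exact: (rintegrable_prod (measurable_vol3 al be) sdd swin2 (vol3_le al be)). Qed.

Lemma vol2_supp al be z : vol2 al be z != 0 -> 0 <= z.1 + z.2.
Proof.
case: z => x s /=; apply: contraNT; rewrite -ltNge => xs.
rewrite -normr_le0; apply: le_trans (vol2_le al be x s) _.
have [/andP[x0 _]|/dd_supp->] := boolP (0 <= x <= L); last by rewrite mul0r.
rewrite /win (_ : 0 <= s = false) ?mulr0//.
by apply/negbTE; rewrite -ltNge; lra.
Qed.

Lemma vol3_supp al be z : vol3 al be z != 0 -> 0 <= z.1 + z.2.1 + z.2.2.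
Proof.
case: z => x w /=; apply: contraNT; rewrite -ltNge => xs.
rewrite -normr_le0; apply: le_trans (vol3_le al be x w) _.
have [/andP[x0 _]|/dd_supp->] := boolP (0 <= x <= L); last by rewrite mul0r.
rewrite /win; have [/andP[w1 _]|_] := boolP (0 <= w.1 <= L); last by rewrite !(mulr0, mul0r).
rewrite (_ : 0 <= w.2 = false) ?mulr0//.
by apply/negbTE; rewrite -ltNge; lra.
Qed.

Hypothesis vol_eq : forall al be t, 0 <= t -> t < L ->
  \int[mu]_x (step_weight t x * D al be x) +
  \int[mu2]_z (step_weight t (z.1 + z.2) * vol2 al be z) +
  \int[(mu \x mu2)%E]_z (step_weight t (z.1 + z.2.1 + z.2.2) * vol3 al be z) = 0.

Let v (T : R) := \int[mu]_x (chi (x <= T) * dd x).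
(** The term 2 C comes from [vol2]. In [vol3] one kernel variable is free in [0, L] and the other is
    confined to a short window, hence C L C. *)
Let c := 2 * C + C * L * C.

Lemma v_ge0 T : 0 <= v T.
Proof. by apply: Rintegral_ge0 => x _; rewrite mulr_ge0// dd_ge0. Qed.

Lemma c_ge0 : 0 <= c.
Proof. by rewrite addr_ge0// !mulr_ge0// ltW. Qed.

Lemma v_integrand T : rintegrable mu (fun x => chi (x <= T) * dd x).
Proof. by apply: rintegrable_chi; [exact: sdd|meas]. Qed.

Lemma window_le a b x : a <= b ->
  \int[mu]_s (win s * chi (a <= x + s <= b)) <= b - a.
Proof.
move=> ab; have ab' : a - x <= b - x by lra.
have [s2 E] := int_chi ab'.
have <- : b - x - (a - x) = b - a by ring.
rewrite -E; apply: int_le => //.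
  apply: (rintegrable_mulbdd (B := 1)) => //; first by meas.
  by move=> s; exact: norm_chi.
move=> s; rewrite (_ : (a - x <= s <= b - x) = (a <= x + s <= b)).
  by rewrite ler_piMl//; case/andP : (win_itv s).
by apply/andP/andP => -[? ?]; split; lra.
Qed.

(** The two weights differ only for t <= x + s <= t'. Since s >= 0 this forces x <= t', which leaves
    the mass [v t'], and for each x the variable s is confined to an interval of length t' - t. *)
Lemma vol2_increment al be t t' : t <= t' ->
  `|\int[mu2]_z ((step_weight t' (z.1 + z.2) - step_weight t (z.1 + z.2)) * vol2 al be z)|
  <= 2 * C * (t' - t) * v t'.
Proof.
move=> tt.
pose F (z : RR * RR) : R := chi (z.1 <= t') * dd z.1 * (2 * C * (win z.2 * chi (t <= z.1 + z.2 <= t'))).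
have mF : measurable_fun setT F by rewrite /F; meas.
have sw : rintegrable mu (fun s => 2 * C * win s) by exact: rintegrableZ.
have FB x s : `|F (x, s)| <= chi (x <= t') * dd x * (2 * C * win s).
  have d0 := dd_ge0 x.
  rewrite /F /= ger0_norm; last by rewrite !mulr_ge0.
  apply: ler_wpM2l; first by rewrite mulr_ge0.
  apply: ler_wpM2l; first by rewrite mulr_ge0.
  by rewrite ler_piMr//; case: (t <= x + s <= t').
have sv := v_integrand t'.
apply: (@le_trans _ _ (\int[mu2]_z F z)).
  apply: int_normr_le.
  - have mw := measurable_step_weight t; have mw' := measurable_step_weight t'.
    have m2 := measurable_vol2 al be; meas.
  - exact: (rintegrable_prod mF sv sw FB).
  - move=> [x s]; rewrite /F /= normrM.
    have dl := step_weight_diff (x + s) tt.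
    apply: le_trans (ler_pM _ _ dl (vol2_le al be x s)) _ => //.
    have [xs|_] := boolP (t <= x + s <= t'); last by rewrite mul0r !mulr_ge0// dd_ge0.
    rewrite mul1r mulr1.
    have [s0|/negbTE s0] := boolP (0 <= s); last by rewrite /win s0 !mulr0.
    rewrite (_ : x <= t') ?mul1r ?mulrA//.
    by case/andP : xs => _; apply: le_trans; rewrite lerDl.
rewrite -(int_bprod1 mF sv sw FB) /F /=.
rewrite /v -intZ//; apply: int_le.
- exact: (rintegrable_bint1 mF sv sw FB).
- exact: rintegrableZ.
- move=> x; rewrite intZ; last first.
    apply: rintegrableZ; apply: (rintegrable_mulbdd (B := 1)) => //; first by meas.
    by move=> s; exact: norm_chi.
  rewrite mulrC; apply: ler_wpM2r; first by rewrite mulr_ge0// dd_ge0.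
  rewrite intZ; last first.
    apply: (rintegrable_mulbdd (B := 1)) => //; first by meas.
    by move=> s; exact: norm_chi.
  by apply: ler_wpM2l; [exact: mulr_ge0|exact: window_le].
Qed.

Lemma vol3_increment al be t t' : t <= t' ->
  `|\int[(mu \x mu2)%E]_z ((step_weight t' (z.1 + z.2.1 + z.2.2) -
      step_weight t (z.1 + z.2.1 + z.2.2)) * vol3 al be z)|
  <= C * L * C * (t' - t) * v t'.
Proof.
move=> tt.
pose g x (w : RR * RR) : R := C * win w.1 * (C * (win w.2 * chi (t <= x + w.1 + w.2 <= t'))).
pose F (z : RR * (RR * RR)) : R := chi (z.1 <= t') * dd z.1 * g z.1 z.2.
have mF : measurable_fun setT F by rewrite /F /g; meas.
have mg x : measurable_fun setT (g x) by rewrite /g; meas.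
have g0 x w : 0 <= g x w by rewrite !mulr_ge0.
have gB x w : `|g x w| <= C * win w.1 * (C * win w.2).
  rewrite ger0_norm// /g; apply: ler_wpM2l; first by rewrite mulr_ge0.
  apply: ler_wpM2l => //.
  by rewrite ler_piMr//; case: (t <= x + w.1 + w.2 <= t').
have sg x : rintegrable mu2 (g x) by apply: rintegrable_le (mg x) swin2 (gB x).
have FB x w : `|F (x, w)| <= chi (x <= t') * dd x * (C * win w.1 * (C * win w.2)).
  have d0 := dd_ge0 x.
  rewrite /F /= normrM ger0_norm; last by rewrite mulr_ge0.
  by apply: ler_wpM2l; [rewrite mulr_ge0|exact: gB].
have sv := v_integrand t'.
apply: (@le_trans _ _ (\int[(mu \x mu2)%E]_z F z)).
  apply: int_normr_le.
  - have mw := measurable_step_weight t; have mw' := measurable_step_weight t'.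
    have m3 := measurable_vol3 al be; meas.
  - exact: (rintegrable_prod mF sv swin2 FB).
  - move=> [x w]; rewrite /F /g /= normrM.
    have dl := step_weight_diff (x + w.1 + w.2) tt.
    apply: le_trans (ler_pM _ _ dl (vol3_le al be x w)) _ => //.
    have [xs|_] := boolP (t <= x + w.1 + w.2 <= t'); last first.
      by rewrite mul0r !mulr_ge0// dd_ge0.
    rewrite mul1r mulr1.
    have [s0|/negbTE s0] := boolP (0 <= w.1); last by rewrite /win s0 !(mulr0, mul0r).
    have [s1|/negbTE s1] := boolP (0 <= w.2); last by rewrite /win s1 !mulr0.
    rewrite (_ : x <= t') ?mul1r ?mulrA//.
    by case/andP : xs => _; apply: le_trans; rewrite -addrA lerDl addr_ge0.
rewrite -(int_bprod1 mF sv swin2 FB) /F /=.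
rewrite /v -intZ//; apply: int_le.
- exact: (rintegrable_bint1 mF sv swin2 FB).
- exact: rintegrableZ.
- move=> x; rewrite intZ//.
  rewrite mulrC; apply: ler_wpM2r; first by rewrite mulr_ge0// dd_ge0.
  have sCw : rintegrable mu (fun s => C * win s) by exact: rintegrableZ.
  have gB' s s' : `|g x (s, s')| <= C * win s * (C * win s') by exact: gB.
  rewrite -(int_bprod1 (mg x) sCw sCw gB').
  apply: (@le_trans _ _ (\int[mu]_s (C * (t' - t) * (C * win s)))); last first.
    rewrite intZ// intZ// iwin le_eqVlt; apply/orP; left; apply/eqP; ring.
  apply: int_le.
  + exact: (rintegrable_bint1 (mg x) sCw sCw gB').
  + exact: rintegrableZ.
  + move=> s; rewrite /g /=.
    have sw : rintegrable mu (fun s' => win s' * chi (t <= x + s + s' <= t')).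
      apply: (rintegrable_mulbdd (B := 1)) => //; first by meas.
      by move=> s'; exact: norm_chi.
    rewrite intZ; last exact: rintegrableZ.
    rewrite intZ// mulrC; apply: ler_wpM2r; first by rewrite mulr_ge0.
    by apply: ler_wpM2l => //; exact: window_le.
Qed.

(** Subtracting [vol_eq] at t from [vol_eq] at t' isolates the mass of D on [t, t']. The other two
    terms are of order (t' - t) v(t') since the kernels are bounded densities in the extra
    variables. *)
Lemma volterra_increment al be t t' : 0 <= t -> t <= t' -> t' < L ->
  `|\int[mu]_x (chi (t <= x <= t') * D al be x)| <= c * v t' * (t' - t).
Proof.
move=> t0 tt tL.
have mw := measurable_step_weight t; have mw' := measurable_step_weight t'.
have wB r s : `|step_weight r s| <= 1.
  by have /andP[? ?] := step_weight_itv r s; rewrite ger0_norm.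
have sw r : rintegrable mu (fun x => step_weight r x * D al be x).
  apply: (rintegrable_eq (f := fun x : RR => D al be x * step_weight r x)).
    by move=> x; rewrite mulrC.
  apply: (rintegrable_mulbdd (B := 1)) => //; exact: measurable_step_weight.
have sw2 r : rintegrable mu2 (fun z => step_weight r (z.1 + z.2) * vol2 al be z).
  apply: (rintegrable_eq (f := fun z : (RR * RR)%type => vol2 al be z * step_weight r (z.1 + z.2))).
    by move=> z; rewrite mulrC.
  apply: (rintegrable_mulbdd (B := 1)) => //; first exact: rintegrable_vol2.
  by have mr := measurable_step_weight r; meas.
have sw3 r : rintegrable (mu \x mu2)%E (fun z => step_weight r (z.1 + z.2.1 + z.2.2) * vol3 al be z).
  apply: (rintegrable_eq (f := fun z : (RR * (RR * RR))%type => vol3 al be z * step_weight r (z.1 + z.2.1 + z.2.2))).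
    by move=> z; rewrite mulrC.
  apply: (rintegrable_mulbdd (B := 1)) => //; first exact: rintegrable_vol3.
  by have mr := measurable_step_weight r; meas.
have E1 : \int[mu]_x (chi (t <= x <= t') * D al be x) =
    \int[mu]_x (step_weight t' x * D al be x) - \int[mu]_x (step_weight t x * D al be x).
  rewrite -intB//; have md := mD al be; apply: int_ae; [by meas|by meas|].
  apply: (@filterS2 _ _ (ae_filter_ringOfSetsType mu) _ _ _ _ (ae_neq t) (ae_neq t')) => x xt xt'.
  rewrite -mulrBl; congr (_ * _); rewrite /step_weight (negbTE xt) (negbTE xt').
  case: (ltgtP x t) xt => //= xt _.
    by rewrite (lt_le_trans xt tt) subrr.
  by rewrite subr0 le_eqVlt (negbTE xt') /=; case: ifP.
have V t1 : 0 <= t1 -> t1 < L -> \int[mu]_x (step_weight t1 x * D al be x) =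
    - (\int[mu2]_z (step_weight t1 (z.1 + z.2) * vol2 al be z)) -
    (\int[(mu \x mu2)%E]_z (step_weight t1 (z.1 + z.2.1 + z.2.2) * vol3 al be z)).
  move=> t10 t1L; move/eqP: (vol_eq al be t10 t1L).
  by rewrite -addrA addr_eq0 => /eqP ->; rewrite opprD.
rewrite E1 (V t)// ?(le_lt_trans tt tL)// (V t')// ?(le_trans t0 tt)//.
have -> (a b a' b' : R) : - a' - b' - (- a - b) = - (a' - a) - (b' - b) by ring.
rewrite -intB// -intB//.
have -> : \int[mu2]_z (step_weight t' (z.1 + z.2) * vol2 al be z -
    step_weight t (z.1 + z.2) * vol2 al be z) = \int[mu2]_z ((step_weight t' (z.1 + z.2) -
    step_weight t (z.1 + z.2)) * vol2 al be z).
  by apply: int_ext => z; rewrite mulrBl.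
have -> : \int[(mu \x mu2)%E]_z (step_weight t' (z.1 + z.2.1 + z.2.2) * vol3 al be z -
    step_weight t (z.1 + z.2.1 + z.2.2) * vol3 al be z) =
    \int[(mu \x mu2)%E]_z ((step_weight t' (z.1 + z.2.1 + z.2.2) -
    step_weight t (z.1 + z.2.1 + z.2.2)) * vol3 al be z).
  by apply: int_ext => z; rewrite mulrBl.
have H2 := vol2_increment al be tt; have H3 := vol3_increment al be tt.
apply: le_trans (ler_normB _ _) _; rewrite normrN.
apply: le_trans (lerD H2 H3) _; rewrite /c le_eqVlt; apply/orP; left; apply/eqP; ring.
Qed.

Let kk : R := k%:R * (k%:R * c).

(** Through Lebesgue points the increments bound each entry of D by c v(T) almost everywhere on (0,
    T), and the k^2 entries give [kk]. As there is no mass below T0, only an interval of length T -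
    T0 contributes to v(T). *)
Lemma v_growth T T0 : 0 <= T0 -> T0 <= T -> T < L -> v T0 = 0 ->
  v T <= kk * v T * (T - T0).
Proof.
move=> T00 TT TL vT0.
have D_T0 : {ae mu, forall x, chi (x <= T0) * dd x = 0}.
  apply: int_eq0_ae; first exact: v_integrand.
  rewrite -[RHS]vT0 /v; apply: int_ext => x.
  by rewrite ger0_norm// mulr_ge0// dd_ge0.
have DM : {ae mu, forall x, 0 < x < T -> dd x <= kk * v T}.
  have H al be : {ae mu, forall x, 0 < x < T -> `|D al be x| <= c * v T}.
    apply: (ae_le_of_int_le (sD al be)) => x y x0 xy yT.
    apply: le_trans (volterra_increment al be x0 xy (le_lt_trans yT TL)) _.
    apply: ler_wpM2r; first by rewrite subr_ge0.
    apply: ler_wpM2l; first exact: c_ge0.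
    apply: int_le; [exact: v_integrand|exact: v_integrand|].
    move=> z; apply: ler_wpM2r; first exact: dd_ge0.
    by case: (leP z y) => // zy; rewrite (le_trans zy yT).
  have : {ae mu, forall x, forall ab : 'I_k * 'I_k, 0 < x < T -> `|D ab.1 ab.2 x| <= c * v T}.
    by apply: ae_forall_count => -[al be]; exact: H.
  apply: (@filterS _ _ (ae_filter_ringOfSetsType mu)) => x Hx xT.
  apply: (@le_trans _ _ (\sum_(i < k) \sum_(j < k) c * v T)).
    by apply: ler_sum => i _; apply: ler_sum => j _; exact: (Hx (i, j)).
  have -> : kk * v T = k%:R * (k%:R * (c * v T)) by rewrite /kk; ring.
  by rewrite !sumr_const !card_ord !mulr_natl.
have [sc Ec] := int_chi TT.
rewrite -Ec -intZ// {1}/v.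
apply: (@le_trans _ _ (\int[mu]_x (chi (T0 <= x <= T) * (chi (x <= T) * dd x)))).
  rewrite le_eqVlt; apply/orP; left; apply/eqP; apply: int_ae; [by meas|by meas|].
  apply: (@filterS _ _ (ae_filter_ringOfSetsType mu) _ _ _ D_T0) => x Hx.
  case: (leP T0 x) => [Tx|/ltW xT0] /=.
    by case: (x <= T); rewrite ?mul1r ?mul0r ?mulr0.
  by rewrite mul0r; move: Hx; rewrite xT0 mul1r => ->; rewrite mulr0.
(* The bound on [dd] holds only almost everywhere while [int_le] compares pointwise; truncating by
   the minimum changes the integrand on a null set only. *)
pose F (x : RR) : R := Num.min (chi (T0 <= x <= T) * (chi (x <= T) * dd x)) (kk * v T * chi (T0 <= x <= T)).
have mF : measurable_fun setT F.
  apply: (measurable_minr (f := fun x : RR => chi (T0 <= x <= T) * (chi (x <= T) * dd x))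
    (g := fun x : RR => kk * v T * chi (T0 <= x <= T))); by meas.
have kv0 : 0 <= kk * v T by rewrite !mulr_ge0 ?c_ge0 ?v_ge0.
have -> : \int[mu]_x (chi (T0 <= x <= T) * (chi (x <= T) * dd x)) = \int[mu]_x F x.
  apply: int_ae; [by meas|exact: mF|].
  apply: (@filterS3 _ _ (ae_filter_ringOfSetsType mu) _ _ _ _ _ DM (ae_neq 0) (ae_neq T)) => x Hx x0 xT.
  rewrite /F; apply/esym/min_idPl.
  have [/andP[Tx xT']|_] := boolP (T0 <= x <= T); last by rewrite mul0r mulr0.
  rewrite mul1r xT' mul1r mulr1; apply: Hx; apply/andP; split.
    by rewrite lt_neqAle eq_sym x0 (le_trans T00 Tx).
  by rewrite lt_neqAle xT.
apply: int_le.
- apply: (rintegrable_le (g := fun x : RR => chi (T0 <= x <= T) * (chi (x <= T) * dd x))).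
  + exact: mF.
  + by apply: rintegrable_chi; [exact: v_integrand|meas].
  + move=> x; have d0 := dd_ge0 x; rewrite /F ger0_norm; first by rewrite ge_min lexx.
    by rewrite le_min (mulr_ge0 kv0)// andbT !mulr_ge0.
- exact: rintegrableZ.
- by move=> x; rewrite /F ge_min lexx orbT.
Qed.

(** Continuation in steps of length [del]: as kk del <= 1 / 2, [v_growth] reads v <= v / 2 on each
    new step. The summand 1 in [del] avoids a division by zero when kk = 0. *)
Lemma v_eq0 T : 0 <= T -> T < L -> v T = 0.
Proof.
pose del := (2 * (kk + 1))^-1.
have kk0 : 0 <= kk by rewrite !mulr_ge0// c_ge0.
have k1 : 0 < 2 * (kk + 1) by rewrite mulr_gt0// ltr_wpDl.
have del0 : 0 < del by rewrite invr_gt0.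
have kdel : kk * del <= 2^-1.
  by rewrite /del ler_pdivrMr//; lra.
have v0 : v 0 = 0.
  rewrite /v -[RHS](@int0 _ _ _ mu); apply: int_ae; [by meas|exact: measurable_cst|].
  apply: (@filterS _ _ (ae_filter_ringOfSetsType mu)) (ae_neq 0) => x x0.
  case: (leP x 0) => xl; rewrite ?mul0r// dd_supp ?mulr0//.
  by rewrite negb_and -ltNge lt_neqAle x0 xl.
have step m : forall T, 0 <= T -> T < L -> T <= m%:R * del -> v T = 0.
  elim: m => [|m IH] T' T0 TL Tm.
    by rewrite (_ : T' = 0)//; apply/le_anti; rewrite T0 andbT; move: Tm; rewrite mul0r.
  have [Td|dT] := leP T' del.
    have := v_growth (lexx 0) T0 TL v0; rewrite subr0 => H.
    apply/le_anti; rewrite v_ge0 andbT.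
    have : kk * v T' * T' <= 2^-1 * v T'.
      rewrite mulrAC; apply: ler_wpM2r; first exact: v_ge0.
      by apply: le_trans kdel; exact: ler_wpM2l.
    by have := v_ge0 T'; lra.
  have Tm' : T' - del <= m%:R * del by move: Tm; rewrite -natr1 mulrDl mul1r; lra.
  have T1 : 0 <= T' - del by rewrite subr_ge0 ltW.
  have T2 : T' - del <= T' by rewrite gerBl ltW.
  have := v_growth T1 T2 TL (IH _ T1 (le_lt_trans T2 TL) Tm').
  rewrite (_ : T' - (T' - del) = del); last by ring.
  move=> H; apply/le_anti; rewrite v_ge0 andbT.
  have : kk * v T' * del <= 2^-1 * v T'.
    by rewrite mulrAC; apply: ler_wpM2r => //; exact: v_ge0.
  by have := v_ge0 T'; lra.
move=> T0 TL; have [m Hm] : exists m : nat, T <= m%:R * del.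
  exists (Num.truncn (T / del)).+1; rewrite -ler_pdivrMr//.
  exact/ltW/truncnS_gt.
exact: step Hm.
Qed.

(** The equation is available only for t < L, so [0, L) is exhausted by countably many points T n,
    and the end point L is a null set. *)
Lemma volterra_unique : {ae mu, forall x, forall i j, D i j x = 0}.
Proof.
pose T n := L * (1 - n.+1%:R^-1).
have T0 n : 0 <= T n < L.
  rewrite /T mulr_ge0 ?(ltW L0)//=; last by rewrite subr_ge0 invf_le1// ler1n.
  by rewrite gtr_pMr// gtrBl invr_gt0.
have H n : {ae mu, forall x, chi (x <= T n) * dd x = 0}.
  have /andP[a b] := T0 n.
  apply: int_eq0_ae; first exact: v_integrand.
  rewrite -[RHS](v_eq0 a b) /v; apply: int_ext => x.
  by rewrite ger0_norm// mulr_ge0// dd_ge0.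
have : {ae mu, forall x, forall n, chi (x <= T n) * dd x = 0} by exact: ae_foralln.
move=> HT; apply: (@filterS2 _ _ (ae_filter_ringOfSetsType mu) _ _ _ _ HT (ae_neq L)) => x Hx xL.
suff d0 : dd x = 0.
  move=> i j; apply/normr0_eq0/le_anti; rewrite normr_ge0 andbT -d0.
  rewrite /dd (bigD1 i)//= (bigD1 j)//= -addrA lerDl addr_ge0//; first exact: sumr_ge0.
  by apply: sumr_ge0 => i' _; apply: sumr_ge0.
have [/andP[x0 xl]|/dd_supp//] := boolP (0 <= x <= L).
have {}xl : x < L by rewrite lt_neqAle xL xl.
pose m := Num.truncn (L / (L - x)).
have Lx : 0 < L - x by rewrite subr_gt0.
have : x <= T m.
  rewrite /T mulrBr mulr1 lerBrDr -lerBrDl.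
  rewrite ler_pdivrMr// -ler_pdivrMl// mulrC; exact/ltW/truncnS_gt.
by move=> xm; have := Hx m; rewrite xm mul1r.
Qed.


End Volterra.

(** * Matrices near the identity, Wronskians and boundary terms at 0 *)

Section NearIdentity.
Context {R : realType} {k : nat}.
Implicit Types A B : 'M[R]_k.

(** A left kernel matrix K of A satisfies K = - K (A - 1), so its norm is at most half of itself.
    [near1_inv] absorbs in the same way, from A^{-1} = 1 - (A - 1) A^{-1}. *)
Lemma near1_unit A : mnorm (A - 1%:M) <= 2^-1 -> A \in unitmx.
Proof.
move=> A1; rewrite -row_free_unit -kermx_eq0; apply/eqP/mnorm_eq0.
have E : kermx A = kermx A *m (- (A - 1%:M)).
  by rewrite mulmxN mulmxBr mulmx_ker mulmx1 sub0r opprK.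
have : mnorm (kermx A) <= mnorm (kermx A) * 2^-1.
  rewrite {1}E; apply: le_trans (mnormM _ _) _.
  by rewrite mnormN; apply: ler_wpM2l => //; exact: mnorm_ge0.
by have := mnorm_ge0 (kermx A); lra.
Qed.

Lemma near1_inv A : mnorm (A - 1%:M) <= 2^-1 ->
  mnorm (invmx A) <= 2 * mnorm (1%:M : 'M[R]_k).
Proof.
move=> A1; have uA := near1_unit A1.
have E : invmx A = 1%:M - (A - 1%:M) *m invmx A.
  by rewrite mulmxBl mulmxV// mul1mx opprB addrC subrK.
have : mnorm (invmx A) <= mnorm (1%:M : 'M[R]_k) + 2^-1 * mnorm (invmx A).
  rewrite {1}E; apply: le_trans (mnormB _ _) _; rewrite lerD2l.
  apply: le_trans (mnormM _ _) _.
  by apply: ler_wpM2r => //; exact: mnorm_ge0.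
by have := mnorm_ge0 (invmx A); lra.
Qed.

End NearIdentity.

Section Wronskian.
Context {R : realType} {k : nat}.
Local Notation mu := (@lebesgue_measure R).
Implicit Types (Q u p v q : R -> 'M[R]_k).

(* (v^T, q^T) solves the row equation with potential Q'. *)
Lemma wronskian L n Q Q' u p v q : sol L n Q u p ->
  sol L n (fun x => (Q' x)^T) v q ->
  acm L (fun x => (v x)^T *m p x - (q x)^T *m u x)
    (fun x => expR (- n * x) *: ((v x)^T *m (Q x - Q' x) *m u x)).
Proof.
move=> [uu pp] [vv qq].
have := acm_D (acm_M (acm_tr vv) pp) (acm_N (acm_M (acm_tr qq) uu)).
apply: acm_ext => // t _.
have trZ (c : R) (M : 'M[R]_k) : (c *: M)^T = c *: M^T.
  by apply/matrixP => i j; rewrite !mxE.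
rewrite !trZ trmx_mul trmxK.
rewrite -!scalemxAl -!scalemxAr mulmxBr mulmxBl !mulmxA.
rewrite scalerBr opprD [- _ - _]addrC addrACA subrr add0r//.
Qed.

Lemma wronskian_cst L n Q u p v q : 0 <= L -> sol L n Q u p ->
  sol L n (fun x => (Q x)^T) v q ->
  (v 0)^T *m p 0 - (q 0)^T *m u 0 = (v L)^T *m p L - (q L)^T *m u L.
Proof.
move=> L0 uu vv; have W := wronskian uu vv.
apply/matrixP => i j; have := (W i j).2 0 L (lexx 0) L0 (lexx L).
under eq_Rintegral do rewrite subrr mulmx0 mul0mx scaler0 mxE mulr0.
by rewrite int0 => /eqP; rewrite subr_eq0 => /eqP <-.
Qed.

(** For a merely integrable h there is no rate. The limit suffices to identify the boundary matrices
    and to make the Weyl denominator invertible. *)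
Lemma int_exp_cvg0 (h : R -> R) : rintegrable mu h -> (forall t, t < 0 -> h t = 0) ->
  \int[mu]_t (expR (- n%:R * t) * h t) @[n --> \oo] --> (0 : R).
Proof.
move=> sh h0; have mh := rintegrable_meas sh.
rewrite -(@int0 _ _ _ mu); apply: (int_dom_cvg (g := fun t : measurableTypeR R => `|h t|)).
- by move=> n; meas.
- exact: measurable_cst.
- exact: rintegrable_norm.
- apply: (@filterS _ _ (ae_filter_ringOfSetsType mu)) (ae_neq 0) => t t0.
  case: (ltgtP t 0) t0 => // t0 _.
    by rewrite h0//; under eq_fun do rewrite mulr0; exact: cvg_cst.
  rewrite -[X in _ --> X](mul0r (h t)); apply: cvgM; last exact: cvg_cst.
  have := @cvg_expRn R (- t); rewrite oppr_lt0 => /(_ t0).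
  by under eq_fun do rewrite mulrN -mulNr.
- move=> n t; case: (ltP t 0) => t0; first by rewrite h0// mulr0 normr0.
  rewrite normrM ler_piMl// ger0_norm ?expR_ge0// -expR0 ler_expR mulNr oppr_le0.
  by rewrite mulr_ge0.
Qed.

End Wronskian.

Section WeylDifference.
Context {R : realType} {k : nat}.
(* Values at 0: a, b, c = phi_1^T, phi_2, phi_2^T with derivatives a', b', c';
   g_i with derivative p_i. *)
Lemma weyl_difference (a a' b b' c c' g1 p1 g2 p2 rho : 'M[R]_k) (e : R) :
  g1 \in unitmx -> g2 \in unitmx -> c \in unitmx ->
  a *m p1 - a' *m g1 = e *: rho -> c *m p2 - c' *m g2 = e *: rho ->
  c *m b' = c' *m b ->
  a *m b' - a' *m b = a *m (p2 *m invmx g2 - p1 *m invmx g1) *m b +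
    e *: (rho *m invmx g1 *m b - a *m invmx c *m rho *m invmx g2 *m b).
Proof.
move=> u1 u2 uc H1 H2 H3.
have Ea : a' = a *m p1 *m invmx g1 - e *: rho *m invmx g1.
  by rewrite -H1 mulmxBl mulmxK// opprB addrC subrK.
have Ec : c' = c *m p2 *m invmx g2 - e *: rho *m invmx g2.
  by rewrite -H2 mulmxBl mulmxK// opprB addrC subrK.
(* The Wronskian with g_2 controls the row solution c, not the column solution b. The relation c b'
   = c' b, a Wronskian for one and the same potential, transfers the logarithmic derivative of g_2
   from c to b. *)
have Eb : b' = p2 *m invmx g2 *m b - e *: (invmx c *m rho *m invmx g2 *m b).
  rewrite -[LHS](mulKmx uc) H3 Ec mulmxBl mulmxBr -!scalemxAl -!scalemxAr.
  by rewrite !mulmxA mulVmx// mul1mx.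
rewrite Ea Eb.
have -> : a *m (p2 *m invmx g2 *m b - e *: (invmx c *m rho *m invmx g2 *m b)) =
    a *m p2 *m invmx g2 *m b - e *: (a *m invmx c *m rho *m invmx g2 *m b).
  by rewrite mulmxBr -scalemxAr !mulmxA.
have -> : (a *m p1 *m invmx g1 - e *: rho *m invmx g1) *m b =
    a *m p1 *m invmx g1 *m b - e *: (rho *m invmx g1 *m b).
  by rewrite mulmxBl -!scalemxAl.
rewrite mulmxBr mulmxBl !mulmxA scalerBr opprB addrACA [RHS]addrACA.
by congr (_ + _); exact: addrC.
Qed.

End WeylDifference.

(** * The Wronskian integral as a Laplace transform *)

Section ProductExpansion.
Context {R : realType} {k : nat}.
Local Notation mu := (@lebesgue_measure R).
Local Notation RR := (measurableTypeR R).
Local Notation mu2 := (@plane_measure R).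

Lemma int_prod_fun (f g : RR -> R) : rintegrable mu f -> rintegrable mu g ->
  \int[mu2]_w (f w.1 * g w.2) = (\int[mu]_x f x) * \int[mu]_y g y.
Proof.
move=> sf sg; have mf := rintegrable_meas sf. have mg := rintegrable_meas sg.
pose F (w : RR * RR) : R := f w.1 * g w.2.
have mF : measurable_fun setT F by rewrite /F; meas.
have FB x y : `|F (x, y)| <= `|f x| * `|g y| by rewrite /F /= normrM.
rewrite -(int_bprod1 mF (rintegrable_norm sf) (rintegrable_norm sg) FB) /F /=.
rewrite mulrC -intZ//; apply: int_ext => x.
by rewrite intZ// mulrC.
Qed.

Variables (L : R) (Q1 Q2 : R -> 'M[R]_k).
Hypotheses (L0 : 0 < L) (i1 : intm L Q1) (i2 : intm L Q2).

Let Q1T x := (Q1 x)^T.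
Let i1T : intm L Q1T := intm_tr i1.

Definition vD (i j : 'I_k) (t : RR) : R := chi (0 <= t <= L) * (Q2 t - Q1 t) i j.
(** The left factor is the transpose of the phi built from the transposed potential, hence the
    exchanged indices. *)
Definition vA (al i : 'I_k) (z : RR * RR) : R := kern L Q1T i al z.
Definition vB (j be : 'I_k) (z : RR * RR) : R := kern L Q2 j be z.
Definition vC : R := Num.max (kbound L Q1T) (kbound L Q2).

Lemma vC_ge0 : 0 <= vC.
Proof. by rewrite le_max (kbound_ge0 L Q1T). Qed.

Lemma rintegrable_vD i j : rintegrable mu (vD i j).
Proof. by have := intm_D i2 (intm_N i1); apply. Qed.

Lemma vD_supp i j x : ~~ (0 <= x <= L) -> vD i j x = 0.
Proof. by move=> /negbTE; rewrite /vD => ->; rewrite mul0r. Qed.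

Lemma measurable_vA i j : measurable_fun setT (vA i j).
Proof. exact: measurable_kern i1T j i. Qed.

Lemma measurable_vB i j : measurable_fun setT (vB i j).
Proof. exact: measurable_kern i2 i j. Qed.

Lemma vA_le i j z : `|vA i j z| <= vC * chi (0 <= z.2 <= L).
Proof.
apply: le_trans (kern_le i1T j i z) _; apply: ler_wpM2r => //.
by rewrite le_max lexx.
Qed.

Lemma vB_le i j z : `|vB i j z| <= vC * chi (0 <= z.2 <= L).
Proof.
apply: le_trans (kern_le i2 i j z) _; apply: ler_wpM2r => //.
by rewrite le_max lexx orbT.
Qed.

(** Each term is a Laplace transform in the total exponent x, x + s or x + s + s', with a density
    free of m: the shape required by [mik_int]. *)
Definition vJ al be (m : nat) : R :=
  \int[mu]_x (expR (- (m%:R * x)) * vD al be x) +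
  (\int[mu2]_z (expR (- (m%:R * (z.1 + z.2))) * vol2 vD vA vB al be z) +
  \int[(mu \x mu2)%E]_z (expR (- (m%:R * (z.1 + z.2.1 + z.2.2))) * vol3 vD vA vB al be z)).

(** Expand (1 + a) D (1 + b), where a and b are the Laplace integrals of the kernels. D alone gives
    the first term of [vJ], a D + D b gives [vol2] and a D b gives [vol3]; Fubini merges the
    exponentials. *)
Lemma vJ_expand (m : nat) al be : (0 < m)%N ->
  \int[mu]_t (chi (0 <= t <= L) * (expR (- m%:R * t) *:
     ((kPhi L m%:R Q1T t)^T *m (Q2 t - Q1 t) *m kPhi L m%:R Q2 t)) al be) = vJ al be m.
Proof.
move=> m0; set n := m%:R; have n0 : 0 < n :> R by rewrite ltr0n.
pose ex (s : RR) : R := chi (0 <= s <= L) * expR (- n * s).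
have sex : rintegrable mu ex := rintegrable_expR (- n) L (lexx 0).
pose a i (t : RR) : R := \int[mu]_s (ex s * vA al i (t, s)).
pose b j (t : RR) : R := \int[mu]_s (ex s * vB j be (t, s)).
have D0 := vD_supp.
have sA i t : rintegrable mu (fun s => ex s * vA al i (t, s)).
  exact: (rintegrable_exK n i1T i al t).
have sB j t : rintegrable mu (fun s => ex s * vB j be (t, s)).
  exact: (rintegrable_exK n i2 j be t).
(* The cut-off in [ex] costs nothing, since the kernel vanishes outside 0 <= s <= L by its own
   bound. *)
have exA i t s : expR (- n * s) * vA al i (t, s) = ex s * vA al i (t, s).
  rewrite /ex; have [_|/negbTE sL] := boolP (0 <= s <= L); first by rewrite mul1r.
  have := vA_le al i (t, s); rewrite /= sL mulr0 normr_le0 => /eqP ->.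
  by rewrite !mulr0.
have exB j t s : expR (- n * s) * vB j be (t, s) = ex s * vB j be (t, s).
  rewrite /ex; have [_|/negbTE sL] := boolP (0 <= s <= L); first by rewrite mul1r.
  have := vB_le j be (t, s); rewrite /= sL mulr0 normr_le0 => /eqP ->.
  by rewrite !mulr0.
have C0 := vC_ge0.
have mD i j := rintegrable_meas (rintegrable_vD i j).
have expn (x : R) : expR (- (n * x)) = expR (- n * x) by rewrite mulNr.
pose S2 (t : RR) : R := expR (- n * t) * (\sum_i a i t * vD i be t + \sum_j vD al j t * b j t).
pose S3 (t : RR) : R := expR (- n * t) * (\sum_i \sum_j a i t * vD i j t * b j t).
have e1 x y : (0 : R) <= x -> `|expR (- n * x) * y| <= `|y|.
  move=> x0; rewrite normrM ler_piMl// ger0_norm ?expR_ge0// -expR0 ler_expR mulNr oppr_le0.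
  by rewrite mulr_ge0// ltW.
have sdd' : rintegrable mu (fun x => \sum_i \sum_j `|vD i j x|) := sdd rintegrable_vD.
have sC : rintegrable mu (fun s => 2 * vC * chi (0 <= s <= L)).
  by apply: rintegrableZ; exact: (int_chi (ltW L0)).1.
have S2E : \int[mu2]_z (expR (- (n * (z.1 + z.2))) * vol2 vD vA vB al be z) = \int[mu]_t S2 t /\
    rintegrable mu S2.
  pose F (z : RR * RR) : R := expR (- (n * (z.1 + z.2))) * vol2 vD vA vB al be z.
  have mF : measurable_fun setT F.
    by have m2 := measurable_vol2 rintegrable_vD measurable_vA measurable_vB al be; rewrite /F; meas.
  have FB t s : `|F (t, s)| <= (\sum_i \sum_j `|vD i j t|) * (2 * vC * chi (0 <= s <= L)).
    apply: le_trans (vol2_le vD C0 vA_le vB_le al be t s).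
    rewrite /F /=; have [->|ne] := eqVneq (vol2 vD vA vB al be (t, s)) 0.
      by rewrite mulr0.
    rewrite expn; apply: e1.
    exact: (vol2_supp C0 vD_supp vA_le vB_le ne).
  have E t : \int[mu]_s F (t, s) = S2 t.
    have s1 i : rintegrable mu (fun s => vD i be t * (ex s * vA al i (t, s))) by exact: rintegrableZ.
    have s2 j : rintegrable mu (fun s => vD al j t * (ex s * vB j be (t, s))) by exact: rintegrableZ.
    transitivity (\int[mu]_s (expR (- n * t) * (\sum_i vD i be t * (ex s * vA al i (t, s)) +
        \sum_j vD al j t * (ex s * vB j be (t, s))))).
      apply: int_ext => s; rewrite /F /vol2 /= (_ : expR _ = expR (- n * t) * expR (- n * s)) -?mulrA; last by
        rewrite -expRD; congr expR; ring.
      congr (_ * _).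
      rewrite mulrDr !mulr_sumr; congr (_ + _); apply: eq_bigr => i _.
        by rewrite mulrA exA mulrC.
      by rewrite mulrCA exB.
    rewrite intZ; last by apply: rintegrableD; apply: rintegrable_sum.
    rewrite intD; [|exact: rintegrable_sum|exact: rintegrable_sum].
    rewrite !int_sum// /S2; congr (_ * (_ + _)); apply: eq_bigr => i _.
      by rewrite intZ// mulrC.
    by rewrite intZ.
  split; first by rewrite -(int_bprod1 mF sdd' sC FB); apply: int_ext.
  by apply: rintegrable_eq (rintegrable_bint1 mF sdd' sC FB).
have sC3 : rintegrable mu2 (fun w => vC * chi (0 <= w.1 <= L) * (vC * chi (0 <= w.2 <= L))).
  have sw : rintegrable mu (fun s => vC * chi (0 <= s <= L)).
    by apply: rintegrableZ; exact: (int_chi (ltW L0)).1.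
  apply: (rintegrable_prod (a := fun s : RR => vC * chi (0 <= s <= L)) (b := fun s : RR => vC * chi (0 <= s <= L))) => //.
    by meas.
  by move=> s s' /=; rewrite ger0_norm// !mulr_ge0.
have S3E : \int[(mu \x mu2)%E]_z (expR (- (n * (z.1 + z.2.1 + z.2.2))) * vol3 vD vA vB al be z) =
    \int[mu]_t S3 t /\ rintegrable mu S3.
  pose F (z : RR * (RR * RR)) : R := expR (- (n * (z.1 + z.2.1 + z.2.2))) * vol3 vD vA vB al be z.
  have mF : measurable_fun setT F.
    by have m3 := measurable_vol3 rintegrable_vD measurable_vA measurable_vB al be; rewrite /F; meas.
  have FB t w : `|F (t, w)| <= (\sum_i \sum_j `|vD i j t|) *
      (vC * chi (0 <= w.1 <= L) * (vC * chi (0 <= w.2 <= L))).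
    apply: le_trans (vol3_le vD vA_le vB_le al be t w).
    rewrite /F /=; have [->|ne] := eqVneq (vol3 vD vA vB al be (t, w)) 0.
      by rewrite mulr0.
    rewrite expn; apply: e1.
    exact: (vol3_supp vD_supp vA_le vB_le ne).
  have E t : \int[mu2]_w F (t, w) = S3 t.
    have sAB i j : rintegrable mu2 (fun w => (ex w.1 * vA al i (t, w.1)) * (ex w.2 * vB j be (t, w.2))).
      have ma := rintegrable_meas (sA i t). have mb := rintegrable_meas (sB j t).
      apply: (rintegrable_prod (a := fun s => `|ex s * vA al i (t, s)|)
        (b := fun s => `|ex s * vB j be (t, s)|)).
      - apply: measurable_funM; first exact: (measurableT_comp ma measurable_fst).
        exact: (measurableT_comp mb measurable_snd).
      - exact: rintegrable_norm.
      - exact: rintegrable_norm.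
      - by move=> s s' /=; rewrite normrM.
    have sDAB i j : rintegrable mu2 (fun w => vD i j t *
      ((ex w.1 * vA al i (t, w.1)) * (ex w.2 * vB j be (t, w.2)))) by exact: rintegrableZ.
    transitivity (\int[mu2]_w (expR (- n * t) * (\sum_i \sum_j vD i j t *
      ((ex w.1 * vA al i (t, w.1)) * (ex w.2 * vB j be (t, w.2)))))).
      apply: int_ext => w; rewrite /F /vol3 /=.
      rewrite !mulr_sumr; apply: eq_bigr => i _; rewrite !mulr_sumr; apply: eq_bigr => j _.
      rewrite -exA -exB.
      have -> : expR (- (n * (t + w.1 + w.2))) = expR (- n * t) * expR (- n * w.1) * expR (- n * w.2).
        by rewrite -!expRD; congr expR; ring.
      by ring.
    rewrite intZ; last by apply: rintegrable_sum => i; apply: rintegrable_sum => j.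
    rewrite int_sum; last by move=> i; apply: rintegrable_sum => j.
    rewrite /S3; congr (_ * _); apply: eq_bigr => i _.
    rewrite int_sum//; apply: eq_bigr => j _; rewrite intZ//.
    rewrite (int_prod_fun (sA i t) (sB j t)).
    by rewrite -/(a i t) -/(b j t); ring.
  split; first by rewrite -(int_bprod1 mF sdd' sC3 FB); apply: int_ext.
  by apply: rintegrable_eq (rintegrable_bint1 mF sdd' sC3 FB).
rewrite /vJ -/n S2E.1 S3E.1.
have s1 : rintegrable mu (fun x => expR (- (n * x)) * vD al be x).
  apply: (rintegrable_le _ (rintegrable_norm (rintegrable_vD al be))).
    by have md := mD al be; meas.
  move=> x; have [/andP[x0 _]|xL] := boolP (0 <= x <= L); first by rewrite expn e1.
  by rewrite vD_supp// mulr0.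
rewrite -intD; [|exact: S2E.2|exact: S3E.2].
rewrite -intD//; last by apply: rintegrableD; [exact: S2E.2|exact: S3E.2].
apply: int_ext => t; rewrite /S2 /S3 expn.
have [tL|tL] := boolP (0 <= t <= L); last first.
  have Z i j : vD i j t = 0 by exact: vD_supp.
  have -> : \sum_i a i t * vD i be t = 0 by rewrite big1// => i _; rewrite Z mulr0.
  have -> : \sum_j vD al j t * b j t = 0 by rewrite big1// => j _; rewrite Z mul0r.
  have -> : \sum_i \sum_j a i t * vD i j t * b j t = 0.
    by rewrite big1// => i _; rewrite big1// => j _; rewrite Z mulr0 mul0r.
  by rewrite Z mul0r addr0 !mulr0 !addr0.
rewrite mul1r mxE -!mulrDr; congr (_ * _).
have DE i j : (Q2 t - Q1 t) i j = vD i j t by rewrite /vD tL mul1r.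
have phiA i : (kPhi L n Q1T t)^T al i = (i == al)%:R + a i t by rewrite !mxE.
have phiB j : kPhi L n Q2 t j be = (j == be)%:R + b j t by rewrite mxE.
transitivity (\sum_j (vD al j t + \sum_i a i t * vD i j t) * ((j == be)%:R + b j t)).
  rewrite mxE; apply: eq_bigr => j _; rewrite phiB; congr (_ * _).
  rewrite mxE (eq_bigr (fun i => (i == al)%:R * vD i j t + a i t * vD i j t)); last first.
    by move=> i _; rewrite phiA DE mulrDl.
  rewrite big_split /=; congr (_ + _).
  rewrite (bigD1 al)//= eqxx mul1r big1 ?addr0// => i /negbTE ->.
  by rewrite mul0r.
have -> : \sum_i \sum_j a i t * vD i j t * b j t = \sum_j (\sum_i a i t * vD i j t) * b j t.
  by rewrite exchange_big; apply: eq_bigr => j _; rewrite mulr_suml.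
under eq_bigr do rewrite mulrDr !mulrDl.
rewrite !big_split /= -!addrA.
have S (f : 'I_k -> R) : \sum_j f j * (j == be)%:R = f be.
  by rewrite (bigD1 be)//= eqxx mulr1 big1 ?addr0// => j /negbTE ->; rewrite mulr0.
by rewrite !S.
Qed.

End ProductExpansion.

(** * Equality of the boundary matrices, then of the potentials *)

Section Core.
Context {R : realType} {k : nat}.
Local Notation mu := (@lebesgue_measure R).
Local Notation RR := (measurableTypeR R).
Let V : R := mnorm (1%:M : 'M[R]_k).

Lemma mnormM_le (A B : 'M[R]_k) a b : mnorm A <= a -> mnorm B <= b -> mnorm (A *m B) <= a * b.
Proof. by move=> h h'; apply: le_trans (mnormM _ _) _; apply: ler_pM => //; exact: mnorm_ge0. Qed.

Definition qint L (Q : R -> 'M[R]_k) : R := \int[mu]_t (chi (0 <= t <= L) * mnorm (Q t)).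

Lemma qint_ge0 L Q : 0 <= qint L Q.
Proof. by apply: Rintegral_ge0 => t _; rewrite mulr_ge0// mnorm_ge0. Qed.

Lemma qint_tr L Q : qint L (fun x => (Q x)^T) = qint L Q.
Proof. by apply: int_ext => t; rewrite mnorm_tr. Qed.

Lemma kPhi_bounds L n (Q : R -> 'M[R]_k) x : 0 <= L -> 0 < n -> intm L Q ->
  4 * qint L Q <= n -> 0 <= x <= L ->
  mnorm (kPhi L n Q x) <= 2 * V /\
  mnorm (kPhi L n Q x - 1%:M) <= n^-1 * (4 * qint L Q * V).
Proof.
move=> L0 n0 iQ qn xL; have S := kPhi_sol n0 iQ.
have [E1 E2] := kPhi_end L0 n0 iQ.
have := sol_bound L0 n0 iQ S qn xL; have := sol_near L0 n0 iQ S qn xL.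
rewrite E1 E2 scaler0 mnorm0 !mulr0 !addr0 add0r -/V -/(qint L Q) => H1 H2; split=> //.
by rewrite (_ : 4 * qint L Q * V = 2 * (qint L Q * (2 * V)))//; ring.
Qed.

Lemma sol_rho_bounds L n (Q g p : R -> 'M[R]_k) (Cr : R) : 0 <= L -> 1 <= n ->
  intm L Q -> 4 * qint L Q <= n -> sol L n Q g p -> g L = 1%:M ->
  mnorm (expR (n * L) *: p L) <= Cr ->
  mnorm (g 0 - 1%:M) <= n^-1 * (2 * Cr + 2 * (qint L Q * (2 * V + 4 * Cr))).
Proof.
move=> L0 n1 iQ qn S gL pL.
have n0 : 0 < n by apply: lt_le_trans n1.
have zL : 0 <= (0 : R) <= L by rewrite lexx.
have := sol_near L0 n0 iQ S qn zL; rewrite gL -/V -/(qint L Q) => H.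
apply: le_trans H _; apply: ler_wpM2l; first by rewrite invr_ge0 ltW.
have q0 := qint_ge0 L Q.
apply: lerD; first by rewrite ler_wpM2l.
rewrite ler_wpM2l// ler_wpM2l// lerD2l -mulrA ler_wpM2l//.
apply: le_trans pL; rewrite ler_piMl ?mnorm_ge0// invf_le1//.
Qed.

Variables (L : R) (Q1 Q2 : R -> 'M[R]_k) (TD : 'M[R]_k) (N0 : nat) (Cr : R).
Hypotheses (L0 : 0 < L) (i1 : intm L Q1) (i2 : intm L Q2).
(** All that the Weyl matrices provide. The value [rho] at L is common to both problems because it
    comes from the background, its bound does not depend on n, and [TD] stands for Theta_2 -
    Theta_1, constant in n. *)
Hypothesis data : forall n, (N0 <= n)%N -> exists g1 p1 g2 p2 rho,
  [/\ sol L n%:R Q1 g1 p1, sol L n%:R Q2 g2 p2, g1 L = 1%:M & g2 L = 1%:M] /\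
  [/\ expR (n%:R * L) *: p1 L = rho, expR (n%:R * L) *: p2 L = rho, mnorm rho <= Cr &
    p1 0 *m invmx (g1 0) - p2 0 *m invmx (g2 0) = TD].

Let Q1T x := (Q1 x)^T.
Let Q2T x := (Q2 x)^T.
Let qq := qint L Q1 + qint L Q2.
(** With the factor n^{-1} this bounds the distance to 1 of g_1(0) and g_2(0), through
    [sol_rho_bounds], and of the phi matrices at 0, through [Kq]. *)
Let K := 2 * Cr + 2 * (qq * (2 * V + 4 * Cr)).

Let a n := (kPhi L n%:R Q1T 0)^T.
Let b n := kPhi L n%:R Q2 0.
Let X n := (kPhi L n%:R Q1T 0)^T *m kP L n%:R Q2 0 - (kP L n%:R Q1T 0)^T *m kPhi L n%:R Q2 0.

Let V0 : 0 <= V := mnorm_ge0 _.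
Let q10 : 0 <= qint L Q1 := qint_ge0 L Q1.
Let q20 : 0 <= qint L Q2 := qint_ge0 L Q2.

Let Cr0 : 0 <= Cr.
Proof.
have [g1 [p1 [g2 [p2 [rho [_ [_ _ h _]]]]]]] := data (leqnn N0).
exact: le_trans (mnorm_ge0 _) h.
Qed.

(** The two summands bound the two error terms of [weyl_difference], with 2 V for each phi and each
    inverse, and [Cr] for rho. *)
Let Y0 : R := Cr * (2 * V) * (2 * V) + 2 * V * (2 * V) * Cr * (2 * V) * (2 * V).

Let large n := [/\ (N0 <= n)%N, (1 <= n)%N, 4 * qq <= n%:R & 2 * K <= n%:R].

Lemma large_near : exists N1, forall n, (N1 <= n)%N -> large n.
Proof.
exists (maxn N0 (maxn 1 (maxn (Num.truncn (4 * qq)).+1 (Num.truncn (2 * K)).+1))) => n.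
rewrite !geq_max => /andP[h1 /andP[h2 /andP[h3 h4]]]; split=> //.
- by apply: le_trans (ltW (truncnS_gt _)) _; rewrite ler_nat.
- by apply: le_trans (ltW (truncnS_gt _)) _; rewrite ler_nat.
Qed.

Lemma Kq (Q : R -> 'M[R]_k) : 0 <= qint L Q -> qint L Q <= qq -> 4 * qint L Q * V <= K.
Proof.
move=> q0 qle; rewrite /K.
have h1 : qint L Q * V <= qq * V by rewrite ler_wpM2r.
have h2 : 0 <= qq * Cr by rewrite mulr_ge0// addr_ge0.
by have := Cr0; nra.
Qed.

Lemma large_half n x : large n -> x <= n%:R^-1 * K -> x <= 2^-1.
Proof.
move=> [_ n1 _ Kn] /le_trans; apply.
by rewrite ler_pdivrMl ?ltr0n//; lra.
Qed.

(** Since the phi matrices equal 1 and have zero derivative at L, their Wronskians with g_1 and g_2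
    equal e^{-n L} rho, at 0 as at L. [weyl_difference] then expresses the boundary term by the
    logarithmic derivatives of the g_i, whose difference is [TD]. *)
Lemma X_eq n : large n -> exists Y, mnorm Y <= Y0 /\
  X n = - (a n *m TD *m b n) + expR (- n%:R * L) *: Y.
Proof.
move=> ln; have [N0n n1 qn Kn] := ln.
have [g1 [p1 [g2 [p2 [rho [[S1 S2 g1L g2L] [r1 r2 rC HTD]]]]]]] := data N0n.
have n0 : 0 < n%:R :> R by rewrite ltr0n.
have L0' := ltW L0.
have n1' : 1 <= n%:R :> R by rewrite ler1n.
have qn1 : 4 * qint L Q1 <= n%:R by apply: le_trans qn; rewrite ler_wpM2l// lerDl.
have qn2 : 4 * qint L Q2 <= n%:R by apply: le_trans qn; rewrite ler_wpM2l// lerDr.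
have i1T : intm L Q1T := intm_tr i1.
have i2T : intm L Q2T := intm_tr i2.
have [A1 A2] := kPhi_end L0' n0 (intm_tr i1 : intm L Q1T).
have [B1 B2] := kPhi_end L0' n0 i2.
have [C1 C2] := kPhi_end L0' n0 (intm_tr i2 : intm L Q2T).
have zL : 0 <= (0 : R) <= L by rewrite lexx.
have pE p rho' : expR (n%:R * L) *: p = rho' -> p = expR (- n%:R * L) *: rho' :> 'M[R]_k.
  by move=> <-; rewrite scalerA -expRD mulNr addNr expR0 scale1r.
have W1 : (kPhi L n%:R Q1T 0)^T *m p1 0 - (kP L n%:R Q1T 0)^T *m g1 0 = expR (- n%:R * L) *: rho.
  rewrite (wronskian_cst L0' S1 (kPhi_sol n0 i1T)) A1 A2 trmx0 mul0mx subr0 trmx1 mul1mx.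
  exact: pE.
have W2 : (kPhi L n%:R Q2T 0)^T *m p2 0 - (kP L n%:R Q2T 0)^T *m g2 0 = expR (- n%:R * L) *: rho.
  rewrite (wronskian_cst L0' S2 (kPhi_sol n0 i2T)) C1 C2 trmx0 mul0mx subr0 trmx1 mul1mx.
  exact: pE.
have W3 : (kPhi L n%:R Q2T 0)^T *m kP L n%:R Q2 0 = (kP L n%:R Q2T 0)^T *m kPhi L n%:R Q2 0.
  apply/eqP; rewrite -subr_eq0; apply/eqP.
  by rewrite (wronskian_cst L0' (kPhi_sol n0 i2) (kPhi_sol n0 i2T)) B2 C2 trmx0 mul0mx mulmx0 subrr.
have qle1 : qint L Q1 <= qq by rewrite lerDl.
have qle2 : qint L Q2 <= qq by rewrite lerDr.
have gK Q (q0 : 0 <= qint L Q) : qint L Q <= qq ->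
   n%:R^-1 * (2 * Cr + 2 * (qint L Q * (2 * V + 4 * Cr))) <= n%:R^-1 * K.
  move=> qle; apply: ler_wpM2l; first by rewrite invr_ge0.
  rewrite /K lerD2l ler_wpM2l//; apply: ler_wpM2r => //.
  by rewrite addr_ge0// mulr_ge0// Cr0.
have hg1 : mnorm (g1 0 - 1%:M) <= 2^-1.
  apply: (large_half ln); apply: le_trans (gK Q1 q10 qle1).
  by apply: sol_rho_bounds L0' n1' i1 qn1 S1 g1L _; rewrite r1.
have hg2 : mnorm (g2 0 - 1%:M) <= 2^-1.
  apply: (large_half ln); apply: le_trans (gK Q2 q20 qle2).
  by apply: sol_rho_bounds L0' n1' i2 qn2 S2 g2L _; rewrite r2.
have qn1T : 4 * qint L Q1T <= n%:R by rewrite qint_tr.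
have qn2T : 4 * qint L Q2T <= n%:R by rewrite qint_tr.
have [ha _] := kPhi_bounds L0' n0 i1T qn1T zL.
have [hb _] := kPhi_bounds L0' n0 i2 qn2 zL.
have [_ hc] := kPhi_bounds L0' n0 i2T qn2T zL.
have hcT : mnorm ((kPhi L n%:R Q2T 0)^T - 1%:M) <= 2^-1.
  rewrite -trmx1 -linearB mnorm_tr; apply: (large_half ln); apply: le_trans hc _.
  by apply: ler_wpM2l; [rewrite invr_ge0|rewrite qint_tr Kq].
have := weyl_difference (near1_unit hg1) (near1_unit hg2) (near1_unit hcT) W1 W2 W3.
rewrite -[p2 0 *m _ - _]opprB HTD mulmxN mulNmx -/(X n) => ->.
eexists; split; last by [].
have ig1 := near1_inv hg1; have ig2 := near1_inv hg2; have ic := near1_inv hcT.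
have ha' : mnorm (kPhi L n%:R Q1T 0)^T <= 2 * V by rewrite mnorm_tr.
apply: le_trans (mnormB _ _) _; apply: lerD; first by do 2 ?apply: mnormM_le.
by do 4 ?apply: mnormM_le.
Qed.

(** The Wronskian vanishes at L because both phi have zero derivative there, so its value [X n] at 0
    is minus the integral over [0, L]. *)
Lemma X_int n al be : large n -> X n al be = - vJ L Q1 Q2 al be n.
Proof.
move=> [_ n1 _ _]; have n0 : 0 < n%:R :> R by rewrite ltr0n.
have L0' := ltW L0.
have W := wronskian (Q' := Q1) (kPhi_sol n0 i2) (kPhi_sol n0 (intm_tr i1)).
have [A1 A2] := kPhi_end L0' n0 (intm_tr i1 : intm L Q1T).
have [B1 B2] := kPhi_end L0' n0 i2.
have := (W al be).2 0 L (lexx 0) L0' (lexx L).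
rewrite -/Q1T vJ_expand// => <-.
by rewrite A2 B2 trmx0 mul0mx mulmx0 subrr (_ : (0 : 'M[R]_k) al be = 0) ?sub0r ?opprK//; rewrite mxE.
Qed.

Let sDQ : rintegrable mu (fun t => chi (0 <= t <= L) * mnorm (Q2 t - Q1 t)).
Proof. exact: intm_mnorm (intm_D i2 (intm_N i1)). Qed.

(** A crude bound, without reference to [TD], that tends to 0 by dominated convergence; set against
    [X_eq] it forces [TD] to vanish. *)
Lemma X_small n : large n -> mnorm (X n) <= 2 * V * (2 * V) *
  \int[mu]_t (expR (- n%:R * t) * (chi (0 <= t <= L) * mnorm (Q2 t - Q1 t))).
Proof.
move=> [_ n1 qn _]; have n0 : 0 < n%:R :> R by rewrite ltr0n.
have L0' := ltW L0.
have i1T : intm L Q1T := intm_tr i1.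
have W := wronskian (Q' := Q1) (kPhi_sol n0 i2) (kPhi_sol n0 i1T).
have [A1 A2] := kPhi_end L0' n0 (intm_tr i1 : intm L Q1T).
have [B1 B2] := kPhi_end L0' n0 i2.
have := acm_norm W (lexx 0) L0' (lexx L).
rewrite A2 B2 trmx0 mul0mx mulmx0 subrr sub0r mnormN -/(X n) => H.
apply: le_trans H _.
have mDQ := rintegrable_meas sDQ.
have sE : rintegrable mu (fun t => expR (- n%:R * t) * (chi (0 <= t <= L) * mnorm (Q2 t - Q1 t))).
  apply: (rintegrable_le _ sDQ); first by meas.
  move=> t; have [/andP[t0 tL]|_] := boolP (0 <= t <= L); last by rewrite !mul0r mulr0 normr0.
  rewrite !mul1r normrM (ger0_norm (mnorm_ge0 _)) ler_piMl ?mnorm_ge0// ger0_norm ?expR_ge0//.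
  by rewrite -expR0 ler_expR mulNr oppr_le0 mulr_ge0.
rewrite -intZ//; apply: int_le.
- exact: intm_mnorm (acm_int W).
- exact: rintegrableZ.
- move=> t; have [tL|_] := boolP (0 <= t <= L); last by rewrite !mul0r !mulr0.
  rewrite !mul1r mnormZ ger0_norm ?expR_ge0// mulrCA; apply: ler_wpM2l; first exact: expR_ge0.
  have qn1T : 4 * qint L Q1T <= n%:R.
    by rewrite qint_tr; apply: le_trans qn; rewrite ler_wpM2l// lerDl.
  have qn2 : 4 * qint L Q2 <= n%:R by apply: le_trans qn; rewrite ler_wpM2l// lerDr.
  have [ha _] := kPhi_bounds L0' n0 i1T qn1T tL.
  have [hb _] := kPhi_bounds L0' n0 i2 qn2 tL.
  apply: le_trans (mnormM _ _) _.
  apply: le_trans (ler_pM (mnorm_ge0 _) (mnorm_ge0 _) (mnormM _ _) (lexx _)) _.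
  rewrite mnorm_tr [leRHS]mulrAC.
  have n1' := mnorm_ge0 (kPhi L n%:R Q1T t); have n2 := mnorm_ge0 (Q2 t - Q1 t).
  have n3 := mnorm_ge0 (kPhi L n%:R Q2 t).
  refine (ler_pM (mulr_ge0 n1' n2) n3 _ hb).
  exact: (ler_wpM2r n2 ha).
Qed.

Lemma cvg_expL : expR (- n%:R * L) @[n --> \oo] --> (0 : R).
Proof.
have := @cvg_expRn R (- L); rewrite oppr_lt0 => /(_ L0).
by under eq_fun do rewrite mulrN -mulNr.
Qed.

Lemma cvg_invn : n%:R^-1 @[n --> \oo] --> (0 : R).
Proof. by rewrite -cvg_shiftS; exact: cvg_harmonic. Qed.

(** Both phi matrices at 0 tend to 1 at rate K / n, so [TD] differs from a TD b by O(1 / n), while a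
    TD b = - X + O(e^{-n L}) tends to 0. The constant [TD] lies below every term of a null
    sequence. *)
Lemma TD_eq0 : TD = 0.
Proof.
have [N1 HN] := large_near.
pose I n := \int[mu]_t (expR (- n%:R * t) * (chi (0 <= t <= L) * mnorm (Q2 t - Q1 t))).
pose z n : R := 2 * V * (2 * V) * I n + expR (- n%:R * L) * Y0 +
  n%:R^-1 * (K * mnorm TD * (2 * V) + mnorm TD * K).
have z0 : z n @[n --> \oo] --> (0 : R).
  rewrite (_ : 0 = 2 * V * (2 * V) * 0 + 0 * Y0 +
    0 * (K * mnorm TD * (2 * V) + mnorm TD * K)); last by ring.
  apply: cvgD; first apply: cvgD.
  - apply: cvgM; first exact: cvg_cst.
    apply: int_exp_cvg0; first exact: sDQ.
    by move=> t t0; rewrite leNgt t0 /= mul0r.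
  - by apply: cvgM; [exact: cvg_expL|exact: cvg_cst].
  - by apply: cvgM; [exact: cvg_invn|exact: cvg_cst].
apply: mnorm_eq0; rewrite -(cvg_lim (@Rhausdorff R) z0).
apply: limr_ge; first by apply/cvg_ex; eexists; exact: z0.
exists N1 => // n /= /HN ln; have [_ n1 qn _] := ln.
have n0 : 0 < n%:R :> R by rewrite ltr0n.
have L0' := ltW L0.
have [Y [YY0 XE]] := X_eq ln.
have E : TD = a n *m TD *m b n - ((a n - 1%:M) *m TD *m b n + TD *m (b n - 1%:M)).
  rewrite mulmxBr mulmxBl mul1mx mulmx1 mulmxBl addrA subrK.
  by rewrite opprB addrC subrK.
have zL : 0 <= (0 : R) <= L by rewrite lexx.
have qn1T : 4 * qint L Q1T <= n%:R.
  by rewrite qint_tr; apply: le_trans qn; rewrite ler_wpM2l// lerDl.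
have qn2 : 4 * qint L Q2 <= n%:R by apply: le_trans qn; rewrite ler_wpM2l// lerDr.
have [ha ha1] := kPhi_bounds L0' n0 (intm_tr i1 : intm L Q1T) qn1T zL.
have [hb hb1] := kPhi_bounds L0' n0 i2 qn2 zL.
have aK : mnorm (a n - 1%:M) <= n%:R^-1 * K.
  rewrite /a -trmx1 -linearB mnorm_tr; apply: le_trans ha1 _.
  by apply: ler_wpM2l; [rewrite invr_ge0|rewrite qint_tr Kq// lerDl].
have bK : mnorm (b n - 1%:M) <= n%:R^-1 * K.
  apply: le_trans hb1 _.
  by apply: ler_wpM2l; [rewrite invr_ge0|rewrite Kq// lerDr].
rewrite {1}E; apply: le_trans (mnormB _ _) _; rewrite /z; apply: lerD.
  have -> : a n *m TD *m b n = - X n + expR (- n%:R * L) *: Y by rewrite XE opprD opprK subrK.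
  apply: le_trans (mnormD _ _) _; rewrite mnormN; apply: lerD; first exact: X_small.
  by rewrite mnormZ ger0_norm ?expR_ge0// ler_wpM2l// expR_ge0.
apply: le_trans (mnormD _ _) _; rewrite mulrDr; apply: lerD.
  apply: le_trans (mnormM_le (mnormM_le aK (lexx _)) hb) _.
  by rewrite !mulrA.
apply: le_trans (mnormM_le (lexx _) bK) _.
by rewrite mulrCA.
Qed.

Theorem potentials_eq : {ae mu, forall x, 0 <= x <= L -> Q2 x = Q1 x}.
Proof.
have [N1 HN] := large_near.
have Jb al be m : (N1 <= m)%N -> `|vJ L Q1 Q2 al be m| <= Y0 * expR (- (m%:R * L)).
  move=> /HN ln; rewrite -normrN -X_int//.
  have [Y [YY0 ->]] := X_eq ln; rewrite TD_eq0 mulmx0 mul0mx oppr0 add0r mxE normrM.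
  rewrite ger0_norm ?expR_ge0// mulrC mulNr; apply: ler_wpM2r; first exact: expR_ge0.
  exact: le_trans (mnorm_entry _ _ _) YY0.
have C0 := vC_ge0 L Q1 Q2.
have vol t al be : 0 <= t -> t < L ->
  \int[mu]_x (step_weight t x * vD L Q1 Q2 al be x) +
  \int[@plane_measure R]_z (step_weight t (z.1 + z.2) *
     vol2 (vD L Q1 Q2) (vA L Q1) (vB L Q2) al be z) +
  \int[(mu \x @plane_measure R)%E]_z (step_weight t (z.1 + z.2.1 + z.2.2) *
     vol3 (vD L Q1 Q2) (vA L Q1) (vB L Q2) al be z) = 0.
  (* The sum of the three integrals is the Mikusinski limit of J, which the decay of J forces to be
     0. *)
  move=> t0 tL; apply: (mik_eq0 tL (Jb al be)); rewrite -addrA /vJ.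
  apply: mik_D; last apply: mik_D.
  - apply: (mik_int (tau := fun x : RR => x)).
    + exact: rintegrable_vD.
    + exact: measurable_id.
    + move=> x; apply: contraNT => x0; rewrite vD_supp//.
      by rewrite negb_and x0.
  - apply: (mik_int (tau := fun z : (RR * RR)%type => z.1 + z.2)).
    + exact: (rintegrable_vol2 L0 C0 (rintegrable_vD i1 i2) (measurable_vA i1) (measurable_vB i2)
        (vA_le Q2 i1) (vB_le Q1 i2)).
    + by meas.
    + move=> z; exact: (vol2_supp C0 (@vD_supp _ _ L Q1 Q2) (vA_le Q2 i1) (vB_le Q1 i2)).
  - apply: (mik_int (tau := fun z : (RR * (RR * RR))%type => z.1 + z.2.1 + z.2.2)).
    + exact: (rintegrable_vol3 L0 C0 (rintegrable_vD i1 i2) (measurable_vA i1) (measurable_vB i2)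
        (vA_le Q2 i1) (vB_le Q1 i2)).
    + by meas.
    + move=> z; exact: (vol3_supp (@vD_supp _ _ L Q1 Q2) (vA_le Q2 i1) (vB_le Q1 i2)).
have := volterra_unique L0 C0 (rintegrable_vD i1 i2) (@vD_supp _ _ L Q1 Q2) (measurable_vA i1)
  (measurable_vB i2) (vA_le Q2 i1) (vB_le Q1 i2) (fun al be t => vol t al be).
apply: (@filterS _ _ (ae_filter_ringOfSetsType mu)) => x Hx xL.
apply/matrixP => i j; apply/eqP; rewrite -subr_eq0; apply/eqP.
by have := Hx i j; rewrite /vD xL mul1r !mxE.
Qed.

End Core.

(** * From the Jost solution to the system in n *)

Section JostSolution.
Context {R : realType} {k : nat}.
Local Notation mu := (@lebesgue_measure R).
Local Notation RR := (measurableTypeR R).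

(** d' is defined only through the integral identity, so its value at H is not immediate. Its mean
    over [H, y] is 0, and on that interval it differs from d'(H) by at most the integral of |d''|,
    which tends to 0 as y decreases to H. *)
Lemma deriv_eq0 (L H : R) (d d' d'' : R -> R) : 0 <= H -> H < L -> ac L d d' -> ac L d' d'' ->
  (forall x, H <= x <= L -> d x = 0) -> d' H = 0.
Proof.
move=> H0 HL dd dd' d0; pose y m : R := H + (L - H) / m.+1%:R.
have LH : 0 < L - H by rewrite subr_gt0.
have Hy m : H < y m by rewrite ltrDl divr_gt0.
have yL m : y m <= L.
  by rewrite -lerBrDl ler_pdivrMr// ler_peMr ?(ltW LH)// ler1n.
pose h (t : RR) : R := `|chi (0 <= t <= L) * d'' t|.
have sh : rintegrable mu h := rintegrable_norm (ac_integr dd').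
have mh := rintegrable_meas sh.
pose A m : R := \int[mu]_t (chi (H <= t <= y m) * h t).
have sA m : rintegrable mu (fun t => chi (H <= t <= y m) * h t).
  apply: (rintegrable_le _ sh); first by meas.
  move=> t; rewrite normrM normr_id ler_piMl//; exact: norm_chi.
have dA m : `|d' H| <= A m.
  have yH : 0 < y m - H by rewrite subr_gt0.
  have idac : ac L (fun t => t) (fun=> 1).
    by apply: ac_C1 => z; exact: cst_continuous.
  have e1 : y m - H = \int[mu]_t (chi (H <= t <= y m) * 1) := idac.2 _ _ H0 (ltW (Hy m)) (yL m).
  have s1 := rintegrable_sub idac.1 H0 (yL m).
  have e2 : 0 = \int[mu]_t (chi (H <= t <= y m) * d' t).
    rewrite -(dd.2 _ _ H0 (ltW (Hy m)) (yL m)).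
    by rewrite (d0 (y m)) ?yL ?(ltW (Hy m))// (d0 H) ?lexx ?(ltW HL)// subrr.
  have s2 := rintegrable_sub dd.1 H0 (yL m).
  rewrite -(ler_pM2l yH) -{1}(ger0_norm (ltW yH)) -normrM mulrC {1}e1 -intZ//.
  have s3 : rintegrable mu (fun t => d' H * (chi (H <= t <= y m) * 1)) := rintegrableZ _ s1.
  rewrite -[X in `|X|]subr0 e2 -(intB s3 s2).
  rewrite [leRHS]mulrC {1}e1 -intZ//; apply: int_normr_le.
  - exact: rintegrable_meas (rintegrableB s3 s2).
  - exact: rintegrableZ.
  - move=> t; have [/andP[Ht ty]|_] := boolP (H <= t <= y m); last first.
      by rewrite !mul0r !mulr0 subrr normr0.
    rewrite /= !mul1r !mulr1 distrC (dd'.2 _ _ H0 Ht (le_trans ty (yL m))).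
    have st := rintegrable_sub dd'.1 H0 (le_trans ty (yL m)).
    apply: int_normr_le; [exact: rintegrable_meas st|exact: sA|] => s.
    rewrite /h; have [/andP[Hs sT]|_] := boolP (H <= s <= t); last first.
      by rewrite mul0r normr0 mulr_ge0//; case: (_ && _).
    by rewrite Hs (le_trans sT ty) (le_trans H0 Hs) (le_trans sT (le_trans ty (yL m))) /= !mul1r.
have A0 : A m @[m --> \oo] --> (0 : R).
  rewrite -(int0 mu); apply: (int_dom_cvg (g := h)) => //.
  - by move=> m; exact: rintegrable_meas (sA m).
  - apply: (@filterS _ _ (ae_filter_ringOfSetsType mu)) (ae_neq H) => t /eqP tneH.
    apply: cvg_near_cst; have [tH|tH|//] := ltgtP t H.
      by exists 0%N => // m _ /=; rewrite mul0r.
    exists (Num.truncn ((L - H) / (t - H))) => // m /= tm.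
    rewrite /y (_ : t <= _ = false) ?andbF ?mul0r//; apply/negbTE; rewrite -ltNge.
    have tH' : 0 < t - H by rewrite subr_gt0.
    rewrite -ltrBrDl ltr_pdivrMr// mulrC -ltr_pdivrMr//.
    by apply: lt_le_trans (truncnS_gt _) _; rewrite ler_nat ltnS.
  - move=> m t; rewrite normrM normr_id ler_piMl//; exact: norm_chi.
apply/normr0_eq0/eqP; rewrite eq_le normr_ge0 andbT.
rewrite -(cvg_lim (@Rhausdorff R) A0); apply: limr_ge; first by apply/cvg_ex; eexists; exact: A0.
by exists 0%N => // m _; exact: dA.
Qed.

Lemma ac_shift_expR L c d : ac L (fun t : R => expR (c * (t - d))) (fun t => c * expR (c * (t - d))).
Proof.
have E t : expR (c * (t - d)) = expR (- c * d) * expR (c * t) by rewrite -expRD; congr expR; ring.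
apply: ac_ext (ac_Z (expR (- c * d)) (ac_expR L c)) => t _; first by rewrite E.
by rewrite E mulrCA.
Qed.

(** Here p = e^{-2 xi x} u', with the exponents merged into - xi (x + L); the sum is written as
    [x - - L] to match [ac_shift_expR]. *)
Lemma jost_sol L xi (Q F F' F'' : R -> 'M[R]_k) : intm L Q -> acm L F F' -> acm L F' F'' ->
  {ae mu, forall t, 0 < t <= L -> F'' t = Q t *m F t + xi ^+ 2 *: F t} ->
  sol L (2 * xi) Q (fun x => expR (xi * (x - L)) *: F x)
    (fun x => expR (- xi * (x - - L)) *: (F' x + xi *: F x)).
Proof.
move=> iQ FF FF' ode; split.
  apply: acm_ext (acm_scale (ac_shift_expR L xi L) FF) => t _ //.
  rewrite scalerA -expRD (_ : 2 * xi * t + _ = xi * (t - L)); last by ring.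
  by rewrite scalerDr [RHS]addrC scalerA (mulrC xi).
pose u x := expR (xi * (x - L)) *: F x.
have Fx := acm_D FF' (acm_scale (ac_cst L xi) FF).
have P := acm_scale (ac_shift_expR L (- xi) (- L)) Fx.
have U := acm_scale (ac_shift_expR L xi L) FF.
have iQu : intm L (fun x => Q x *m u x) := intm_M U iQ.
move=> i j; apply: (ac_ae _ _ (P i j)).
  have mq := rintegrable_meas (iQu i j).
  rewrite (_ : (fun _ => _) = (fun t : RR => expR (- (2 * xi) * t) *
     (chi (0 <= t <= L) * (Q t *m u t) i j))); last first.
    by apply/funext => t; rewrite [X in chi _ * X]mxE mulrCA.
  by meas.
apply: (@filterS _ _ (ae_filter_ringOfSetsType mu)) ode => t ode t0.
move: (ode t0) => ->; congr (fun_of_matrix _ i j).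
rewrite scale0r add0r -scalemxAr scalerA -expRD (_ : - (2 * xi) * t + _ = - xi * (t - - L)); last by ring.
set e := expR _; set M := Q t *m F t.
by clearbody e M; apply/matrixP => i' j'; rewrite !mxE; ring.
Qed.

(** Backward uniqueness as a by-product of the a priori bounds; it serves to show that the imaginary
    part of the Jost solution vanishes at 0. *)
Lemma sol_eq0 L n (Q u p : R -> 'M[R]_k) : 0 <= L -> 0 < n -> intm L Q -> sol L n Q u p ->
  4 * qint L Q <= n -> u L = 0 -> p L = 0 -> u 0 = 0 /\ p 0 = 0.
Proof.
move=> L0 n0 iQ S qn u0 p0; have zL : 0 <= (0 : R) <= L by rewrite lexx.
split; apply: mnorm_eq0.
  by apply: le_trans (sol_bound L0 n0 iQ S qn zL) _; rewrite u0 p0 scaler0 mnorm0 !mulr0 addr0.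
apply: le_trans (sol_du0 L0 n0 iQ S qn) _.
by rewrite u0 p0 scaler0 mnorm0 !mulr0 addr0 mul0r addr0.
Qed.
End JostSolution.

Local Open Scope complex_scope.

(** * Real and imaginary parts, and the data at real xi *)

Section Interface.
Context {R : realType}.
Local Notation mu := (@lebesgue_measure R).
Local Notation RR := (measurableTypeR R).

Lemma ReMl (a : R) (z : R[i]) : complex.Re (a%:C * z) = a * complex.Re z.
Proof. by case: z => x y /=; rewrite mul0r subr0. Qed.

Lemma ImMl (a : R) (z : R[i]) : complex.Im (a%:C * z) = a * complex.Im z.
Proof. by case: z => x y /=; rewrite mul0r addr0. Qed.

Lemma map_Re_mul m n p (A : 'M[R]_(m, n)) (B : 'M[R[i]]_(n, p)) :
  map_mx (@complex.Re R) (map_mx (real_complex R) A *m B) = A *m map_mx (@complex.Re R) B.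
Proof.
apply/matrixP => i j; rewrite !mxE raddf_sum; apply: eq_bigr => l _.
by rewrite [in LHS]mxE [in RHS]mxE; exact: ReMl.
Qed.

Lemma map_Im_mul m n p (A : 'M[R]_(m, n)) (B : 'M[R[i]]_(n, p)) :
  map_mx (@complex.Im R) (map_mx (real_complex R) A *m B) = A *m map_mx (@complex.Im R) B.
Proof.
apply/matrixP => i j; rewrite !mxE raddf_sum; apply: eq_bigr => l _.
by rewrite [in LHS]mxE [in RHS]mxE; exact: ImMl.
Qed.

Lemma ac_deriv_Re L (f g : R -> R[i]) : 0 <= L -> ac_deriv f g ->
  ac L (fun t => complex.Re (f t)) (fun t => complex.Re (g t)).
Proof.
move=> L0 fg; split.
  by apply/rintegrable_itv; have [] := fg 0 L (lexx 0) L0.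
move=> x y x0 xy _; have [_ _ E] := fg x y x0 xy.
by rewrite chi_itv -raddfB E.
Qed.

Lemma ac_deriv_Im L (f g : R -> R[i]) : 0 <= L -> ac_deriv f g ->
  ac L (fun t => complex.Im (f t)) (fun t => complex.Im (g t)).
Proof.
move=> L0 fg; split.
  by apply/rintegrable_itv; have [] := fg 0 L (lexx 0) L0.
move=> x y x0 xy _; have [_ _ E] := fg x y x0 xy.
by rewrite chi_itv -raddfB E.
Qed.

Lemma ord2 (i : 'I_2) : i = 0 \/ i = 1.
Proof. by case: i => [[|[|//]] ?]; [left|right]; apply/val_inj. Qed.

Lemma mx2E (T : Type) (a b c d : T) : (mx2 a b c d 0 0 = a) * (mx2 a b c d 0 1 = b) *
  (mx2 a b c d 1 0 = c) * (mx2 a b c d 1 1 = d).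
Proof. by rewrite /mx2 !mxE /=. Qed.

Lemma mx2_ext (T : Type) (A B : 'M[T]_2) : A 0 0 = B 0 0 -> A 0 1 = B 0 1 -> A 1 0 = B 1 0 ->
  A 1 1 = B 1 1 -> A = B.
Proof.
by move=> h1 h2 h3 h4; apply/matrixP => i j; case: (ord2 i) (ord2 j) => -> [] ->.
Qed.

Lemma quasi_momentum_real (b : background R) m q x : 0 < omega b -> 0 < mu0 b ->
  quasi_momentum b m q -> xiS b < x ->
  exists s, [/\ 0 < s, q x%:C = 0 +i* s & s ^+ 2 = x ^+ 2 - omega b ^+ 2 / m].
Proof.
move=> w0 m0 [_ qE qp _] xx; have S0 : 0 < xiS b by rewrite divr_gt0 ?sqrtr_gt0.
have [re im] := qp x xx.
have Kx : K b x%:C.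
  by split=> /=; [case=> _ /andP[_]; rewrite leNgt xx|apply/eqP; rewrite gt_eqF// (lt_trans S0)].
exists (complex.Im (q x%:C)); split=> //; first by rewrite -re; case: (q _).
have := qE _ Kx; case: (q _) re im => u v /= -> _ /(congr1 (@complex.Re R)) /=.
rewrite !expr2 /= => E.
lra.
Qed.

Lemma cexp_real (p x : R) : cexp ('i * x%:C * (0 +i* p)) = (expR (- p * x))%:C.
Proof.
have -> : 'i * x%:C * (0 +i* p) = (- p * x)%:C by simpc; rewrite [x * p]mulrC.
by rewrite /cexp /= cos0 sin0 mulr1 mulr0.
Qed.

End Interface.

(** * The background Jost solution and its logarithmic derivative at H *)

Section Background.
Context {R : realType}.
Local Notation mu := (@lebesgue_measure R).
Local Notation RR := (measurableTypeR R).

Lemma mx2_mul (a b c d a' b' c' d' : R) : mx2 a b c d *m mx2 a' b' c' d' =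
  mx2 (a * a' + b * c') (a * b' + b * d') (c * a' + d * c') (c * b' + d * d').
Proof.
have E (A B : 'M[R]_2) i j : (A *m B) i j = A i 0 * B 0 j + A i 1 * B 1 j.
  by rewrite mxE !big_ord_recl big_ord0 addr0; congr (_ + A i _ * B _ j); apply/val_inj.
by apply: mx2_ext; rewrite E !mx2E.
Qed.

Lemma det_mx2 (a b c d : R) : \det (mx2 a b c d) = a * d - b * c.
Proof.
rewrite (expand_det_row _ 0) !big_ord_recl big_ord0 addr0 /cofactor !det_mx11.
rewrite /row' /col' !mxE /= addn0 expr0 expr1; ring.
Qed.

Lemma mx2_unit (a b c d : R) : a * d - b * c != 0 -> mx2 a b c d \in unitmx.
Proof. by move=> h; rewrite unitmxE det_mx2 unitfE. Qed.

(** A class closed under differentiation that contains the background solution at real xi: affine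
    for the P column, constant for the S column, with one decay rate per column. *)
Definition affexp (al be : 'M[R]_2) (c : 'I_2 -> R) (x : R) : 'M[R]_2 :=
  \matrix_(i, j) ((al i j * x + be i j) * expR (c j * x)).

Lemma acm_affexp L al be c : acm L (affexp al be c)
  (affexp (\matrix_(i, j) (c j * al i j)) (\matrix_(i, j) (al i j + c j * be i j)) c).
Proof.
move=> i j.
have lin : ac L (fun t : R => al i j * t + be i j) (fun=> al i j * 1 + 0).
  apply: ac_D; last exact: ac_cst.
  by apply: ac_Z; apply: ac_C1 => z; exact: cst_continuous.
apply: ac_ext (ac_mul lin (ac_expR L (c j))) => t _; rewrite !mxE//.
ring.
Qed.

Variables (b : background R) (pP pS xi : R).
Local Notation H := (depth b).
Local Notation k0 := (mu0 b / omega b ^+ 2).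
Local Notation G := (GH b)^T.

Definition jost_c (j : 'I_2) : R := if j == 0 then - pP else - pS.

Definition jost_al : 'M[R]_2 :=
  mx2 (- (c0 b / 2) * GH b 0 0) 0 (- (c0 b / 2) * GH b 0 1) 0.

Definition jost_be : 'M[R]_2 :=
  mx2 (c0 b / 2 * GH b 0 0 * H + GH b 1 0 - k0 * pP * GH b 0 0) (- (k0 * xi * GH b 0 0))
      (c0 b / 2 * GH b 0 1 * H + GH b 1 1 - k0 * pP * GH b 0 1) (- (k0 * xi * GH b 0 1)).

Definition jost0 := affexp jost_al jost_be jost_c.

Definition djost0 := affexp (\matrix_(i, j) (jost_c j * jost_al i j))
  (\matrix_(i, j) (jost_al i j + jost_c j * jost_be i j)) jost_c.

Lemma F0_real x : F0 b (0 +i* pP) (0 +i* pS) xi%:C x = map_mx (real_complex R) (jost0 x).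
Proof.
rewrite /F0; cbv zeta; rewrite !cexp_real /g21 /g22 -fmorphV -rmorphM.
by apply: mx2_ext; rewrite !mxE /jost_c /=; simpc; congr (_ +i* _); ring.
Qed.

Definition jost_exp : 'M[R]_2 := mx2 (expR (- pP * H)) 0 0 (expR (- pS * H)).

(** The matrix rho with F'(H) + xi F(H) = rho F(H). In the basis given by the transpose of [GH] it
    is triangular, and it depends on the background and xi only, not on the perturbation. *)
Definition jost_rho : 'M[R]_2 :=
  G *m mx2 (xi - pS) (- (c0 b / 2) + k0 * (pP * (pP - pS))) 0 (xi - pP) *m invmx G.

Lemma GT_mx2 : G = mx2 (GH b 0 0) (GH b 1 0) (GH b 0 1) (GH b 1 1).
Proof. by apply: mx2_ext; rewrite mxE !mx2E. Qed.

Lemma jost0_H : jost0 H = G *m mx2 (- (k0 * pP)) (- (k0 * xi)) 1 0 *m jost_exp.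
Proof.
rewrite GT_mx2 /jost_exp !mx2_mul.
by apply: mx2_ext; rewrite !mxE /jost_c /=; ring.
Qed.

Lemma djost0_H : GH b \in unitmx -> djost0 H + xi *: jost0 H = jost_rho *m jost0 H.
Proof.
move=> Gu; rewrite /jost_rho [in RHS]jost0_H -!mulmxA mulKmx ?unitmx_tr//.
rewrite GT_mx2 /jost_exp !mx2_mul.
by apply: mx2_ext; rewrite !mxE /jost_c /=; ring.
Qed.

Lemma jost0_unit : GH b \in unitmx -> 0 < xi -> 0 < mu0 b -> 0 < omega b -> jost0 H \in unitmx.
Proof.
move=> Gu xi0 m0 w0; rewrite jost0_H !unitmx_mul unitmx_tr Gu /=; apply/andP; split.
  apply: mx2_unit; rewrite mulr0 sub0r mulr1 opprK gt_eqF// mulr_gt0// divr_gt0// exprn_gt0//.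
by apply: mx2_unit; rewrite mulr0 subr0 gt_eqF// mulr_gt0// expR_gt0.
Qed.

(** Although pP and pS grow like xi, the entries stay bounded: xi - pP and xi - pS are controlled by
    xi^2 - pP^2 = cP and xi^2 - pS^2 = cS, and |pP (pP - pS)| <= |pP^2 - pS^2| = |cS - cP|. *)
Lemma jost_rho_le (cP cS : R) : 0 <= cP -> 0 <= cS -> 1 <= xi -> 0 < pP -> 0 < pS ->
  pP ^+ 2 = xi ^+ 2 - cP -> pS ^+ 2 = xi ^+ 2 - cS -> 0 <= k0 ->
  mnorm jost_rho <= mnorm G *
   (2 * (2 * (cP + cS + `|c0 b / 2| + k0 * (cP + cS)))) * mnorm (invmx G).
Proof.
move=> cP0 cS0 xi1 pP0 pS0 EP ES k00.
have kc : 0 <= k0 * (cP + cS) by rewrite mulr_ge0// addr_ge0.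
have c00 := normr_ge0 (c0 b / 2).
have dP : 0 <= xi - pP <= cP by apply/andP; split; nra.
have dS : 0 <= xi - pS <= cS by apply/andP; split; nra.
have dPS : `|pP * (pP - pS)| <= cP + cS.
  have E : pP ^+ 2 - pS ^+ 2 = cS - cP by rewrite EP ES; ring.
  rewrite normrM (gtr0_norm pP0).
  have E2 : `|pP - pS| * (pP + pS) = `|cS - cP|.
    by rewrite -{1}(gtr0_norm (addr_gt0 pP0 pS0)) -normrM -E; congr `|_|; ring.
  apply: (@le_trans _ _ (`|pP - pS| * (pP + pS))).
    by rewrite mulrC ler_wpM2l// lerDl ltW.
  rewrite E2; apply: le_trans (ler_normB _ _) _; rewrite !ger0_norm//; lra.
apply: mnormM_le => //; apply: mnormM_le => //.
apply: le_trans (mnorm_le _) _; last by apply: lexx.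
move=> i j; case: (ord2 i) (ord2 j) => -> [] ->; rewrite mx2E.
- rewrite ger0_norm; lra.
- apply: le_trans (ler_normD _ _) _; rewrite normrN (normrM k0) (ger0_norm k00).
  have := ler_wpM2l k00 dPS; lra.
- rewrite normr0; lra.
- rewrite ger0_norm; lra.
Qed.

End Background.

(** * The Jost solution at real xi is real *)

Section Jost.
Context {R : realType}.
Local Notation mu := (@lebesgue_measure R).
Local Notation RR := (measurableTypeR R).
Local Notation toC := (map_mx (real_complex R)).
Local Notation mRe := (map_mx (@complex.Re R)).
Local Notation mIm := (map_mx (@complex.Im R)).
Variables (b : background R) (p : problem R).
Local Notation H := (depth b).
Hypothesis H0 : 0 < H.


Definition total_pot (x : R) := Q0 b x + pot p x.

Lemma intm_total_pot : admissible b p -> intm H total_pot.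
Proof.
move=> [_ _ iV]; apply: intm_D; last by move=> i j; apply/rintegrable_itv; exact: iV.
have idac : ac H (fun t : R => t) (fun=> 1) by apply: ac_C1 => z; exact: cst_continuous.
have i1 : intm H (fun=> 1%:M : 'M[R]_2).
  move=> i j; apply: rintegrable_eq (rintegrableZ ((1%:M : 'M[R]_2) i j) idac.1) => t.
  by rewrite mulr1 mulrC.
have E x : Q0 b x = Q0 b 0 + x *: (Q0 b 1 - Q0 b 0).
  by rewrite /Q0 /g21 /g22; apply: mx2_ext; rewrite !mxE /=; ring.
have := intm_M (acm_D (acm_cst H (Q0 b 0)) (acm_scale idac (acm_cst H (Q0 b 1 - Q0 b 0)))) i1.
by move=> I i j; apply: rintegrable_eq (I i j) => t; rewrite mul1mx -E.
Qed.

Variables (pP pS xi : R) (F F' : R -> 'M[R[i]]_2).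
Hypotheses (xi0 : 0 < xi) (iQ : intm H total_pot) (qxi : 4 * qint H total_pot <= 2 * xi)
  (JF : is_jost b p (0 +i* pP) (0 +i* pS) xi%:C F F').

Let opp_sqr_real : - xi%:C ^+ 2 = (- xi ^+ 2)%:C.
Proof. by rewrite rmorphN rmorphXn. Qed.

(** The potential and xi^2 are real, so the real and imaginary parts decouple. *)
Lemma jost_ode_Re : exists F'' : R -> 'M[R]_2,
  [/\ forall L, 0 <= L -> acm L (fun x => mRe (F x)) (fun x => mRe (F' x)),
      forall L, 0 <= L -> acm L (fun x => mRe (F' x)) F''
    & {ae mu, forall t, 0 < t <= H ->
        F'' t = total_pot t *m mRe (F t) + xi ^+ 2 *: mRe (F t)}].
Proof.
have [FF [F'' [FF' ode]] _] := JF; exists (fun x => mRe (F'' x)); split.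
- by move=> L L0 i j; apply: ac_ext (ac_deriv_Re L0 (FF i j)) => t _; rewrite mxE.
- by move=> L L0 i j; apply: ac_ext (ac_deriv_Re L0 (FF' i j)) => t _; rewrite mxE.
- apply: (@filterS _ _ (ae_filter_ringOfSetsType mu)) ode => t + /andP[t0 _] => /(_ t0).
  rewrite -/(total_pot t) => /(congr1 mRe).
  rewrite map_mxD map_mxN map_Re_mul; move: (_ *m _) => M E.
  apply/matrixP => i j; have := congr1 (fun Z : 'M[R]_2 => Z i j) E.
  by rewrite opp_sqr_real !mxE; case: (F t i j) => x y /= E'; lra.
Qed.

Lemma jost_ode_Im : exists F'' : R -> 'M[R]_2,
  [/\ forall L, 0 <= L -> acm L (fun x => mIm (F x)) (fun x => mIm (F' x)),
      forall L, 0 <= L -> acm L (fun x => mIm (F' x)) F''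
    & {ae mu, forall t, 0 < t <= H ->
        F'' t = total_pot t *m mIm (F t) + xi ^+ 2 *: mIm (F t)}].
Proof.
have [FF [F'' [FF' ode]] _] := JF; exists (fun x => mIm (F'' x)); split.
- by move=> L L0 i j; apply: ac_ext (ac_deriv_Im L0 (FF i j)) => t _; rewrite mxE.
- by move=> L L0 i j; apply: ac_ext (ac_deriv_Im L0 (FF' i j)) => t _; rewrite mxE.
- apply: (@filterS _ _ (ae_filter_ringOfSetsType mu)) ode => t + /andP[t0 _] => /(_ t0).
  rewrite -/(total_pot t) => /(congr1 mIm).
  rewrite map_mxD map_mxN map_Im_mul; move: (_ *m _) => M E.
  apply/matrixP => i j; have := congr1 (fun Z : 'M[R]_2 => Z i j) E.
  by rewrite opp_sqr_real !mxE; case: (F t i j) => x y /= E'; lra.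
Qed.

(** The imaginary part vanishes for x >= H, so by [deriv_eq0] its derivative vanishes at H, and
    backward uniqueness makes both vanish at 0. The real part yields the solution u of the system,
    with data at H read off the background. *)
Lemma jost_real_sol : exists A A' : 'M[R]_2, exists u q,
  [/\ F 0 = toC A, F' 0 = toC A' & sol H (2 * xi) total_pot u q] /\
  [/\ u H = jost0 b pP pS xi H,
      expR (2 * xi * H) *: q H = djost0 b pP pS xi H + xi *: jost0 b pP pS xi H,
      u 0 = expR (- xi * H) *: A & q 0 = expR (- xi * H) *: (A' + xi *: A)].
Proof.
have H0' := ltW H0; have HH1 : H < H + 1 by rewrite ltrDl.
(* The derivative at H is identified from the right, so the equation is used on a slightly longer
   interval; the length 1 is arbitrary. *)
have H10 : 0 <= H + 1 by rewrite addr_ge0.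
have [FE FHE] : (forall x, H <= x -> mRe (F x) = jost0 b pP pS xi x) /\
    (forall x, H <= x -> mIm (F x) = 0).
  have [_ _ E] := JF; split=> x Hx; rewrite E// F0_real; apply/matrixP => i j; rewrite !mxE//.
have [Fr'' [FFr FFr' oder]] := jost_ode_Re.
have [Fi'' [FFi FFi' odei]] := jost_ode_Im.
have Fr'H : mRe (F' H) = djost0 b pP pS xi H.
  apply/eqP; rewrite -subr_eq0; apply/eqP/matrixP => i j.
  have h1 := acm_D (FFr _ H10) (acm_N (acm_affexp (H + 1) (jost_al b) (jost_be b pP xi) (jost_c pP pS))).
  have h2 := acm_D (FFr' _ H10) (acm_N (acm_affexp (H + 1)
    (\matrix_(i, j) (jost_c pP pS j * jost_al b i j))
    (\matrix_(i, j) (jost_al b i j + jost_c pP pS j * jost_be b pP xi i j)) (jost_c pP pS))).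
  rewrite [RHS]mxE; apply: (deriv_eq0 H0' HH1 (h1 i j) (h2 i j)) => x /andP[Hx _].
  by rewrite FE// subrr mxE.
have Fi'H : mIm (F' H) = 0.
  apply/matrixP => i j; rewrite [RHS]mxE.
  apply: (deriv_eq0 H0' HH1 (FFi _ H10 i j) (FFi' _ H10 i j)) => x /andP[Hx _].
  by rewrite FHE// mxE.
have Si := jost_sol iQ (FFi _ H0') (FFi' _ H0') odei.
have n0 : 0 < 2 * xi by rewrite mulr_gt0.
have [Fi0 Fi'0] : mIm (F 0) = 0 /\ mIm (F' 0) = 0.
  have [] := sol_eq0 H0' n0 iQ Si qxi.
  - by rewrite FHE// scaler0.
  - by rewrite FHE// Fi'H scaler0 addr0 scaler0.
  - move=> /eqP; rewrite scaler_eq0 gt_eqF ?expR_gt0//= => /eqP -> /eqP.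
    by rewrite scaler_eq0 gt_eqF ?expR_gt0//= scaler0 addr0 => /eqP.
have realE (Z : 'M[R[i]]_2) : mIm Z = 0 -> Z = toC (mRe Z).
  move=> Z0; apply/matrixP => i j; have := congr1 (fun M : 'M[R]_2 => M i j) Z0.
  by rewrite !mxE; case: (Z i j) => x y /= ->.
have Sr := jost_sol iQ (FFr _ H0') (FFr' _ H0') oder.
exists (mRe (F 0)), (mRe (F' 0)); do 2 eexists; split; split; [exact: realE|exact: realE|exact: Sr|..].
- by rewrite /= subrr mulr0 expR0 scale1r FE.
- rewrite /= scalerA -expRD (_ : _ + _ = 0) ?expR0 ?scale1r ?Fr'H ?FE//; ring.
- by rewrite /= sub0r mulrN mulNr.
- by rewrite /= sub0r opprK.
Qed.

End Jost.

(** * The Weyl matrix at large real xi *)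

Section Weyl.
Context {R : realType}.
Local Notation mu := (@lebesgue_measure R).
Local Notation RR := (measurableTypeR R).
Local Notation toC := (map_mx (real_complex R)).

Lemma sol_mulr k L n (Q u q : R -> 'M[R]_k) (Z : 'M[R]_k) : sol L n Q u q ->
  sol L n Q (fun x => u x *m Z) (fun x => q x *m Z).
Proof.
move=> [uu qq]; split.
  by apply: acm_ext (acm_M uu (acm_cst L Z)) => // t _; rewrite mulmx0 addr0 scalemxAl.
by apply: acm_ext (acm_M qq (acm_cst L Z)) => // t _; rewrite mulmx0 addr0 -scalemxAl mulmxA.
Qed.

(** At leading order the determinant is xi^2 (1 - 2 tau t12) = kap xi^2: the diagonal contributes
    xi^2, and the entry 2 tau xi^2 meets the constant t12 across the diagonal. *)
Lemma weyl_denominator_unit (t11 t12 tau c kap : R) : 0 < kap -> 0 < tau ->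
  2 * tau * t12 = 1 - kap ->
  exists eps N, 0 < eps /\ forall xi (r : 'M[R]_2), N <= xi -> mnorm r <= eps ->
    r - xi%:M + mx2 t11 t12 (tau * (2 * xi ^+ 2 - c)) 0 \in unitmx.
Proof.
move=> kap0 tau0 E.
pose C1 : R := 2 + `|t11|.
pose C2 : R := (1 + `|t11|) * 1 + (1 + `|t12|) * (1 + `|tau * c|).
have C10 : 0 <= C1 by rewrite addr_ge0.
have C20 : 0 <= C2 by rewrite addr_ge0// mulr_ge0// addr_ge0.
(* Only the upper right entry of r meets the factor 2 tau xi^2, so the bound kap / (4 tau) costs at
   most half of kap xi^2; the bound 1 controls the other entries. What is left must exceed C1 xi +
   C2, and the summand 1 in the threshold gives strictness and xi >= 1. *)
exists (Num.min 1 (kap / (4 * tau))), (2 * (C1 + C2) / kap + 1); split.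
  by rewrite lt_min ltr01 divr_gt0// mulr_gt0.
move=> xi r xiN; rewrite le_min => /andP[r1 rk].
have {}r1 i j : `|r i j| <= 1 := le_trans (mnorm_entry r i j) r1.
have {}rk : `|r 0 1| <= kap / (4 * tau) := le_trans (mnorm_entry r 0 1) rk.
have -> : r - xi%:M + mx2 t11 t12 (tau * (2 * xi ^+ 2 - c)) 0 =
    mx2 (r 0 0 - xi + t11) (r 0 1 + t12) (r 1 0 + tau * (2 * xi ^+ 2 - c)) (r 1 1 - xi).
  by apply: mx2_ext; rewrite !mxE /= ?mulr1n ?mulr0n ?subr0 ?addr0.
apply: mx2_unit.
set a := r 0 0; set d := r 0 1; set e := r 1 0; set f := r 1 1.
have -> : (a - xi + t11) * (f - xi) - (d + t12) * (e + tau * (2 * xi ^+ 2 - c)) =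
   xi ^+ 2 * (1 - 2 * tau * t12 - 2 * tau * d) - xi * (a + t11 + f) +
   ((a + t11) * f - (d + t12) * (e - tau * c)) by ring.
rewrite E gt_eqF//.
have kd : 2 * tau * d <= kap / 2.
  have := le_trans (ler_norm d) rk; rewrite ler_pdivlMr; last by rewrite mulr_gt0.
  by move=> h; lra.
have h1 : a + t11 + f <= C1.
  by have := le_trans (ler_norm _) (r1 0 0); have := le_trans (ler_norm _) (r1 1 1); have := ler_norm t11; rewrite /C1 /a /f; lra.
have h2 : - C2 <= (a + t11) * f - (d + t12) * (e - tau * c).
  apply: lerNnormlW; rewrite /C2; apply: le_trans (ler_normB _ _) _; rewrite !normrM; apply: lerD.
    apply: ler_pM => //; last exact: r1.
    by apply: le_trans (ler_normD _ _) _; apply: lerD => //; exact: r1.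
  apply: ler_pM => //.
    by apply: le_trans (ler_normD _ _) _; apply: lerD => //; exact: r1.
  by apply: le_trans (ler_normB _ _) _; rewrite -normrM; apply: lerD => //; exact: r1.
have xi1 : 1 <= xi by apply: le_trans xiN; rewrite lerDr divr_ge0 ?(ltW kap0)// mulr_ge0// addr_ge0.
have xik : 2 * (C1 + C2) < kap * xi.
  by rewrite [kap * xi]mulrC -ltr_pdivrMr//; apply: lt_le_trans xiN; rewrite ltrDl.
have xi2 : xi * (2 * (C1 + C2)) < xi * (kap * xi) by rewrite ltr_pM2l//; lra.
have xi3 : xi * (a + t11 + f) <= xi * C1 by rewrite ler_wpM2l//; lra.
have xi4 : C2 <= xi * C2 by rewrite ler_peMl.
have xi5 : xi ^+ 2 * (2 * tau * d) <= xi ^+ 2 * (kap / 2) by rewrite ler_wpM2l// sqr_ge0.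
have -> : xi ^+ 2 * (1 - (1 - kap) - 2 * tau * d) = xi * (kap * xi) - xi ^+ 2 * (2 * tau * d) by ring.
have e5 : xi ^+ 2 * (kap / 2) = xi * (kap * xi) / 2 by field.
rewrite e5 in xi5; lra.
Qed.

Lemma invmx_cancel (A W : 'M[R]_2) : W \in unitmx -> A \in unitmx ->
  A *m invmx (W *m A) = invmx W.
Proof.
move=> Wu Au; rewrite -[LHS](mulKmx Wu) (mulmxA W) mulmxV ?mulmx1//.
by rewrite unitmx_mul Wu.
Qed.

Variables (b : background R) (qP qS : R[i] -> R[i]).
Hypotheses (w0 : 0 < omega b) (H0 : 0 < depth b) (m0 : 0 < mu0 b)
  (lame0 : 0 < 2 * mu0 b + 3 * lambda0 b) (ms0 : 0 < mu_s b) (Gu : GH b \in unitmx)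
  (bP : is_qP b qP) (bS : is_qS b qS).
Local Notation H := (depth b).

Definition ThetaR (p : problem R) (xi : R) : 'M[R]_2 :=
  let ddinvmu := - (ddmu_s p / mu_s b ^+ 2) + 2 * dmu_s b ^+ 2 / mu_s b ^+ 3 in
  mx2 (- (dmu_s b / mu_s b)) ((2 * mu0 b)^-1 * (mu_s b ^+ 2 / (lambda_s p + 2 * mu_s b)))
    (mu0 b / mu_s b * (2 * xi ^+ 2 - (omega b ^+ 2 / mu_s b + mu_s b * ddinvmu))) 0.

Lemma Theta_real p xi : Theta b p xi%:C = toC (ThetaR p xi).
Proof.
rewrite /Theta /ThetaR; cbv zeta; rewrite -rmorphXn.
by apply: mx2_ext; rewrite !mxE /=; simpc; congr (_ +i* _); ring.
Qed.

Let pP (xi : R) := complex.Im (qP xi%:C).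
Let pS (xi : R) := complex.Im (qS xi%:C).

Definition rho_at xi := jost_rho b (pP xi) (pS xi) xi.

Let cP := omega b ^+ 2 / (lambda0 b + 2 * mu0 b).
Let cS := omega b ^+ 2 / mu0 b.
Let k0 := mu0 b / omega b ^+ 2.

Definition rho_bound : R := mnorm (GH b)^T *
   (2 * (2 * (cP + cS + `|c0 b / 2| + k0 * (cP + cS)))) * mnorm (invmx (GH b)^T).

Lemma pPS xi : xiS b < xi -> [/\ 0 < pP xi, 0 < pS xi, qP xi%:C = 0 +i* pP xi,
   qS xi%:C = 0 +i* pS xi & pP xi ^+ 2 = xi ^+ 2 - cP /\ pS xi ^+ 2 = xi ^+ 2 - cS].
Proof.
move=> xx.
have [s [s1 s2 s3]] := quasi_momentum_real w0 m0 bP xx.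
have [t [t1 t2 t3]] := quasi_momentum_real w0 m0 bS xx.
by rewrite /pP /pS s2 t2.
Qed.

Lemma rho_at_le xi : xiS b < xi -> 1 <= xi -> mnorm (rho_at xi) <= rho_bound.
Proof.
move=> xx xi1; have [P0 S0 _ _ [EP ES]] := pPS xx.
have L0 : 0 < lambda0 b + 2 * mu0 b by move: lame0 m0; lra.
by apply: jost_rho_le => //; rewrite divr_ge0 ?sqr_ge0 ?(ltW L0) ?(ltW m0).
Qed.

Lemma Kplus_real xi : xiS b < xi -> Kplus b xi%:C.
Proof.
move=> xx; have S0 : 0 < xiS b by rewrite divr_gt0 ?sqrtr_gt0.
have x0 : 0 < xi by apply: lt_trans xx.
split=> //; split=> /=; last by apply/eqP; rewrite gt_eqF.
by case=> _ /andP[_]; rewrite leNgt xx.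
Qed.

(** The inverse of the Weyl matrix: the factor e^{xi (x - H)} shifts the logarithmic derivative of F
    by xi, which is subtracted here. *)
Definition weyl_core (p : problem R) (g0 q0 : 'M[R]_2) (xi : R) :=
  q0 *m invmx g0 - xi%:M + ThetaR p xi.

(** Right multiplication by the inverse of F(H) normalises g(H) = 1, turns the data at H into
    [rho_at xi], and drops out of q(0) g(0)^{-1}. Invertibility is left as a premise, since the
    value of M is known only there. *)
Lemma weyl_at p M n xi : admissible b p -> is_weyl b qP qS p M -> n = 2 * xi ->
  xiS b < xi -> 1 <= xi -> 4 * qint H (total_pot b p) <= n ->
  exists g q,
    [/\ sol H n (total_pot b p) g q, g H = 1%:M & expR (n * H) *: q H = rho_at xi] /\
    (g 0 \in unitmx -> weyl_core p (g 0) (q 0) xi \in unitmx ->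
     M xi%:C = toC (invmx (weyl_core p (g 0) (q 0) xi))).
Proof.
move=> adm wM -> xx xi1 qn; have xi0 : 0 < xi by apply: lt_le_trans xi1.
have iQ := intm_total_pot adm.
have [P0 S0 EP ES _] := pPS xx.
have [F [F' [JF D]]] := wM _ (Kplus_real xx).
rewrite EP ES in JF.
have [A [A' [u [q [[FA FA' S] [uH qH u0 q0]]]]]] := jost_real_sol H0 xi0 iQ qn JF.
set J := jost0 b (pP xi) (pS xi) xi H in uH qH.
have Ju : J \in unitmx by exact: jost0_unit.
exists (fun x => u x *m invmx J), (fun x => q x *m invmx J); split.
  split; [exact: sol_mulr|by rewrite uH mulmxV|].
  by rewrite scalemxAl qH djost0_H// mulmxK.
rewrite u0 q0; set e := expR _; have e0 : e != 0 by rewrite gt_eqF// expR_gt0.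
rewrite unitmx_mul => /andP[/= eAu _].
have Au : A \in unitmx by move: eAu; rewrite unitmxZ// unitfE.
have WE : weyl_core p (e *: A *m invmx J) (e *: (A' + xi *: A) *m invmx J) xi *m A =
    A' + ThetaR p xi *m A.
  rewrite !mulmxDl mulNmx mul_scalar_mx; congr (_ + _).
  apply/eqP; rewrite subr_eq; apply/eqP.
  have -> : invmx (e *: A *m invmx J) = J *m invmx (e *: A).
    apply: (can_inj (mulKmx (_ : e *: A *m invmx J \in unitmx))).
      by rewrite unitmx_mul eAu unitmx_inv.
    by rewrite mulmxV ?unitmx_mul ?eAu ?unitmx_inv// !mulmxA mulmxKV// mulmxV.
  rewrite !mulmxA mulmxKV// invmxZ ?unitfE// -!scalemxAl -!scalemxAr -!scalemxAl.
  by rewrite scalerA mulfV// scale1r mulmxKV.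
move=> Wu; move: D; cbv zeta; rewrite FA FA' Theta_real -map_mxM -map_mxD -WE => -> .
  by rewrite -map_invmx -map_mxM invmx_cancel.
by rewrite map_unitmx unitmx_mul Wu.
Qed.

(** Supplies the invertibility asked for in [weyl_at]: for large n, g(0) is near 1 and q(0)
    g(0)^{-1} is small enough for [weyl_denominator_unit]. *)
Lemma weyl_data p M : admissible b p -> is_weyl b qP qS p M ->
  exists N, forall n, (N <= n)%N -> exists g q,
    [/\ sol H n%:R (total_pot b p) g q, g H = 1%:M,
      expR (n%:R * H) *: q H = rho_at (n%:R / 2) &
      mnorm (rho_at (n%:R / 2)) <= rho_bound] /\
    (weyl_core p (g 0) (q 0) (n%:R / 2) \in unitmx /\
     M (n%:R / 2)%:C = toC (invmx (weyl_core p (g 0) (q 0) (n%:R / 2)))).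
Proof.
move=> adm wM.
have iQ := intm_total_pot adm; have H0' := ltW H0.
have sQ := intm_mnorm iQ.
set Q := total_pot b p in iQ sQ *.
have ls0 : 0 < lambda_s p + 2 * mu_s b by have [+ _ _] := adm; move: ms0; lra.
(* This is 1 - 2 tau t12 for the entries of Theta; 2 mu(0) + 3 lambda(0) > 0 and mu(0) > 0 give
   lambda(0) + mu(0) > mu(0) / 3. *)
have kap0 : 0 < (lambda_s p + mu_s b) / (lambda_s p + 2 * mu_s b).
  by apply: divr_gt0 => //; have [+ _ _] := adm; move: ms0; lra.
have tau0 : 0 < mu0 b / mu_s b by rewrite divr_gt0.
have E : 2 * (mu0 b / mu_s b) * ((2 * mu0 b)^-1 * (mu_s b ^+ 2 / (lambda_s p + 2 * mu_s b))) =
    1 - (lambda_s p + mu_s b) / (lambda_s p + 2 * mu_s b).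
  by field; rewrite !gt_eqF.
have [eps [X [eps0 HX]]] := weyl_denominator_unit (- (dmu_s b / mu_s b))
  (omega b ^+ 2 / mu_s b + mu_s b * (- (ddmu_s p / mu_s b ^+ 2) + 2 * dmu_s b ^+ 2 / mu_s b ^+ 3))
  kap0 tau0 E.
pose V : R := mnorm (1%:M : 'M[R]_2).
pose I (n : nat) := \int[mu]_t (expR (- n%:R * t) * (chi (0 <= t <= H) * mnorm (Q t))).
(* The bound of [sol_du0] for q(0), with n^{-1} replaced by 1 in its second factor, times the bound
   2 V of [near1_inv] for the inverse of g(0). *)
pose z (n : nat) : R := (expR (- n%:R * H) * rho_bound + (2 * V + 4 * rho_bound) * I n) * (2 * V).
have z0 : z n @[n --> \oo] --> (0 : R).
  rewrite (_ : 0 = (0 * rho_bound + (2 * V + 4 * rho_bound) * 0) * (2 * V)); last by ring.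
  apply: cvgM; last exact: cvg_cst.
  apply: cvgD; first by apply: cvgM; [exact: (cvg_expL H0)|exact: cvg_cst].
  apply: cvgM; first exact: cvg_cst.
  apply: int_exp_cvg0; first exact: sQ.
  by move=> t t0; rewrite leNgt t0 /= mul0r.
suff : \forall n \near \oo, exists g q,
    [/\ sol H n%:R Q g q, g H = 1%:M,
      expR (n%:R * H) *: q H = rho_at (n%:R / 2) &
      mnorm (rho_at (n%:R / 2)) <= rho_bound] /\
    (weyl_core p (g 0) (q 0) (n%:R / 2) \in unitmx /\
     M (n%:R / 2)%:C = toC (invmx (weyl_core p (g 0) (q 0) (n%:R / 2)))).
  by move=> [N _ HN]; exists N => n /HN.
pose K1 := 2 * rho_bound + 2 * (qint H Q * (2 * V + 4 * rho_bound)).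
near=> n.
have big (c : R) : c <= n%:R / 2 = (2 * c <= n%:R) by rewrite ler_pdivlMr// mulrC.
have xx : xiS b < n%:R / 2.
  have : 2 * (xiS b + 1) <= n%:R by near: n; exact: nbhs_infty_ger.
  by rewrite -big; lra.
have xi1 : 1 <= n%:R / 2 :> R by rewrite big; near: n; exact: nbhs_infty_ger.
have qn : 4 * qint H Q <= n%:R by near: n; exact: nbhs_infty_ger.
have nE : n%:R = 2 * (n%:R / 2) :> R by field.
have [g [q [[S gH qH] HM]]] := weyl_at adm wM nE xx xi1 qn.
have rle := rho_at_le xx xi1.
have n1 : 1 <= n%:R :> R by rewrite nE; lra.
have n0 : 0 < n%:R :> R by apply: lt_le_trans n1.
have Kn : 2 * K1 <= n%:R by near: n; exact: nbhs_infty_ger.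
have g1 : mnorm (g 0 - 1%:M) <= 2^-1.
  apply: le_trans (sol_rho_bounds H0' n1 iQ qn S gH _) _; first by rewrite qH; exact: rle.
  by rewrite ler_pdivrMl// -/V -/K1; lra.
have gu := near1_unit g1; have gi := near1_inv g1.
have rb0 : 0 <= rho_bound by apply: le_trans (mnorm_ge0 _) rle.
have V0 : 0 <= V := mnorm_ge0 _.
have I0 : 0 <= I n.
  by apply: Rintegral_ge0 => t _; rewrite mulr_ge0 ?expR_ge0// mulr_ge0// mnorm_ge0.
have r_eps : mnorm (q 0 *m invmx (g 0)) <= eps.
  have zn : z n <= eps.
    near: n; move/cvgr0_norm_le: z0 => /(_ _ eps0); apply: filterS => m /=.
    exact: le_trans (ler_norm _).
  apply: le_trans zn; apply: mnormM_le => //.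
  apply: le_trans (sol_du0 H0' n0 iQ S qn) _; rewrite qH gH -/V -/(I n).
  apply: lerD; first by rewrite ler_wpM2l// expR_ge0.
  rewrite ler_wpM2r// lerD2l -mulrA ler_wpM2l//.
  by rewrite ler_pdivrMl//; apply: le_trans rle _; rewrite ler_peMl.
have Wu : weyl_core p (g 0) (q 0) (n%:R / 2) \in unitmx.
  by apply: HX r_eps; rewrite big; near: n; exact: nbhs_infty_ger.
by exists g, q; split; split=> //; exact: HM.
Unshelve. all: by end_near.
Qed.

(** The xi^2 term carries the common factor 2 mu0 / mu(0), while lambda(0) and mu''(0) enter only
    terms free of xi; so the difference may be evaluated at xi = 0. *)
Lemma ThetaR_diff p1 p2 xi xi' :
  ThetaR p2 xi - ThetaR p1 xi = ThetaR p2 xi' - ThetaR p1 xi'.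
Proof. by apply: mx2_ext; rewrite !mxE /=; ring. Qed.

Lemma weyl_potential_eq p1 p2 M1 M2 : admissible b p1 -> admissible b p2 ->
  is_weyl b qP qS p1 M1 -> is_weyl b qP qS p2 M2 ->
  (forall xi, Kplus b xi -> M2 xi = M1 xi) ->
  {ae mu, forall x : R, pot p2 x = pot p1 x}.
Proof.
move=> a1 a2 w1 w2 eqM.
have [N1 HN1] := weyl_data a1 w1; have [N2 HN2] := weyl_data a2 w2.
have [N3 _ HN3] : \forall n \near \oo, 2 * (xiS b + 1) <= n%:R :> R by exact: nbhs_infty_ger.
have data n : (maxn N1 (maxn N2 N3) <= n)%N -> exists g1 q1 g2 q2 rho,
  [/\ sol H n%:R (total_pot b p1) g1 q1, sol H n%:R (total_pot b p2) g2 q2,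
      g1 H = 1%:M & g2 H = 1%:M] /\
  [/\ expR (n%:R * H) *: q1 H = rho, expR (n%:R * H) *: q2 H = rho,
      mnorm rho <= rho_bound &
      q1 0 *m invmx (g1 0) - q2 0 *m invmx (g2 0) = ThetaR p2 0 - ThetaR p1 0].
  rewrite !geq_max => /andP[n1 /andP[n2 n3]].
  have [g1 [q1 [[S1 g1H q1H rle] [W1u M1E]]]] := HN1 n n1.
  have [g2 [q2 [[S2 g2H q2H _] [W2u M2E]]]] := HN2 n n2.
  exists g1, q1, g2, q2, (rho_at (n%:R / 2)); split; split=> //.
  have xx : xiS b < n%:R / 2.
    by have := HN3 n n3; rewrite /= mulrC -ler_pdivlMr//; lra.
  have := eqM _ (Kplus_real xx); rewrite M1E M2E => /map_mx_inj /(can_inj (@invmxK _ _)).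
  rewrite /weyl_core (ThetaR_diff p1 p2 0 (n%:R / 2)) => E.
  apply/eqP; rewrite subr_eq -subr_eq0; apply/eqP.
  apply/matrixP => i j; have := congr1 (fun Z : 'M[R]_2 => Z i j) E.
  move: (q1 0 *m _) (q2 0 *m _) => r1 r2; rewrite !mxE.
  by lra.
have := potentials_eq H0 (intm_total_pot a1) (intm_total_pot a2) data.
apply: (@filterS _ _ (ae_filter_ringOfSetsType mu)) => x Hx.
have [xH|xH] := boolP (0 <= x <= H).
  by apply: (addrI (Q0 b x)); exact: Hx.
have [_ h1 _] := a1; have [_ h2 _] := a2.
by rewrite h1 ?h2//; exact/negP.
Qed.

End Weyl.

(** Elements of L^1 are classes modulo null sets, so V_2 = V_1 reads as equality almost
    everywhere. *)
Theorem propositionV1 (R : realType) (b : background R)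
    (omega_gt0 : 0 < omega b) (depth_gt0 : 0 < depth b)
    (mu0_gt0 : 0 < mu0 b) (lame0_gt0 : 0 < 2 * mu0 b + 3 * lambda0 b)
    (mu_s_gt0 : 0 < mu_s b) (det_GH : \det (GH b) = 1)
    (qP qS : R[i] -> R[i]) (qP_branch : is_qP b qP) (qS_branch : is_qS b qS)
    (p1 p2 : problem R) (p1_adm : admissible b p1) (p2_adm : admissible b p2)
    (M1 M2 : R[i] -> 'M[R[i]]_2)
    (M1_weyl : is_weyl b qP qS p1 M1) (M2_weyl : is_weyl b qP qS p2 M2)
    (M1_A : assumptionA b M1) (M1_B : assumptionB b qS M1)
    (M2_A : assumptionA b M2) (M2_B : assumptionB b qS M2)
    (eqM : forall xi : R[i], Kplus b xi -> M2 xi = M1 xi) :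
  {ae lebesgue_measure, forall x : R, pot p2 x = pot p1 x}.
Proof.
have GHu : GH b \in unitmx by rewrite unitmxE det_GH unitr1.
exact: (weyl_potential_eq omega_gt0 depth_gt0 mu0_gt0 lame0_gt0 mu_s_gt0 GHu qP_branch qS_branch
  p1_adm p2_adm M1_weyl M2_weyl eqM).
Qed.
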